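(* Let $F(z)=\sum_{n=0}^\infty c_nz^n$ be analytic in the unit disc $\mathbb{D}$. Suppose there is a closed subset $E\subset\partial\mathbb{D}$ of linear measure zero such that $F$ has local pseudofunction boundary behavior on $\partial\mathbb{D}\setminus E$, while for each $e^{i\theta}\in E$ one has $\sum_{n=0}^Nc_ne^{in\theta}=O_\theta(1)$ as $N\to\infty$. Then $F$ has pseudofunction boundary behavior on the whole of $\partial\mathbb{D}$, that is, $c_n=o(1)$. In particular, $\sum_{n=0}^\infty c_ne^{in\theta_0}$ converges at every point $e^{i\theta_0}\in\partial\mathbb{D}$ for which there is a constant $F(e^{i\theta_0})$ such that $\frac{F(z)-F(e^{i\theta_0})}{z-e^{i\theta_0}}$ has pseudofunction boundary behavior at $z=e^{i\theta_0}$, and then $\sum_{n=0}^\infty c_ne^{in\theta_0}=F(e^{i\theta_0})$.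
   Context: Fourier transform $\hat\varphi(t)=\int e^{-itx}\varphi(x)\,\mathrm{d}x$. A tempered distribution $g$ is a pseudofunction if $\hat g\in L^\infty$ and $\hat g(x)\to0$ as $|x|\to\infty$; a distribution on an open $U\subseteq\mathbb{R}$ is a local pseudofunction on $U$ if near each point of $U$ it coincides with a pseudofunction. An analytic $H$ on $\mathbb{D}$ has local pseudofunction boundary behavior on an open arc $\{e^{i\theta}:\theta\in U\}$ ($U\subseteq\mathbb{R}$ open) if $H(re^{i\theta})$ converges in $\mathcal{D}'(U)$ as $r\to1^-$ to a local pseudofunction on $U$; at a point $e^{i\theta_0}$ if this holds for some open $U\ni\theta_0$; on all of $\partial\mathbb{D}$ if it holds with $U=\mathbb{R}$ (the limit being a $2\pi$-periodic distribution). *)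

(* Defs.v *)
From mathcomp Require Import all_boot all_algebra.
From mathcomp Require Import all_classical all_reals all_analysis.
From mathcomp Require Import complex.
Import GRing.Theory Num.Theory.
Import numFieldTopology.Exports numFieldNormedType.Exports.

Set Implicit Arguments.
Unset Strict Implicit.
Unset Printing Implicit Defensive.

Local Open Scope classical_set_scope.
Local Open Scope ring_scope.

(* The complex numbers over R, seen as a numClosedFieldType so that the
   norm-induced topology of MathComp-Analysis applies. *)
Definition Cplx (R : realType) : numClosedFieldType := R[i].

Section Defs.
Variable R : realType.
Local Notation C := (Cplx R).

Definition expi (t : R) : C := (cos t +i* sin t)%C.

Definition RtoC (x : R) : C := (x%:C)%C.

Definition cintegral (f : R -> C) : C :=
  (Rintegral lebesgue_measure setT (fun t => complex.Re (f t))
   +i* Rintegral lebesgue_measure setT (fun t => complex.Im (f t)))%C.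

Definition fourier (phi : R -> C) (x : R) : C :=
  cintegral (fun t => expi (- (x * t)) * phi t).

Definition smooth (phi : R -> C) : Prop :=
  forall (n : nat) (x : R),
    derivable (derive1n n (fun t => complex.Re (phi t))) x 1 /\
    derivable (derive1n n (fun t => complex.Im (phi t))) x 1.

Definition test_fun (U : set R) (phi : R -> C) : Prop :=
  smooth phi /\
  exists K : set R, compact K /\ K `<=` U /\ (forall x, ~ K x -> phi x = 0).

(* G is an admissible Fourier transform of a pseudofunction:
   an L^\infty function (bounded measurable representative) tending to 0 at
   +-infinity. *)
Definition pf_transform (G : R -> C) : Prop :=
  measurable_fun setT (fun x => complex.Re (G x)) /\
  measurable_fun setT (fun x => complex.Im (G x)) /\
  (exists M : R, forall x, `|G x| <= RtoC M) /\
  G x @[x --> +oo] --> (0 : C) /\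
  G x @[x --> -oo] --> (0 : C).

(* The action on a test (Schwartz) function phi of the pseudofunction g whose
   Fourier transform is G:
   <g, phi> = <\hat g, F^{-1} phi> = \int G(x) (1/2pi) \hat phi(-x) dx. *)
Definition pf_pairing (G : R -> C) (phi : R -> C) : C :=
  RtoC ((2 * pi)^-1) * cintegral (fun x => G x * fourier phi (- x)).

Definition local_pseudofunction (U : set R) (T : (R -> C) -> C) : Prop :=
  forall t0, U t0 ->
    exists V : set R, open V /\ V t0 /\ V `<=` U /\
      exists G : R -> C, pf_transform G /\
        forall phi, test_fun V phi -> T phi = pf_pairing G phi.

Definition dist_limit (H : C -> C) (U : set R) (T : (R -> C) -> C) : Prop :=
  forall phi, test_fun U phi ->
    cintegral (fun t => H (RtoC r * expi t) * phi t) @[r --> (1 : R)^'-]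
      --> T phi.

Definition lpf_boundary (H : C -> C) (U : set R) : Prop :=
  open U /\
  exists T : (R -> C) -> C, dist_limit H U T /\ local_pseudofunction U T.

Definition lpf_boundary_at (H : C -> C) (t0 : R) : Prop :=
  exists U : set R, open U /\ U t0 /\ lpf_boundary H U.

Definition pf_boundary_circle (H : C -> C) : Prop := lpf_boundary H setT.

End Defs.

(* Main.v *)
Require Import Defs.
From mathcomp Require Import all_boot all_order all_algebra.
From mathcomp Require Import all_classical all_reals all_analysis.
From mathcomp Require Import complex measurable_realfun.
From mathcomp Require Import ring lra zify.
Import Order.TTheory GRing.Theory Num.Theory.
Import numFieldTopology.Exports numFieldNormedType.Exports.
Set Implicit Arguments.
Unset Strict Implicit.
Unset Printing Implicit Defensive.
Local Open Scope classical_set_scope.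
Local Open Scope ring_scope.

(* Pairing the boundary values of [F] with [phi(t) e^{-imt}], for a smooth bump [phi], gives the
   smoothed coefficients [sum_n c_n phi^(m - n)]; call [phi] good if they tend to 0. The points
   having no neighbourhood in which all bumps are good form a closed null set [E'] contained in
   [E]. If [E'] were nonempty, Baire's theorem would give a portion of [E'] on which the partial
   sums are uniformly bounded. Cut a bump supported near that portion at scale [1 / N]: the pieces
   missing [E'] are good, the others are [o(N)] in number because [E'] is null, and each of them
   contributes [O(1 / N)] by summation by parts at a point of [E']; so the bump is good after all.
   Hence [E'] is empty and [c_n -> 0].

   Convolving [c] with a decaying kernel whose Fourier transform is constant near [t0] then
   exhibits the boundary distribution of [F] as a pseudofunction near [t0].

   For the convergence, the Taylor coefficients of [(F z - L) / (z - e^{i t0})] are, up to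
   unimodular factors, the partial sums of the series minus [L], so they should tend to 0. A
   partition of unity on the circle splits into a bump near [t0], good by hypothesis, and a
   multiple of [|e^{it} - e^{i t0}|^2], for which summation by parts brings back the
   coefficients of [F]. *)

(** * Complex numbers, limits and integrals *)

(** Nothing is known about the growth of [c] at the start, so goodness is phrased with Abel limits
    at radius [r < 1]. One point of [E'] with bounded partial sums bounds all of [c], and from there
    on the Abel limits are convergent sums. If [E'] is empty, a cutoff whose translates by [2 pi]
    sum to 1 isolates each coefficient exactly, whatever its size.

    The estimate near [E'] must hold for all [m] at once, since the scale [1 / N] is fixed before
    [m] tends to infinity. It rests on a cancellation: for a piece [g] near a point [t] of [E'],
    summation by parts produces, up to unimodular factors, transforms of [(1 - e^{i(x - t)}) g]. The
    new factor is [O(1 / N)] on the support of [g], whose length is at most [2 / N]. The product is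
    thus [O(1 / N)] with second derivative [O(N)], its transform at [k] is [O(1 / (N^2 + k^2))], and
    the sum over integers [k] is [O(1 / N)].

    The coefficients of the difference quotient may grow linearly, which is why bumps are given
    Fourier decay of order four. *)

Section ComplexModulus.
Variable R : realType.
Local Notation C := (Cplx R).
Implicit Types (z w : C) (x t : R).

(** The norm of [Cplx R] takes values in the complex type itself; its real part is the modulus as a
    real number, to which real order and real arithmetic apply. *)
Definition cabs (z : C) : R := complex.Re `|z|.

Lemma cabsE z : `|z| = RtoC (cabs z) :> C.
Proof. by []. Qed.

Lemma cabs_ge0 z : 0 <= cabs z.
Proof. by have := normr_ge0 z; rewrite cabsE -lecR. Qed.

Lemma cabsD z w : cabs (z + w) <= cabs z + cabs w.
Proof. by have := ler_normD z w; rewrite !cabsE /RtoC -rmorphD lecR. Qed.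

Lemma cabsM z w : cabs (z * w) = cabs z * cabs w.
Proof.
by have := normrM z w; rewrite !cabsE /RtoC -rmorphM => /complexI.
Qed.

Lemma cabsN z : cabs (- z) = cabs z.
Proof. by rewrite /cabs normrN. Qed.

Lemma cabsBC z w : cabs (z - w) = cabs (w - z).
Proof. by rewrite /cabs distrC. Qed.

Lemma cabsB z w : cabs (z - w) <= cabs z + cabs w.
Proof. by rewrite -(cabsN w) cabsD. Qed.

Lemma cabs0 : cabs 0 = 0.
Proof. by rewrite /cabs normr0. Qed.

Lemma cabs1 : cabs 1 = 1.
Proof. by rewrite /cabs normr1. Qed.

Lemma cabs_eq0 z : cabs z = 0 -> z = 0.
Proof. by move=> h; apply/normr0_eq0; rewrite cabsE h. Qed.

Lemma cabsX z n : cabs (z ^+ n) = cabs z ^+ n.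
Proof. by elim: n => [|n IH]; rewrite ?expr0 ?cabs1// !exprS cabsM IH. Qed.

Lemma cabsV z : cabs z^-1 = (cabs z)^-1.
Proof.
have [->|z0] := eqVneq z 0; first by rewrite invr0 cabs0 invr0.
have h : cabs z != 0 by apply: contra_neq z0; exact: cabs_eq0.
apply: (mulfI h); rewrite divff// -cabsM divff// cabs1 //.
Qed.

Lemma cabs_sqr z : cabs z ^+ 2 = complex.Re z ^+ 2 + complex.Im z ^+ 2.
Proof.
case: z => a b; rewrite /cabs /= sqr_sqrtr//.
by rewrite addr_ge0// sqr_ge0.
Qed.

Lemma cabs_RtoC x : cabs (RtoC x) = `|x|.
Proof.
apply/eqP; rewrite -(@eqrXn2 _ 2) ?cabs_ge0 ?normr_ge0//.
by rewrite cabs_sqr /= expr0n addr0 real_normK// num_real.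
Qed.

Lemma Re_le_cabs z : `|complex.Re z| <= cabs z.
Proof.
rewrite -(@ler_pXn2r _ 2) ?nnegrE ?cabs_ge0//.
by rewrite cabs_sqr real_normK ?num_real// lerDl sqr_ge0.
Qed.

Lemma Im_le_cabs z : `|complex.Im z| <= cabs z.
Proof.
rewrite -(@ler_pXn2r _ 2) ?nnegrE ?cabs_ge0//.
by rewrite cabs_sqr real_normK ?num_real// lerDr sqr_ge0.
Qed.

Lemma cabs_le_ReIm z : cabs z <= `|complex.Re z| + `|complex.Im z|.
Proof.
rewrite -(@ler_pXn2r _ 2) ?nnegrE ?cabs_ge0 ?addr_ge0//.
rewrite cabs_sqr sqrrD !real_normK ?num_real//.
by rewrite -addrAC lerDl mulrn_wge0// mulr_ge0.
Qed.

Lemma cabs_sum (I : Type) (s : seq I) (P : pred I) (f : I -> C) :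
  cabs (\sum_(i <- s | P i) f i) <= \sum_(i <- s | P i) cabs (f i).
Proof.
elim/big_ind2 : _ => [|z x w y h1 h2|//]; first by rewrite cabs0.
by apply: le_trans (cabsD _ _) _; exact: lerD.
Qed.

Lemma RtoCD x y : RtoC (x + y) = RtoC x + RtoC y.
Proof. exact: rmorphD. Qed.

Lemma RtoCM x y : RtoC (x * y) = RtoC x * RtoC y.
Proof. exact: rmorphM. Qed.

Lemma RtoCN x : RtoC (- x) = - RtoC x.
Proof. exact: rmorphN. Qed.

Lemma RtoCX x n : RtoC (x ^+ n) = RtoC x ^+ n.
Proof. exact: rmorphXn. Qed.

Lemma RtoC0 : RtoC 0 = 0 :> C.
Proof. by []. Qed.

Lemma RtoC1 : RtoC 1 = 1 :> C.
Proof. by []. Qed.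

Lemma Re_add z w : complex.Re (z + w) = complex.Re z + complex.Re w.
Proof. by case: z; case: w. Qed.

Lemma Im_add z w : complex.Im (z + w) = complex.Im z + complex.Im w.
Proof. by case: z; case: w. Qed.

Lemma Re_opp z : complex.Re (- z) = - complex.Re z.
Proof. by case: z. Qed.

Lemma Im_opp z : complex.Im (- z) = - complex.Im z.
Proof. by case: z. Qed.

Lemma Re_mul z w : complex.Re (z * w) =
  complex.Re z * complex.Re w - complex.Im z * complex.Im w.
Proof. by case: z; case: w. Qed.

Lemma Im_mul z w : complex.Im (z * w) =
  complex.Re z * complex.Im w + complex.Im z * complex.Re w.
Proof. by case: z => a b; case: w => c d; rewrite /= ; ring. Qed.

Lemma C_ext z w : complex.Re z = complex.Re w -> complex.Im z = complex.Im w ->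
  z = w.
Proof. by case: z => a b; case: w => c d /= -> ->. Qed.

Lemma expiD s t : expi (s + t) = expi s * expi t :> C.
Proof. by apply: C_ext; rewrite ?Re_mul ?Im_mul /= ?cosD ?sinD//; ring. Qed.

Lemma expi0 : expi 0 = 1 :> C.
Proof. by apply: C_ext; rewrite /= ?cos0 ?sin0. Qed.

Lemma expi_natM n t : expi (n%:R * t) = expi t ^+ n :> C.
Proof.
elim: n => [|n IH]; first by rewrite mul0r expi0.
by rewrite -addn1 natrD mulrDl mul1r expiD IH exprD expr1.
Qed.

Lemma cabs_expi t : cabs (expi t) = 1.
Proof.
apply/eqP; rewrite -(@eqrXn2 _ 2) ?cabs_ge0// cabs_sqr /= expr1n.
by rewrite cos2Dsin2.
Qed.

Lemma expi_neq0 t : expi t != 0 :> C.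
Proof.
by apply/eqP => h; have := cabs_expi t; rewrite h cabs0 => /eqP; rewrite eq_sym oner_eq0.
Qed.

Lemma expiN t : expi (- t) = (expi t)^-1 :> C.
Proof.
apply: (mulfI (expi_neq0 t)); rewrite divff ?expi_neq0//.
by rewrite -expiD subrr expi0.
Qed.

Lemma expi_periodic (t : R) (k : int) : expi (t + k%:~R * (2 * pi)) = expi t :> C.
Proof.
have h (s : R) (n : nat) : expi (s + n%:R * (2 * pi)) = expi s :> C.
  elim: n s => [|n IH] s; first by rewrite mul0r addr0.
  rewrite -(IH s) -addn1 natrD mulrDl addrA mul1r (mulr_natl pi 2).
  by rewrite -[LHS]/(cos _ +i* sin _)%C cosD2pi sinD2pi.
case: k => n; first by rewrite h.
by rewrite -[in RHS](subrK (n.+1%:R * (2 * pi)) t) h NegzE mulrNz mulNr.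
Qed.

Section Limits.
Context {T : Type}.

(* Convergence of complex functions through the real-valued modulus: going through the
   norm of [Cplx R] makes unification unfold the complex structures. *)
Definition clim (F : set_system T) (f : T -> C) (l : C) :=
  forall e : R, 0 < e -> \forall x \near F, cabs (f x - l) < e.

Context {F : set_system T} {FF : Filter F}.
Implicit Types (f g : T -> C) (l m k : C).

Lemma climP f l : clim F f l <-> f @ F --> l.
Proof.
split.
  move=> h; apply/cvgrPdist_lt => e e0.
  (* The radius of a ball for this norm is itself a complex number; being positive, it is real. *)
  have ei : e = RtoC (complex.Re e).
    by apply: C_ext => //=; rewrite ger0_Im// ltW.
  have : 0 < complex.Re e by move: e0; rewrite {1}ei ltcR.
  move=> /h; apply: filterS => x.
  by rewrite cabsE cabsBC ei ltcR.
move=> /cvgrPdist_lt h e e0.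
have /h : 0 < RtoC e by rewrite ltcR.
by apply: filterS => x; rewrite cabsE cabsBC ltcR.
Qed.

Lemma clim_ReIm f l : clim F f l <->
  (complex.Re (f u) @[u --> F] --> complex.Re l /\
   complex.Im (f u) @[u --> F] --> complex.Im l).
Proof.
split.
  move=> h; split; apply/cvgrPdist_lt => e /h; apply: filterS => x;
    apply: le_lt_trans; rewrite cabsBC.
    by have := Re_le_cabs (l - f x); rewrite Re_add Re_opp.
  by have := Im_le_cabs (l - f x); rewrite Im_add Im_opp.
move=> [/cvgrPdist_lt hr /cvgrPdist_lt hi] e e0.
have e2 : 0 < e / 2 by rewrite divr_gt0.
apply: filterS2 (hr _ e2) (hi _ e2) => x h1 h2.
rewrite cabsBC; apply: le_lt_trans (cabs_le_ReIm _) _.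
rewrite Re_add Im_add Re_opp Im_opp.
by rewrite (splitr e) ltrD.
Qed.

Lemma eq_clim f g l : (forall u, f u = g u) -> clim F f l -> clim F g l.
Proof. by move=> fg h e /h; apply: filterS => x; rewrite fg. Qed.

Lemma clim_cst l : clim F (fun=> l) l.
Proof. by move=> e e0; apply: nearW => x; rewrite subrr cabs0. Qed.

Lemma climD f g l m : clim F f l -> clim F g m ->
  clim F (fun u => f u + g u) (l + m).
Proof.
move=> fl gm e e0; have e2 : 0 < e / 2 by lra.
apply: filterS2 (fl _ e2) (gm _ e2) => u h1 h2.
rewrite opprD addrACA; apply: le_lt_trans (cabsD _ _) _; lra.
Qed.

Lemma climZ k f l : clim F f l -> clim F (fun u => k * f u) (k * l).
Proof.
move=> fl e e0; have k0 : 0 < cabs k + 1 by have := cabs_ge0 k; lra.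
apply: filterS (fl _ (divr_gt0 e0 k0)) => u h.
rewrite -mulrBr cabsM; move: h; rewrite ltr_pdivlMr// mulrC; apply: le_lt_trans.
by rewrite ler_wpM2r ?cabs_ge0//; lra.
Qed.

Lemma climB f g l m : clim F f l -> clim F g m ->
  clim F (fun u => f u - g u) (l - m).
Proof.
move=> fl gm; rewrite -mulN1r.
by apply: (eq_clim _ (climD fl (climZ (-1) gm))) => u; rewrite mulN1r.
Qed.

Lemma clim_sum (I : Type) (s : seq I) (f : I -> T -> C) (l : I -> C) :
  (forall i, clim F (f i) (l i)) ->
  clim F (fun u => \sum_(i <- s) f i u) (\sum_(i <- s) l i).
Proof.
move=> fl; elim: s => [|i s IH].
  by rewrite big_nil; apply: (eq_clim _ (clim_cst 0)) => u; rewrite big_nil.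
by rewrite big_cons; apply: (eq_clim _ (climD (fl i) IH)) => u; rewrite big_cons.
Qed.

Lemma clim_RtoC (f : T -> R) (l : R) : f @ F --> l ->
  clim F (fun u => RtoC (f u)) (RtoC l).
Proof. by move=> fl; apply/clim_ReIm; split => //=; exact: cvg_cst. Qed.

Lemma clim_squeeze f l (g : T -> R) :
  (\forall x \near F, cabs (f x - l) <= g x) -> g @ F --> (0 : R) -> clim F f l.
Proof.
move=> h /cvgrPdist_lt g0 e /g0 ge.
apply: filterS2 h ge => x h1 h2.
apply: le_lt_trans h1 _; apply: le_lt_trans h2.
by rewrite sub0r normrN ler_norm.
Qed.

End Limits.

Lemma clim_le (T : Type) (F : set_system T) {FF : ProperFilter F}
  (f : T -> C) (l : C) (e : R) :
  clim F f l -> (\forall x \near F, cabs (f x) <= e) -> cabs l <= e.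
Proof.
move=> fl fe; rewrite leNgt; apply/negP => el.
have d0 : 0 < cabs l - e by lra.
have [x [h1 h2]] := @filter_ex _ F FF _ (filterI fe (fl _ d0)).
have := cabsD (l - f x) (f x); rewrite subrK cabsBC; lra.
Qed.

Lemma clim_unique (T : Type) (F : set_system T) {FF : ProperFilter F}
  (f : T -> C) (l m : C) : clim F f l -> clim F f m -> l = m.
Proof.
move=> fl fm; apply/eqP; rewrite -subr_eq0; apply/eqP/cabs_eq0/eqP.
rewrite eq_le cabs_ge0 andbT.
apply: (clim_le (climB fl fm)); apply: nearW => x.
by rewrite subrr cabs0.
Qed.

Definition csum_cvg (w : nat -> C) (l : C) :=
  clim \oo (fun N => \sum_(0 <= n < N) w n) l.

Lemma csum_cvgP (w : nat -> C) (l : C) : csum_cvg w l <-> series w @ \oo --> l.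
Proof. exact: climP. Qed.

End ComplexModulus.

(** * Integrals of complex functions: linearity, domination, limits *)

Section ComplexIntegral.
Variable R : realType.
Local Notation C := (Cplx R).
Local Notation mu := (@lebesgue_measure R).
Implicit Types (f : R -> C) (h : R -> R).

Definition cmeas f := measurable_fun setT (fun t => complex.Re (f t)) /\
  measurable_fun setT (fun t => complex.Im (f t)).

Definition rintble h := mu.-integrable setT (EFin \o h).

Definition cintble f := rintble (fun t => complex.Re (f t)) /\
  rintble (fun t => complex.Im (f t)).

Lemma cmeasD f (g : R -> C) : cmeas f -> cmeas g -> cmeas (fun t => f t + g t).
Proof.
move=> [f1 f2] [g1 g2]; split.
  by under eq_fun do rewrite Re_add; exact: measurable_funD.
by under eq_fun do rewrite Im_add; exact: measurable_funD.
Qed.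

Lemma cmeasM f (g : R -> C) : cmeas f -> cmeas g -> cmeas (fun t => f t * g t).
Proof.
move=> [f1 f2] [g1 g2]; split.
  by under eq_fun do rewrite Re_mul; apply: measurable_funB; exact: measurable_funM.
by under eq_fun do rewrite Im_mul; apply: measurable_funD; exact: measurable_funM.
Qed.

Lemma cmeas_cst (z : C) : cmeas (fun=> z).
Proof. by split; exact: measurable_cst. Qed.

Lemma cmeas_RtoC h : measurable_fun setT h -> cmeas (fun t => RtoC (h t)).
Proof. by move=> mh; split => //=; exact: measurable_cst. Qed.

Lemma cmeas_expi h : measurable_fun setT h -> cmeas (fun t => expi (h t)).
Proof.
move=> mh; split => /=.
  apply: (measurableT_comp _ mh).
  by apply: continuous_measurable_fun; exact: continuous_cos.
apply: (measurableT_comp _ mh).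
by apply: continuous_measurable_fun; exact: continuous_sin.
Qed.

Lemma cmeas_sum (I : Type) (s : seq I) (F : I -> R -> C) :
  (forall i, cmeas (F i)) -> cmeas (fun t => \sum_(i <- s) F i t).
Proof.
move=> mF; elim: s => [|i s IH].
  by under eq_fun do rewrite big_nil; exact: cmeas_cst.
by under eq_fun do rewrite big_cons; exact: cmeasD.
Qed.

Lemma le_rintble h g : measurable_fun setT h -> rintble g ->
  (forall x, `|h x| <= g x) -> rintble h.
Proof.
move=> mh ig hg; apply: le_integrable ig => //.
  exact/measurable_EFinP.
move=> x _ /=; rewrite lee_fin; apply: le_trans (hg x) _; exact: ler_norm.
Qed.

Lemma le_cintble f g : cmeas f -> rintble g ->
  (forall x, cabs (f x) <= g x) -> cintble f.
Proof.
move=> [m1 m2] ig fg; split; apply: le_rintble ig _ => // x.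
  exact: le_trans (Re_le_cabs _) (fg x).
exact: le_trans (Im_le_cabs _) (fg x).
Qed.

Lemma rintbleD h g : rintble h -> rintble g -> rintble (fun x => h x + g x).
Proof. by move=> ih ig; exact: (@integrableD _ _ _ mu setT _ _ _ ih ig). Qed.

Lemma rintbleB h g : rintble h -> rintble g -> rintble (fun x => h x - g x).
Proof. by move=> ih ig; exact: (@integrableB _ _ _ mu setT _ _ _ ih ig). Qed.

Lemma rintbleZ (k : R) h : rintble h -> rintble (fun x => k * h x).
Proof. by move=> ih; exact: (@integrableZl _ _ _ mu setT _ k _ ih). Qed.

Lemma cintbleD f (g : R -> C) : cintble f -> cintble g -> cintble (fun t => f t + g t).
Proof.
move=> [f1 f2] [g1 g2]; split.
  by under eq_fun do rewrite Re_add; exact: rintbleD.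
by under eq_fun do rewrite Im_add; exact: rintbleD.
Qed.

Lemma cintbleZ (k : C) f : cintble f -> cintble (fun t => k * f t).
Proof.
move=> [f1 f2]; split.
  by under eq_fun do rewrite Re_mul; apply: rintbleB; exact: rintbleZ.
by under eq_fun do rewrite Im_mul; apply: rintbleD; exact: rintbleZ.
Qed.

Lemma cintble0 : cintble (fun=> 0).
Proof. by split; exact: integrable0. Qed.

Lemma cintble_sum (I : Type) (s : seq I) (F : I -> R -> C) :
  (forall i, cintble (F i)) -> cintble (fun t => \sum_(i <- s) F i t).
Proof.
move=> mF; elim: s => [|i s IH].
  by under eq_fun do rewrite big_nil; exact: cintble0.
by under eq_fun do rewrite big_cons; exact: cintbleD.
Qed.

Lemma eq_cintegral f (g : R -> C) : (forall t, f t = g t) -> cintegral f = cintegral g.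
Proof. by move=> fg; congr cintegral; apply/funext. Qed.

Lemma cintegralD f (g : R -> C) : cintble f -> cintble g ->
  cintegral (fun t => f t + g t) = cintegral f + cintegral g.
Proof.
move=> [f1 f2] [g1 g2]; apply: C_ext; rewrite ?Re_add ?Im_add /=.
  by under eq_Rintegral do rewrite Re_add; rewrite RintegralD.
by under eq_Rintegral do rewrite Im_add; rewrite RintegralD.
Qed.

Lemma cintegralZ (k : C) f : cintble f ->
  cintegral (fun t => k * f t) = k * cintegral f.
Proof.
move=> [f1 f2]; apply: C_ext; rewrite ?Re_mul ?Im_mul /=.
  under eq_Rintegral do rewrite Re_mul.
  by rewrite RintegralB ?RintegralZl//; exact: rintbleZ.
under eq_Rintegral do rewrite Im_mul.
by rewrite RintegralD ?RintegralZl//; exact: rintbleZ.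
Qed.

Lemma cintegral0 : cintegral (fun=> 0 : C) = 0 :> C.
Proof. by rewrite /cintegral Rintegral_cst// !mul0r. Qed.

Lemma cintegralN f : cintble f -> cintegral (fun t => - f t) = - cintegral f.
Proof.
move=> h; rewrite -mulN1r -cintegralZ//; apply: eq_cintegral => t.
by rewrite mulN1r.
Qed.

Lemma cintegralB f (g : R -> C) : cintble f -> cintble g ->
  cintegral (fun t => f t - g t) = cintegral f - cintegral g.
Proof.
move=> h1 h2; rewrite cintegralD//; last first.
  by under eq_fun do rewrite -mulN1r; exact: cintbleZ.
by rewrite cintegralN.
Qed.

Lemma cintegral_sum (I : Type) (s : seq I) (F : I -> R -> C) :
  (forall i, cintble (F i)) ->
  cintegral (fun t => \sum_(i <- s) F i t) = \sum_(i <- s) cintegral (F i).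
Proof.
move=> mF; elim: s => [|i s IH].
  under eq_cintegral do rewrite big_nil.
  by rewrite big_nil cintegral0.
under eq_cintegral do rewrite big_cons.
by rewrite big_cons cintegralD ?IH//; exact: cintble_sum.
Qed.

Lemma cintegral_RtoC h : cintegral (fun t => RtoC (h t)) =
  RtoC (Rintegral mu setT h).
Proof. by apply: C_ext => //=; rewrite Rintegral_cst// mul0r. Qed.

Lemma le_RintegralT h g : rintble h -> rintble g -> (forall x, h x <= g x) ->
  Rintegral mu setT h <= Rintegral mu setT g.
Proof. by move=> ih ig hg; apply: le_Rintegral. Qed.

(** The factor 2 is the price of bounding the real and imaginary integrals separately. *)
Lemma cabs_cintegral_le f g : cintble f -> rintble g ->
  (forall x, cabs (f x) <= g x) ->
  cabs (cintegral f) <= 2 * Rintegral mu setT g.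
Proof.
move=> [f1 f2] ig fg; apply: le_trans (cabs_le_ReIm _) _ => /=.
have b h : rintble h -> (forall x, `|h x| <= g x) ->
    `|Rintegral mu setT h| <= Rintegral mu setT g.
  move=> ih hg; apply: le_trans (le_normr_Rintegral _ ih) _ => //.
  apply: le_RintegralT => //.
  exact: integrable_norm.
rewrite mulr_natl mulr2n; apply: lerD; apply: b => // x.
  exact: le_trans (Re_le_cabs _) (fg x).
exact: le_trans (Im_le_cabs _) (fg x).
Qed.

Lemma Rintegral_dct (F : nat -> R -> R) h g :
  (forall n, measurable_fun setT (F n)) -> (forall x, F n x @[n --> \oo] --> h x) ->
  rintble g -> (forall n x, `|F n x| <= g x) ->
  rintble h /\ Rintegral mu setT (F n) @[n --> \oo] --> Rintegral mu setT h.
Proof.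
move=> mF Fh ig Fg.
have mh : measurable_fun setT h.
  by apply: (measurable_fun_cvg mF) => x _; exact: Fh.
have Fh' x : [set: measurableTypeR R] x -> EFin (F n x) @[n --> \oo] --> (h x)%:E.
  by move=> _; apply/cvg_EFin; [exact: nearW|exact: Fh].
have Fg' (x : measurableTypeR R) n : setT x -> (`|(F n x)%:E| <= (g x)%:E)%E.
  by move=> _; rewrite lee_fin.
have [ih _ cv] := @dominated_convergence _ _ _ mu setT measurableT
  (fun n => EFin \o F n) (EFin \o h) (EFin \o g)
  (fun n => (measurable_EFinP _ _).2 (mF n)) ((measurable_EFinP _ _).2 mh)
  (aeW _ Fh') ig
  (aeW _ Fg').
split => //; rewrite /Rintegral.
apply: fine_cvg; rewrite fineK//; exact: integrable_fin_num.
Qed.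

Lemma cintegral_dct (F : nat -> R -> C) f g :
  (forall n, cmeas (F n)) -> (forall x, clim \oo (F ^~ x) (f x)) ->
  rintble g -> (forall n x, cabs (F n x) <= g x) ->
  cintble f /\ clim \oo (fun n => cintegral (F n)) (cintegral f).
Proof.
move=> mF Ff ig Fg.
have [i1 c1] := @Rintegral_dct (fun n t => complex.Re (F n t))
  (fun t => complex.Re (f t)) g (fun n => (mF n).1)
  (fun x => ((clim_ReIm _ _).1 (Ff x)).1) ig
  (fun n x => le_trans (Re_le_cabs _) (Fg n x)).
have [i2 c2] := @Rintegral_dct (fun n t => complex.Im (F n t))
  (fun t => complex.Im (f t)) g (fun n => (mF n).2)
  (fun x => ((clim_ReIm _ _).1 (Ff x)).2) ig
  (fun n x => le_trans (Im_le_cabs _) (Fg n x)).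
by split => //; apply/clim_ReIm; split.
Qed.

Lemma Rintegral_supp a b h : (forall x, x \notin `[a, b] -> h x = 0) ->
  Rintegral mu setT h = Rintegral mu `[a, b] h.
Proof.
move=> h0; rewrite [RHS]Rintegral_mkcond; congr Rintegral; apply/funext => x.
rewrite patchE; case: ifPn => //; rewrite notin_setE => /negP xab; exact: h0.
Qed.

Lemma rintble_cst_supp a b (M : R) :
  rintble (fun x => if x \in `[a, b] then M else 0).
Proof.
have := (@integrable_mkcond _ _ _ mu `[a, b] (EFin \o cst M) (measurable_itv _)).1.
rewrite /rintble.
have -> : (EFin \o (fun x => if x \in `[a, b] then M else 0)) =
   (EFin \o cst M) \_ `[a, b].
  by apply/funext => x; rewrite patchE /= mem_setE; case: ifP.
move=> h; apply: h; apply: continuous_compact_integrable.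
  exact: segment_compact.
by apply: continuous_subspaceT => x; exact: cst_continuous.
Qed.

Lemma Rintegral_cst_supp a b (M : R) : a <= b ->
  Rintegral mu setT (fun x => if x \in `[a, b] then M else 0) = (b - a) * M.
Proof.
move=> ab; rewrite (@Rintegral_supp a b); last by move=> x /negbTE ->.
rewrite (@eq_Rintegral _ _ _ mu `[a, b] (cst M)); last first.
  by move=> x; rewrite inE /= => ->.
rewrite Rintegral_cst; last exact: measurable_itv.
rewrite [X in fine X](_ : _ = @lebesgue_measure R `[a, b]%classic)//.
rewrite lebesgue_measure_itv /= lte_fin.
case: ltgtP ab => // [ab|->] _; last by rewrite subrr mul0r mulr0.
by rewrite -EFinB /= mulrC.
Qed.

End ComplexIntegral.

(** * Smooth functions of compact support *)

Section Smooth.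
Variable R : realType.
Implicit Types (f g : R -> R).

(* A [Variant] rather than a definition, so that unification never unfolds it. *)
Variant rsmooth f : Prop := Rsmooth of (forall n x, derivable (derive1n n f) x 1).

Lemma rsmoothP f : rsmooth f ->
  rsmooth f^`()%classic /\ forall x : R, is_derive x 1 f (f^`()%classic x).
Proof.
case=> sf; split; first by split=> n x; rewrite -derive1Sn; exact: sf.
move=> x; rewrite derive1E; apply: derivableP; exact: (sf 0%N x).
Qed.

Lemma is_derive1E f (x d : R) : is_derive x 1 f d -> f^`()%classic x = d.
Proof. by move=> h; rewrite derive1E derive_val. Qed.

(** A class of functions closed under differentiation contains all iterated derivatives of its
    members, by induction on the order and uniqueness of derivatives. Smoothness thus needs no
    formula for higher derivatives. *)
Lemma rsmooth_coind (P : (R -> R) -> Prop) :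
  (forall f, P f -> exists2 g, P g & forall x : R, is_derive x 1 f (g x)) ->
  forall f, P f -> rsmooth f.
Proof.
move=> Pd f Pf; split=> n x.
have {Pf} : P (derive1n n f).
  elim: n => [|n IH]; first by rewrite derive1n0.
  have [g Pg dg] := Pd _ IH.
  rewrite derive1nS (_ : (_)^`()%classic = g)//; apply/funext => y.
  by rewrite derive1E; have /@derive_val := dg y.
by move=> /Pd[g _ dg]; exact: ex_derive.
Qed.

(** The class generated by smooth functions under the operations used below. The product, chain and
    quotient rules keep it closed under differentiation, so [rsmooth_coind] settles all these
    operations at once. *)
Inductive smooth_closure : (R -> R) -> Prop :=
| SC_base f : rsmooth f -> smooth_closure f
| SC_cst (c : R) : smooth_closure (fun=> c)
| SC_add f g : smooth_closure f -> smooth_closure g ->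
    smooth_closure (fun x => f x + g x)
| SC_mul f g : smooth_closure f -> smooth_closure g ->
    smooth_closure (fun x => f x * g x)
| SC_affine f (a b : R) : smooth_closure f -> smooth_closure (fun x => f (a * x + b))
| SC_inv f : smooth_closure f -> (forall x, f x != 0) ->
    smooth_closure (fun x => (f x)^-1).

Lemma is_derive_affine f (a b d x : R) : is_derive (a * x + b) 1 f d ->
  is_derive x 1 (fun y => f (a * y + b)) (a * d).
Proof.
move=> df.
have h : is_derive x 1 (fun y => a * y + b) a.
  by apply: is_derive_eq; rewrite addr0 scaler1.
rewrite mulrC; exact: (@is_derive1_comp _ f (fun y => a * y + b) x _ _ df h).
Qed.

Lemma is_derive_mulR f g (x a b : R) : is_derive x 1 f a -> is_derive x 1 g b ->
  is_derive x 1 (fun y => f y * g y) (f x * b + g x * a).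
Proof. exact: is_deriveM. Qed.

Lemma is_derive_addR f g (x a b : R) : is_derive x 1 f a -> is_derive x 1 g b ->
  is_derive x 1 (fun y => f y + g y) (a + b).
Proof. exact: is_deriveD. Qed.

Lemma is_derive_scaleR f (k x a : R) : is_derive x 1 f a ->
  is_derive x 1 (fun y => k * f y) (k * a).
Proof. exact: is_deriveZ. Qed.

Lemma smooth_closureP f : smooth_closure f -> rsmooth f.
Proof.
apply: (@rsmooth_coind smooth_closure) => {f} f; elim => {f}.
- by move=> f /rsmoothP[sf df]; exists f^`()%classic => //; exact: SC_base.
- by move=> c; exists (fun=> 0) => [|x]; [exact: SC_cst|exact: is_derive_cst].
- move=> f g _ [f' sf df] _ [g' sg dg]; exists (fun x => f' x + g' x).
    exact: SC_add.
  by move=> x; exact: is_deriveD.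
- move=> f g sf0 [f' sf df] sg0 [g' sg dg].
  exists (fun x => f x * g' x + g x * f' x).
    by apply: SC_add; exact: SC_mul.
  by move=> x; exact: is_deriveM.
- move=> f a b _ [f' sf df]; exists (fun x => a * f' (a * x + b)).
    by apply: SC_mul; [exact: SC_cst|exact: SC_affine].
  by move=> x; exact: is_derive_affine.
- move=> f sf0 [f' sf df] f0.
  exists (fun x => (-1) * ((f x)^-1 * (f x)^-1) * f' x).
    apply: SC_mul => //; apply: SC_mul; first exact: SC_cst.
    by apply: SC_mul; exact: SC_inv.
  move=> x; apply: (is_derive_eq (is_deriveV (f0 x) (df x))).
  by rewrite /GRing.scale /= mulN1r -exprVn expr2.
Qed.

Lemma rsmooth_cst (c : R) : rsmooth (fun=> c).
Proof. exact/smooth_closureP/SC_cst. Qed.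

Lemma rsmoothD f g : rsmooth f -> rsmooth g -> rsmooth (fun x => f x + g x).
Proof. by move=> sf sg; apply/smooth_closureP/SC_add; exact: SC_base. Qed.

Lemma rsmoothM f g : rsmooth f -> rsmooth g -> rsmooth (fun x => f x * g x).
Proof. by move=> sf sg; apply/smooth_closureP/SC_mul; exact: SC_base. Qed.

Lemma rsmoothN f : rsmooth f -> rsmooth (fun x => - f x).
Proof.
move=> sf; under eq_fun do rewrite -mulN1r.
by apply: rsmoothM => //; exact: rsmooth_cst.
Qed.

Lemma rsmoothB f g : rsmooth f -> rsmooth g -> rsmooth (fun x => f x - g x).
Proof. by move=> sf sg; apply: rsmoothD => //; exact: rsmoothN. Qed.

Lemma rsmooth_affine f (a b : R) : rsmooth f -> rsmooth (fun x => f (a * x + b)).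
Proof. by move=> sf; apply/smooth_closureP/SC_affine; exact: SC_base. Qed.

Lemma rsmoothV f : rsmooth f -> (forall x, f x != 0) -> rsmooth (fun x => (f x)^-1).
Proof. by move=> sf f0; apply/smooth_closureP/SC_inv => //; exact: SC_base. Qed.

Lemma rsmooth_cos_sin (a b : R) : rsmooth (fun x => a * cos x + b * sin x).
Proof.
apply: (@rsmooth_coind (fun f => exists a b, f = fun x => a * cos x + b * sin x)).
  move=> _ [c [d ->]]; exists (fun x => d * cos x + (- c) * sin x).
    by exists d, (- c).
  move=> x; apply: is_derive_eq; rewrite /GRing.scale /=; ring.
by exists a, b.
Qed.

Lemma rsmooth_cos : rsmooth cos.
Proof.
rewrite (_ : cos = fun x : R => 1 * cos x + 0 * sin x).
  exact: rsmooth_cos_sin.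
by apply/funext => x; rewrite mul1r mul0r addr0.
Qed.

Lemma rsmooth_sin : rsmooth sin.
Proof.
rewrite (_ : sin = fun x : R => 0 * cos x + 1 * sin x).
  exact: rsmooth_cos_sin.
by apply/funext => x; rewrite mul1r mul0r add0r.
Qed.

Lemma rsmooth_continuous f : rsmooth f -> continuous f.
Proof.
move=> /rsmoothP[_ df] x; apply/differentiable_continuous/derivable1_diffP.
exact: ex_derive.
Qed.

Lemma is_derive_quadratic f (M : R) : (forall x, `|f x| <= M * x ^+ 2) ->
  is_derive (0 : R) 1 f 0.
Proof.
move=> fM.
have f0 : f 0 = 0.
  by apply/eqP; rewrite -normr_eq0 eq_le normr_ge0 andbT; have := fM 0; rewrite expr0n mulr0.
have M0 : 0 <= M by apply: le_trans (normr_ge0 (f 1)) _; have := fM 1; rewrite expr1n mulr1.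
have h : h^-1 *: ((f \o shift 0) (h *: 1) - f 0) @[h --> 0^'] --> (0 : R).
  apply/cvgrPdist_lt => e e0; near=> t.
  rewrite sub0r normrN f0 subr0 /= addr0 /GRing.scale /= mulr1 normrM normfV.
  have t0 : 0 < `|t| by rewrite normr_gt0; near: t; exact: nbhs_dnbhs_neq.
  rewrite mulrC ltr_pdivrMr//; apply: le_lt_trans (fM t) _.
  rewrite -(real_normK (num_real t)) expr2 mulrA ltr_pM2r//.
  have : `|t| < e / (M + 1).
    near: t; apply: dnbhs0_lt; rewrite divr_gt0//; lra.
  have M1 : 0 < M + 1 by lra.
  by rewrite ltr_pdivlMr//; apply: le_lt_trans; rewrite mulrC ler_wpM2l// lerDl.
by apply: DeriveDef; [apply: cvgP h|exact: cvg_lim h].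
Unshelve. all: by end_near. Qed.

(** For [n > 0], raise [y / n <= exp (y / n)] to the power [n]. *)
Lemma exprn_le_expR n (y : R) : 0 <= y -> y ^+ n <= n%:R ^+ n * expR y.
Proof.
case: n => [|n] y0; first by rewrite !expr0 mul1r; have := expR_ge1Dx y; lra.
have n0 : 0 < n.+1%:R :> R by [].
rewrite -{2}(mulfVK (lt0r_neq0 n0) y) mulrC expRM_natr -exprMn_comm; last exact: mulrC.
apply: lerXn2r; rewrite ?nnegrE ?mulr_ge0 ?expR_ge0//.
by rewrite -ler_pdivrMr//; apply: le_trans (expR_ge1Dx _); rewrite lerDr.
Qed.

Lemma poly_le_expR (p : {poly R}) :
  exists2 M : R, 0 <= M & forall y, 0 <= y -> `|p.[y]| <= M * expR y.
Proof.
exists (\sum_(i < size p) `|p`_i| * i%:R ^+ i).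
  by apply: sumr_ge0 => i _; rewrite mulr_ge0// exprn_ge0.
move=> y y0; rewrite horner_coef mulr_suml.
apply: le_trans (ler_norm_sum _ _ _) _; apply: ler_sum => i _.
rewrite normrM -mulrA ler_wpM2l// ger0_norm ?exprn_ge0//; exact: exprn_le_expR.
Qed.

(** The classical functions [p(1 / x) e^{-1 / x}], extended by 0. All polynomials [p] are taken
    together because differentiation only changes the polynomial. *)
Definition flat (p : {poly R}) (x : R) := if 0 < x then p.[x^-1] * expR (- x^-1) else 0.

Lemma rsmooth_flat p : rsmooth (flat p).
Proof.
apply: (@rsmooth_coind (fun f => exists p, f = flat p)); last by exists p.
(* For [x > 0] the derivative of [p(1/x) e^{-1/x}] is [x^{-2} (p(1/x) - p'(1/x)) e^{-1/x}], which is
   [flat q]. *)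
move=> _ [{}p ->]; pose q := ('X ^+ 2 * (p - p^`()))%R.
exists (flat q); first by exists q.
move=> x; case: (ltgtP x 0) => [x0|x0|->].
- rewrite /flat ltNge (ltW x0) /=; apply: (@near_eq_is_derive _ _ _ (fun=> 0)).
    near=> y; rewrite ltNge (_ : y <= 0)//; apply/ltW; near: y; exact: lt_nbhsl.
- rewrite {2}/flat x0; apply: (@near_eq_is_derive _ _ _ (fun y : R => p.[y^-1] * expR (- y^-1) : R)).
    near=> y; rewrite /flat (_ : 0 < y)//; near: y; exact: lt_nbhsr.
  have dV : is_derive x 1 (fun y : R => y^-1) (- x ^- 2).
    by apply: is_derive_eq; [apply: is_deriveV; exact: lt0r_neq0|rewrite /GRing.scale/= mulr1].
  have dp : is_derive x 1 (fun y => p.[y^-1]) (p^`().[x^-1] * (- x ^- 2)).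
    apply: (is_derive1_comp (f := horner p)) dV; exact: is_derive_poly.
  have de : is_derive x 1 (fun y => expR (- y^-1)) (expR (- x^-1) * (x ^- 2)).
    apply: (is_derive1_comp (f := expR) (g := fun y => - y^-1)).
    by rewrite -(opprK (x ^- 2)); exact: is_deriveN.
  apply: (is_derive_eq (is_deriveM dp de)).
  rewrite /q !hornerE /GRing.scale /=.
  by rewrite -exprVn; ring.
(* At the origin, [x^{-2} p(1/x)] is at most a multiple of [e^{1/x}] for [x > 0], so [flat p] is
   [O(x^2)] and has derivative 0 there. *)
- have [M M0 pM] := poly_le_expR ('X ^+ 2 * p).
  rewrite {2}/flat ltxx; apply: (@is_derive_quadratic _ M) => {}x; rewrite /flat.
  case: ifPn => [x0|_]; last by rewrite normr0 mulr_ge0 ?sqr_ge0.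
  have := pM x^-1; rewrite invr_ge0 (ltW x0) => /(_ isT).
  rewrite hornerM hornerXn normrM exprVn ger0_norm ?invr_ge0 ?sqr_ge0//.
  rewrite -ler_pdivrMr ?expR_gt0// -expRN.
  rewrite normrM (ger0_norm (expR_ge0 _)) => h.
  by rewrite -ler_pdivrMr ?exprn_gt0//; apply: le_trans h; rewrite mulrC mulrA.
Unshelve. all: by end_near. Qed.

(** The denominator never vanishes because [x] and [1 - x] are not both nonpositive; the step goes
    from 0 on [x <= 0] to 1 on [x >= 1]. *)
Definition smooth_step (x : R) := flat 1 x / (flat 1 x + flat 1 (1 - x)).

Lemma flat1_gt0 x : 0 < x -> 0 < flat 1 x.
Proof. by move=> x0; rewrite /flat x0 hornerC mul1r expR_gt0. Qed.

Lemma flat1_eq0 x : x <= 0 -> flat 1 x = 0.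
Proof. by rewrite /flat leNgt => /negbTE ->. Qed.

Lemma flat1_ge0 x : 0 <= flat 1 x.
Proof.
by case: (ltP 0 x) => [/flat1_gt0/ltW//|/flat1_eq0 ->].
Qed.

Lemma flat1_den_gt0 x : 0 < flat 1 x + flat 1 (1 - x).
Proof.
case: (ltP 0 x) => [/flat1_gt0 h|h]; first by have := flat1_ge0 (1 - x); lra.
have /flat1_gt0 : 0 < 1 - x by lra.
by have := flat1_ge0 x; lra.
Qed.

Lemma smooth_step0 x : x <= 0 -> smooth_step x = 0.
Proof. by move=> x0; rewrite /smooth_step flat1_eq0// mul0r. Qed.

Lemma smooth_step1 x : 1 <= x -> smooth_step x = 1.
Proof.
move=> x1; rewrite /smooth_step (@flat1_eq0 (1 - x)) ?addr0 ?divff//; last by lra.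
by rewrite lt0r_neq0// flat1_gt0//; lra.
Qed.

Lemma smooth_step_ge0 x : 0 <= smooth_step x.
Proof. by rewrite divr_ge0 ?flat1_ge0// ltW// flat1_den_gt0. Qed.

Lemma smooth_step_gt0 x : 0 < x -> 0 < smooth_step x.
Proof. by move=> x0; rewrite divr_gt0 ?flat1_gt0// flat1_den_gt0. Qed.

Lemma smooth_step_le1 x : smooth_step x <= 1.
Proof.
rewrite ler_pdivrMr ?flat1_den_gt0// mul1r lerDl; exact: flat1_ge0.
Qed.

Lemma rsmooth_step : rsmooth smooth_step.
Proof.
apply: rsmoothM; first exact: rsmooth_flat.
apply: rsmoothV => [|x]; last by rewrite lt0r_neq0 ?flat1_den_gt0.
apply: rsmoothD; first exact: rsmooth_flat.
under eq_fun do rewrite addrC -mulN1r.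
by apply: rsmooth_affine; exact: rsmooth_flat.
Qed.

(** When [b < a] the interval is empty and the condition says that [f] vanishes identically; pieces
    cut by maxima and minima of endpoints are therefore covered. *)
Definition supp_in (a b : R) f := forall x, x \notin `[a, b] -> f x = 0.

Lemma supp_in_derive a b f : rsmooth f -> supp_in a b f ->
  supp_in a b f^`()%classic.
Proof.
move=> /rsmoothP[_ df] f0 x xab.
have : is_derive x 1 f 0.
  apply: (@near_eq_is_derive _ _ _ (fun=> 0)).
  have : open (~` `[a, b]%classic) by apply: closed_openC; exact: itv_closed.
  move=> /(_ x); rewrite /= => h.
  have : nbhs x (~` `[a, b]%classic).
    by apply: open_nbhs_nbhs; split; [apply: closed_openC; exact: itv_closed|apply/negP].
  by apply: filterS => y /= /negP/f0 ->.
by move=> h; rewrite derive1E derive_val.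
Qed.

Lemma supp_in_bounded a b f : continuous f -> supp_in a b f ->
  exists2 M, 0 <= M & forall x, `|f x| <= M.
Proof.
move=> cf f0; case: (leP a b) => ab; last first.
  exists 0 => // x; rewrite f0 ?normr0// in_itv /=; apply/negP => /andP[]; lra.
have [c _ cM] := @EVT_max _ (fun x => `|f x|) a b ab
  (continuous_subspaceT (fun x => continuous_comp (cf x) (@norm_continuous _ _ _))).
exists `|f c| => // x.
by case: (boolP (x \in `[a, b])) => [/cM//|/f0 ->]; rewrite normr0.
Qed.

End Smooth.

(** * Fourier decay and Abel limits of pairings *)

Section DominatedSeries.
Variable R : realType.
Local Notation C := (Cplx R).

Lemma nneg_series_cauchy (D : nat -> R) (B : R) : (forall n, 0 <= D n) ->
  (forall N, \sum_(0 <= n < N) D n <= B) -> forall e, 0 < e ->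
  exists N, forall M, (N <= M)%N -> \sum_(N <= n < M) D n <= e.
Proof.
move=> D0 DB e e0.
have nd : nondecreasing_seq (series D).
  apply/nondecreasing_seqP => n; rewrite seriesSr /=.
  by rewrite lerDl.
have /cvg_ex[/= l cl] : cvgn (series D).
  apply: nondecreasing_is_cvgn => //.
  by exists B => _ [n _ <-]; rewrite seriesEnat /=; exact: DB.
have e2 : 0 < e / 2 by lra.
have := @cvgr_dist_lt _ _ _ _ _ _ _ cl (e / 2) e2.
move=> [N _ hN]; exists N => M NM.
have := hN N (leqnn N); have := hN M NM.
rewrite /= !seriesEnat /= !ltr_norml => /andP[h1 h2] /andP[h3 h4].
have -> : \sum_(N <= n < M) D n = \sum_(0 <= n < M) D n - \sum_(0 <= n < N) D n.
  by rewrite (@big_cat_nat _ _ _ N 0 M)//= addrAC subrr add0r.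
by move: h1 h2 h3 h4; set a := \sum_(0 <= n < M) _; set b := \sum_(0 <= n < N) _; lra.
Qed.

Lemma csum_tail_le (w : nat -> C) (s : C) (D : nat -> R) (e : R) N :
  csum_cvg w s -> (forall n, cabs (w n) <= D n) ->
  (forall M, (N <= M)%N -> \sum_(N <= n < M) D n <= e) ->
  cabs (s - \sum_(0 <= n < N) w n) <= e.
Proof.
move=> ws wD De.
apply: (clim_le (climB ws (clim_cst (\sum_(0 <= n < N) w n)))).
exists N => // M /= NM.
rewrite (@big_cat_nat _ _ _ N 0 M)//= addrAC subrr add0r.
apply: le_trans (cabs_sum _ _ _) _; apply: le_trans (De M NM).
exact: ler_sum.
Qed.

Lemma dominated_csum_cvg (w : nat -> C) (D : nat -> R) (B : R) :
  (forall n, cabs (w n) <= D n) -> (forall N, \sum_(0 <= n < N) D n <= B) ->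
  exists2 l : C, csum_cvg w l & cabs l <= B.
Proof.
move=> wD DB.
have D0 n : 0 <= D n by apply: le_trans (wD n); exact: cabs_ge0.
have cv (v : nat -> R) : (forall n, `|v n| <= D n) -> cvgn (series v).
  move=> vD; apply: normed_cvg; apply: nondecreasing_is_cvgn.
    apply/nondecreasing_seqP => n; rewrite -subr_ge0.
    rewrite (_ : _ - _ = `|v n|)// /= /normed_series_of.
    by rewrite /series /= big_nat_recr //= addrAC subrr add0r.
  exists B => _ [n _ <-]; rewrite /normed_series_of /series /=; apply: le_trans (DB n).
  exact: ler_sum.
have /cvg_ex[/= a ca] := cv (fun n => complex.Re (w n))
  (fun n => le_trans (Re_le_cabs _) (wD n)).
have /cvg_ex[/= b cb] := cv (fun n => complex.Im (w n))
  (fun n => le_trans (Im_le_cabs _) (wD n)).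
have wl : csum_cvg w (a +i* b)%C.
  apply/clim_ReIm; split => /=.
    rewrite (_ : (fun n => complex.Re _) = series (fun n => complex.Re (w n)))//.
    apply/funext => n; rewrite /series /=.
    by elim/big_ind2 : _ => // x y x' y' <- <-; rewrite Re_add.
  rewrite (_ : (fun n => complex.Im _) = series (fun n => complex.Im (w n)))//.
  apply/funext => n; rewrite /series /=.
  by elim/big_ind2 : _ => // x y x' y' <- <-; rewrite Im_add.
exists (a +i* b)%C => //; apply: (clim_le wl); apply: nearW => n.
apply: le_trans (cabs_sum _ _ _) _.
by apply: le_trans (DB n); exact: ler_sum.
Qed.

(** Tannery's theorem along a filter: beyond some [N] the majorant sums to at most [e / 3], and the
    finite head converges term by term. *)
Lemma csum_dct (T : Type) (F : set_system T) {FF : ProperFilter F}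
  (u : T -> nat -> C) (v : nat -> C) (D : nat -> R) (B : R) (s : T -> C) (l : C) :
  (forall N, \sum_(0 <= n < N) D n <= B) ->
  (\forall x \near F, forall n, cabs (u x n) <= D n) ->
  (forall n, clim F (u ^~ n) (v n)) ->
  (\forall x \near F, csum_cvg (u x) (s x)) ->
  csum_cvg v l -> clim F s l.
Proof.
move=> DB uD uv us vl.
have vD n : cabs (v n) <= D n.
  by apply: (clim_le (uv n)); apply: filterS uD => x.
have D0 n : 0 <= D n by apply: le_trans (vD n); exact: cabs_ge0.
move=> e e0; have e3 : 0 < e / 3 by lra.
have [N hN] := nneg_series_cauchy D0 DB e3.
have lN := csum_tail_le vl vD hN.
have Ff : Filter F by exact: filter_filter.
have h := @clim_sum R T F Ff _ (index_iota 0 N) _ _ uv _ e3.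
apply: filterS3 uD us h => x ux usx hx.
have sN := csum_tail_le usx ux hN.
have := cabsD (s x - \sum_(0 <= n < N) u x n)
  (\sum_(0 <= n < N) u x n - \sum_(0 <= n < N) v n).
rewrite addrA subrK => h1.
have := cabsD (s x - \sum_(0 <= n < N) v n) (\sum_(0 <= n < N) v n - l).
rewrite addrA subrK; move: lN; rewrite cabsBC; lra.
Qed.

(** Comparison with the increments of [(3 / N) atan (y / N)], whose derivative is [3 / (N^2 + y^2)].
    The factor 3 absorbs the variation of [N^2 + y^2] over a unit step: for [|c - y| <= 1 <= N] one
    has [N^2 + c^2 <= N^2 + 2 y^2 + 2 <= 3 (N^2 + y^2)]. The total increase of [atan] is at most
    [pi]. *)
Lemma lattice_sum (N x : R) (p q : nat) : 1 <= N -> (p <= q)%N ->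
  \sum_(p <= n < q) (N ^+ 2 + (x - n%:R) ^+ 2)^-1 <= 3 * pi / N.
Proof.
move=> N1 pq; pose T (y : R) := 3 / N * atan (N^-1 * y + 0).
have N0 : 0 < N by lra.
have dT (y : R) : is_derive y 1 T (3 / (N ^+ 2 + y ^+ 2)).
  have := @is_derive_affine _ _ N^-1 0 _ y (is_derive1_atan (N^-1 * y + 0)).
  move=> h; rewrite /T.
  apply: (is_derive_eq (is_deriveZ (3 / N) h)); rewrite /GRing.scale /= addr0.
  have h1 : N ^+ 2 + y ^+ 2 != 0 by rewrite lt0r_neq0// ltr_wpDr ?sqr_ge0// exprn_gt0.
  field; rewrite h1 /= ?andbT (lt0r_neq0 N0) /= ?andbT.
  by rewrite expr2 in h1 *; rewrite expr2 in h1.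
have step n : (N ^+ 2 + (x - n%:R) ^+ 2)^-1 <= T (n.+1%:R - x) - T (n%:R - x).
  have lt1 : n%:R - x < n.+1%:R - x by rewrite -natr1; lra.
  have [c] := @MVT _ T _ _ _ lt1 (fun y _ => dT y)
    (derivable_within_continuous (fun y _ => @ex_derive _ _ _ _ _ _ _ (dT y))).
  rewrite in_itv /= => /andP[c1 c2] ->.
  rewrite -natr1 in c2 *.
  rewrite (_ : n%:R + 1 - x - (n%:R - x) = 1); last by ring.
  rewrite mulr1 -ler_pdivrMl// -invfM lef_pV2 ?posrE.
  - move: c1 c2; set y := n%:R - x => c1 c2.
    rewrite (_ : x - n%:R = - y); last by rewrite /y; ring.
    rewrite sqrrN.
    have h1 := sqr_ge0 (y - (c - y)).
    have c3 : c < y + 1 by rewrite /y; lra.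
    have h2 : (c - y) ^+ 2 <= 1 by nra.
    have h3 : 1 <= N ^+ 2 by rewrite expr_ge1//; lra.
    nra.
  - by rewrite mulr_gt0// ltr_wpDr ?sqr_ge0// exprn_gt0.
  - by rewrite ltr_wpDr ?sqr_ge0// exprn_gt0.
apply: (@le_trans _ _ (\sum_(p <= n < q) (T (n.+1%:R - x) - T (n%:R - x)))).
  by apply: ler_sum => n _; exact: step.
rewrite (telescope_sumr (fun n => T (n%:R - x)))// /T -mulrBr.
rewrite [leRHS]mulrAC ler_wpM2l ?divr_ge0 ?ltW//.
have := @atan_ltpi2 R (N^-1 * (q%:R - x) + 0).
have := @atan_gtNpi2 R (N^-1 * (p%:R - x) + 0).
lra.
Qed.

End DominatedSeries.

(** * Decay of the Fourier transform of a smooth bump *)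

Section FourierDecay.
Variable R : realType.
Local Notation C := (Cplx R).
Local Notation mu := (@lebesgue_measure R).
Implicit Types (f g : R -> R).

Definition rft f (x : R) : C := fourier (fun t => RtoC (f t)) x.

Lemma supp_rintble a b f : continuous f -> supp_in a b f -> rintble f.
Proof.
move=> cf f0; have [M M0 fM] := supp_in_bounded cf f0.
apply: (@le_rintble _ _ (fun x => if x \in `[a, b] then M else 0)).
- exact: continuous_measurable_fun.
- exact: rintble_cst_supp.
- move=> x; case: ifPn => [_ //|/f0 ->]; by rewrite normr0.
Qed.

Lemma supp_cintble a b f (h : R -> C) : continuous f -> supp_in a b f -> cmeas h ->
  (forall t, cabs (h t) <= 1) -> cintble (fun t => h t * RtoC (f t)).
Proof.
move=> cf f0 mh h1; apply: (@le_cintble _ _ (fun t => `|f t|)).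
- apply: cmeasM => //; apply: cmeas_RtoC; exact: continuous_measurable_fun.
- exact: integrable_norm (supp_rintble cf f0).
- move=> x; rewrite cabsM cabs_RtoC -[leRHS]mul1r ler_wpM2r//.
Qed.

Lemma cmeas_expi_linear (x : R) : cmeas (fun t => expi (- (x * t))).
Proof.
apply: cmeas_expi; apply: continuous_measurable_fun => t.
by apply: cvgN; apply: cvgM; [exact: cvg_cst|exact: cvg_id].
Qed.

Lemma rft_cintble a b f x : continuous f -> supp_in a b f ->
  cintble (fun t => expi (- (x * t)) * RtoC (f t)).
Proof.
move=> cf f0; apply: (supp_cintble cf f0) => [|t]; first exact: cmeas_expi_linear.
by rewrite cabs_expi.
Qed.

Lemma cabs_cintegral_supp a b f (M : R) (h : R -> C) : a <= b -> continuous f ->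
  supp_in a b f -> (forall t, `|f t| <= M) -> cmeas h -> (forall t, cabs (h t) <= 1) ->
  cabs (cintegral (fun t => h t * RtoC (f t))) <= 2 * ((b - a) * M).
Proof.
move=> ab cf f0 fM mh h1; rewrite -(Rintegral_cst_supp M ab).
apply: cabs_cintegral_le; [exact: (supp_cintble cf f0)|exact: rintble_cst_supp|].
move=> t; rewrite cabsM cabs_RtoC; case: ifPn => [_|/f0 ->]; last by rewrite normr0 mulr0.
by rewrite -[leRHS]mul1r ler_pM ?cabs_ge0.
Qed.

Lemma rft_bound a b f (M x : R) : a <= b -> continuous f -> supp_in a b f ->
  (forall t, `|f t| <= M) -> cabs (rft f x) <= 2 * ((b - a) * M).
Proof.
move=> ab cf f0 fM; apply: cabs_cintegral_supp => //; first exact: cmeas_expi_linear.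
by move=> t; rewrite cabs_expi.
Qed.

Lemma Rintegral_derive0 a b f : rsmooth f -> supp_in a b f ->
  Rintegral mu setT f^`()%classic = 0.
Proof.
move=> sf f0; have [sf' df] := rsmoothP sf.
(* The interval is widened so that it is nondegenerate whatever the order of [a] and [b], and so
   that [f] vanishes at both ends. *)
pose a' := Num.min a b - 1; pose b' := Num.max a b + 1.
have ha : a' < a by rewrite /a'; case: (leP a b); lra.
have hb : b < b' by rewrite /b'; case: (leP a b); lra.
have ab : a' < b' by rewrite /a' /b'; case: (leP a b); lra.
have f0' := supp_in_derive sf f0.
rewrite (@Rintegral_supp _ a' b'); last first.
  move=> x xab; apply: f0'; apply: contra xab; rewrite !in_itv /= => /andP[]; lra.
rewrite /Rintegral (@continuous_FTC2 _ _ f)//.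
- have -> : f b' = 0 by apply: f0; rewrite in_itv /=; apply/negP => /andP[]; lra.
  have -> : f a' = 0 by apply: f0; rewrite in_itv /=; apply/negP => /andP[]; lra.
  by rewrite -EFinB subrr.
- by apply: continuous_subspaceT; exact: rsmooth_continuous.
- split => [x _||].
  + exact: ex_derive.
  + apply: cvg_at_right_filter; exact: rsmooth_continuous.
  + apply: cvg_at_left_filter; exact: rsmooth_continuous.
Qed.

Lemma Re_expiM (u y : R) : complex.Re (expi u * RtoC y : C) = cos u * y.
Proof. by rewrite Re_mul /= mulr0 subr0. Qed.

Lemma Im_expiM (u y : R) : complex.Im (expi u * RtoC y : C) = sin u * y.
Proof. by rewrite Im_mul /= mulr0 add0r. Qed.

(** Integration by parts: the derivative of [e^{-ixt} f(t)] has integral 0. Its real and imaginary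
    parts give [e1] and [e2]. *)
Lemma rft_derive a b f x : rsmooth f -> supp_in a b f ->
  rft f^`()%classic x = (0 +i* x)%C * rft f x.
Proof.
move=> sf f0; have [sf' df] := rsmoothP sf.
have [i1 i2] := rft_cintble x (rsmooth_continuous sf) f0.
have [j1 j2] := rft_cintble x (rsmooth_continuous sf') (supp_in_derive sf f0).
have sc : rsmooth (fun t => cos (- (x * t))).
  by under eq_fun do rewrite -mulNr -[_ * _]addr0; apply: rsmooth_affine; exact: rsmooth_cos.
have ss : rsmooth (fun t => sin (- (x * t))).
  by under eq_fun do rewrite -mulNr -[_ * _]addr0; apply: rsmooth_affine; exact: rsmooth_sin.
have d1 (t : R) : is_derive t 1 (fun t => - (x * t)) (- x).
  by apply: is_derive_eq; rewrite /GRing.scale/= mulr1.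
have dc (t : R) : is_derive t 1 (fun t => cos (- (x * t))) (- sin (- (x * t)) * - x).
  exact: (is_derive1_comp (f := cos)).
have ds (t : R) : is_derive t 1 (fun t => sin (- (x * t))) (cos (- (x * t)) * - x).
  exact: (is_derive1_comp (f := sin)).
have e1 : Rintegral mu setT (fun t => complex.Re (expi (- (x * t)) * RtoC (f^`()%classic t) : C)) +
    x * Rintegral mu setT (fun t => complex.Im (expi (- (x * t)) * RtoC (f t) : C)) = 0.
  rewrite -RintegralZl// -RintegralD//; last exact: rintbleZ.
  rewrite -(@Rintegral_derive0 a b (fun t => cos (- (x * t)) * f t)).
  - apply: eq_Rintegral => t _; rewrite Re_expiM Im_expiM.
    have h : is_derive (t : R) 1 (fun t => cos (- (x * t)) * f t)
        (cos (- (x * t)) * f^`()%classic t + x * (sin (- (x * t)) * f t)).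
      by apply: (is_derive_eq (is_deriveM (dc t) (df t))); rewrite /GRing.scale /=; ring.
    exact: (esym (is_derive1E h)).
  - exact: rsmoothM.
  - by move=> t /f0 ->; rewrite mulr0.
have e2 : Rintegral mu setT (fun t => complex.Im (expi (- (x * t)) * RtoC (f^`()%classic t) : C)) -
    x * Rintegral mu setT (fun t => complex.Re (expi (- (x * t)) * RtoC (f t) : C)) = 0.
  rewrite -RintegralZl// -RintegralB//; last exact: rintbleZ.
  rewrite -(@Rintegral_derive0 a b (fun t => sin (- (x * t)) * f t)).
  - apply: eq_Rintegral => t _; rewrite Re_expiM Im_expiM.
    have h : is_derive (t : R) 1 (fun t => sin (- (x * t)) * f t)
        (sin (- (x * t)) * f^`()%classic t - x * (cos (- (x * t)) * f t)).
      by apply: (is_derive_eq (is_deriveM (ds t) (df t))); rewrite /GRing.scale /=; ring.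
    exact: (esym (is_derive1E h)).
  - exact: rsmoothM.
  - by move=> t /f0 ->; rewrite mulr0.
apply: C_ext; rewrite ?Re_mul ?Im_mul /= ?mul0r ?add0r ?sub0r.
  by apply/eqP; rewrite -subr_eq0 opprK e1.
by apply/eqP; rewrite -subr_eq0 e2.
Qed.

Lemma rft_derive2 a b f x : rsmooth f -> supp_in a b f ->
  cabs (rft f^`()%classic^`()%classic x) = x ^+ 2 * cabs (rft f x).
Proof.
move=> sf f0; have [sf' df] := rsmoothP sf.
rewrite (rft_derive _ sf' (supp_in_derive sf f0)) (rft_derive _ sf f0) mulrA cabsM.
congr (_ * _); rewrite cabsM -expr2 cabs_sqr /= expr0n add0r //.
Qed.

Lemma rft_decay2 a b f (M x : R) : a <= b -> rsmooth f -> supp_in a b f ->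
  (forall t, `|f^`()%classic^`()%classic t| <= M) ->
  x ^+ 2 * cabs (rft f x) <= 2 * ((b - a) * M).
Proof.
move=> ab sf f0 fM; have [sf1 _] := rsmoothP sf; have [sf2 _] := rsmoothP sf1.
rewrite -(rft_derive2 _ sf f0); apply: rft_bound => //.
  exact: rsmooth_continuous.
exact/supp_in_derive/supp_in_derive.
Qed.

Lemma rft_bounded a b f : continuous f -> supp_in a b f ->
  exists2 K : R, 0 <= K & forall x, cabs (rft f x) <= K.
Proof.
move=> cf f0; have [M M0 fM] := supp_in_bounded cf f0.
have f0' : supp_in (Num.min a b) (Num.max a b) f.
  move=> x xab; apply: f0; apply: contra xab; rewrite !in_itv /= => /andP[].
  by rewrite ge_min le_max => -> ->; rewrite orbT.
have ab : Num.min a b <= Num.max a b by rewrite ge_min le_max lexx.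
exists (2 * ((Num.max a b - Num.min a b) * M)).
  by rewrite mulr_ge0// mulr_ge0// subr_ge0.
by move=> x; apply: rft_bound.
Qed.

(** Bounds for the transforms of [f] and of its second and fourth derivatives add up, since
    [(1 + x^2)^2 = 1 + 2 x^2 + x^4]. One factor [1 + x^2] will pay for coefficients of linear
    growth, the other keeps the series summable. *)
Lemma rft_decay a b f : rsmooth f -> supp_in a b f ->
  exists2 K : R, 0 <= K & forall x, cabs (rft f x) <= K / (1 + x ^+ 2) ^+ 2.
Proof.
move=> sf f0; have [sf1 _] := rsmoothP sf; have [sf2 _] := rsmoothP sf1.
have [sf3 _] := rsmoothP sf2; have [sf4 _] := rsmoothP sf3.
have f2 := supp_in_derive sf1 (supp_in_derive sf f0).
have [K K0 hK] := rft_bounded (rsmooth_continuous sf) f0.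
have [K2 K20 hK2] := rft_bounded (rsmooth_continuous sf2) f2.
have [K4 K40 hK4] := rft_bounded (rsmooth_continuous sf4)
  (supp_in_derive sf3 (supp_in_derive sf2 f2)).
exists (K + 2 * K2 + K4) => [|x]; first by lra.
have p : 0 < (1 + x ^+ 2) ^+ 2 by rewrite exprn_gt0// ltr_wpDr ?sqr_ge0.
have h0 := hK x.
have h2 : x ^+ 2 * cabs (rft f x) <= K2.
  by rewrite -(rft_derive2 x sf f0); exact: hK2.
have h4 : x ^+ 2 * cabs (rft f^`()%classic^`()%classic x) <= K4.
  by rewrite -(rft_derive2 x sf2 f2); exact: hK4.
rewrite (rft_derive2 x sf f0) in h4.
rewrite ler_pdivlMr//; move: (cabs _) h0 h2 h4 => c h0 h2 h4.
rewrite (_ : c * _ = c + 2 * (x ^+ 2 * c) + x ^+ 2 * (x ^+ 2 * c)); last by ring.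
lra.
Qed.

End FourierDecay.

Section Translation.
Variable R : realType.
Local Notation C := (Cplx R).
Local Notation mu := (@lebesgue_measure R).

Lemma integral_affine_ge0 (G : R -> R) (a b : R) : 0 < a -> continuous G ->
  (forall x, 0 <= G x) ->
  (\int[mu]_x (G x)%:E = \int[mu]_x (a * G (a * x + b))%:E)%E.
Proof.
move=> a0 cG G0; pose F (x : R) := a * x + b.
have dF (x : R) : is_derive x 1 F a.
  by apply: is_derive_eq; rewrite /GRing.scale /= addr0 mulr1.
have F' : F^`()%classic = fun=> a by apply/funext => x; exact: is_derive1E.
rewrite (@increasing_ge0_integration_by_substitutionT _ F)//.
- by apply: eq_integral => x _; rewrite F' /F /= mulrC.
- by move=> x y xy; rewrite /F ltrD2r ltr_pM2l.
- by rewrite F' => x; exact: cst_continuous.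
- by rewrite F'; exact: is_cvg_cst.
- by rewrite F'; exact: is_cvg_cst.
- apply/cvgrNyPle => A; near=> x.
  rewrite /F -lerBrDr mulrC -ler_pdivlMr//; near: x; exact: nbhs_ninfty_le.
- apply/cvgryPge => A; near=> x.
  rewrite /F -lerBlDr mulrC -ler_pdivrMr//; near: x; exact: nbhs_pinfty_ge.
Unshelve. all: by end_near. Qed.

Lemma rintble_affine_ge0 (G : R -> R) (a b : R) : 0 < a -> continuous G ->
  (forall x, 0 <= G x) -> rintble G ->
  rintble (fun x => G (a * x + b)) /\
  a * Rintegral mu setT (fun x => G (a * x + b)) = Rintegral mu setT G.
Proof.
move=> a0 cG G0 iG.
have cGa : continuous (fun x => G (a * x + b)).
  move=> x; apply: continuous_comp; last exact: cG.
  by apply: cvgD; [apply: cvgM; [exact: cvg_cst|exact: cvg_id]|exact: cvg_cst].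
have ia : rintble (fun x => a * G (a * x + b)).
  apply/integrableP; split.
    apply/measurable_EFinP; apply: measurable_funM => //.
    exact: continuous_measurable_fun.
  under eq_integral => x _ do rewrite /= ger0_norm ?mulr_ge0 ?(ltW a0)//.
  rewrite -(integral_affine_ge0 b a0 cG G0).
  have /integrableP[_] := iG.
  by under eq_integral => x _ do rewrite /= ger0_norm//.
have ib : rintble (fun x => G (a * x + b)).
  have := rintbleZ a^-1 ia.
  by under eq_fun do rewrite mulKf ?lt0r_neq0//.
split => //; rewrite -RintegralZl//.
by rewrite /Rintegral (integral_affine_ge0 b a0 cG G0).
Qed.

Lemma Rintegral_shift (f : R -> R) (c : R) : continuous f -> rintble f ->
  Rintegral mu setT (fun x => f (x + c)) = Rintegral mu setT f.
Proof.
move=> cf jf.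
(* The change of variables is available for nonnegative functions, hence the positive and negative
   parts [p] and [n]. *)
pose p x := 2^-1 * (`|f x| + f x); pose n x := 2^-1 * (`|f x| - f x).
have cn : continuous (fun x => `|f x|).
  by move=> x; apply: (continuous_comp (cf x)); exact: norm_continuous.
have jn : rintble (fun x => `|f x|) by exact: integrable_norm.
have cp : continuous p by move=> x; apply: cvgM; [exact: cvg_cst|apply: cvgD; [exact: cn|exact: cf]].
have cq : continuous n by move=> x; apply: cvgM; [exact: cvg_cst|apply: cvgB; [exact: cn|exact: cf]].
have p0 x : 0 <= p x by rewrite /p mulr_ge0//; have := ler_norm (- f x); rewrite normrN; lra.
have n0 x : 0 <= n x by rewrite /n mulr_ge0//; have := ler_norm (f x); lra.
have ip : rintble p by apply: rintbleZ; exact: rintbleD.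
have iq : rintble n by apply: rintbleZ; exact: rintbleB.
have [ip' ep] := rintble_affine_ge0 c ltr01 cp p0 ip.
have [iq' eq] := rintble_affine_ge0 c ltr01 cq n0 iq.
have fpn x : f x = p x - n x by rewrite /p /n; lra.
rewrite !mul1r in ep eq.
rewrite [RHS](_ : _ = Rintegral mu setT (fun x => p x - n x)); last first.
  by apply: eq_Rintegral => x _; exact: fpn.
rewrite RintegralB// -ep -eq -RintegralB//.
by apply: eq_Rintegral => x _; rewrite fpn !mul1r.
Qed.

End Translation.

Lemma le_absz_ceil (R : realType) (x : R) : x <= `|Num.ceil x|%N%:R.
Proof.
apply: le_trans (ceil_ge _) _; move: (Num.ceil x) => z.
by rewrite -[`|z|%N%:R]/((`|z|%N : int)%:~R) ler_int; lia.
Qed.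

(** * Pairings at radius [r < 1] and their limits *)

Section AbelPairing.
Variable R : realType.
Local Notation C := (Cplx R).
Local Notation mu := (@lebesgue_measure R).
Implicit Types (f g phi : R -> R) (h c : nat -> C) (H : C -> C).

(* [twist phi m] is the test function [phi(t) e^{-imt}], whose pairing with the boundary
   values of [sum_n h_n z^n] is the smoothed coefficient [sum_n h_n rft phi (m - n)]. *)
Definition twist phi (m : nat) (t : R) : C := expi (- (m%:R * t)) * RtoC (phi t).

Definition pairing H phi (r : R) (m : nat) : C :=
  cintegral (fun t => H (RtoC r * expi t) * twist phi m t).

Definition has_expansion H h := forall z : C, cabs z < 1 ->
  csum_cvg (fun n => h n * z ^+ n) (H z).

Lemma cabs_circle (r t : R) : cabs (RtoC r * expi t : C) = `|r|.
Proof. by rewrite cabsM cabs_RtoC cabs_expi mulr1. Qed.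

Lemma cabs_twist phi m t : cabs (twist phi m t) = `|phi t|.
Proof. by rewrite cabsM cabs_expi cabs_RtoC mul1r. Qed.

(** Take a radius [s] strictly between [r] and 1. The terms of the convergent series at [s] are
    bounded, and the ratio [q = r / s] is below 1. *)
Lemma coef_geometric_bound H h (r : R) : has_expansion H h -> 0 <= r < 1 ->
  exists B q : R, [/\ 0 <= B, 0 <= q, q < 1 &
    forall n, cabs (h n) * r ^+ n <= B * q ^+ n].
Proof.
move=> hH /andP[r0 r1]; pose s := (1 + r) / 2.
have s0 : 0 < s by rewrite /s; lra.
have s1 : s < 1 by rewrite /s; lra.
have rs : r < s by rewrite /s; lra.
have sH := hH (RtoC s); rewrite cabs_RtoC gtr0_norm// in sH.
have {sH} := sH s1; set l := H _ => sl.
have [N _ hN] := sl 1 ltr01.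
have tb n : (N <= n)%N -> cabs (h n) * s ^+ n <= 2.
  move=> Nn; have h1 := hN n Nn; have h2 := hN n.+1 (leqW Nn).
  have -> : cabs (h n) * s ^+ n = cabs (h n * RtoC s ^+ n).
    by rewrite cabsM cabsX cabs_RtoC gtr0_norm.
  move: h1 h2; rewrite /= big_nat_recr //=; set S := \sum_(0 <= i < n) _.
  set w := h n * _ => h1 h2.
  have -> : w = (S + w - l) - (S - l) by rewrite opprB addrA subrK addrAC subrr add0r.
  by apply: le_trans (cabsB _ _) _; lra.
have t0 n : 0 <= cabs (h n) * s ^+ n by rewrite mulr_ge0 ?cabs_ge0// exprn_ge0// ltW.
pose A := \sum_(i < N) cabs (h i) * s ^+ i + 2.
have A0 : 0 <= A by rewrite /A addr_ge0// sumr_ge0.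
have tA n : cabs (h n) * s ^+ n <= A.
  case: (leqP N n) => Nn.
    by apply: le_trans (tb n Nn) _; rewrite /A lerDr sumr_ge0.
  rewrite /A (bigD1 (Ordinal Nn))//= -addrA lerDl addr_ge0// sumr_ge0//.
exists A, (r / s); split => //.
- by rewrite divr_ge0// ltW.
- by rewrite ltr_pdivrMr// mul1r.
move=> n; rewrite [X in _ * X](_ : _ = s ^+ n * (r / s) ^+ n); last first.
  by rewrite -exprMn mulrC divfK// lt0r_neq0.
by rewrite mulrA ler_wpM2r// exprn_ge0// divr_ge0// ltW.
Qed.

Lemma geometric_sum_le (q : R) N : 0 <= q < 1 -> \sum_(0 <= n < N) q ^+ n <= (1 - q)^-1.
Proof.
move=> /andP[q0 q1]; have d : 0 < 1 - q by lra.
rewrite -[leRHS]mul1r ler_pdivlMr//.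
suff -> : (\sum_(0 <= n < N) q ^+ n) * (1 - q) = 1 - q ^+ N.
  by rewrite gerBl exprn_ge0.
elim: N => [|N IH]; first by rewrite big_geq// mul0r expr0 subrr.
by rewrite big_nat_recr//= mulrDl IH exprS; ring.
Qed.

(** At fixed [r < 1] the geometric bound dominates the partial sums uniformly on the circle, which
    allows termwise integration whatever the growth of [h] towards the boundary. *)
Lemma pairing_expansion H h phi a b r m : has_expansion H h -> 0 <= r < 1 ->
  continuous phi -> supp_in a b phi ->
  csum_cvg (fun n => h n * RtoC r ^+ n * rft phi (m%:R - n%:R)) (pairing H phi r m).
Proof.
move=> hH r01 cphi phi0.
have [B [q [B0 q0 q1 hB]]] := coef_geometric_bound hH r01.
have /andP[r0 r1] := r01.
pose F N t := \sum_(0 <= n < N) (h n * RtoC r ^+ n) * (expi (- ((m%:R - n%:R) * t)) * RtoC (phi t)).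
have FE N t : F N t = (\sum_(0 <= n < N) h n * (RtoC r * expi t) ^+ n) * twist phi m t.
  rewrite mulr_suml; apply: eq_bigr => n _; rewrite exprMn -!mulrA; congr (_ * (_ * _)).
  rewrite /twist mulrA -expi_natM -expiD; congr (expi _ * _); ring.
have mF N : cmeas (F N).
  apply: cmeas_sum => n; apply: cmeasM; first exact: cmeas_cst.
  apply: cmeasM; first exact: cmeas_expi_linear.
  by apply: cmeas_RtoC; exact: continuous_measurable_fun.
have iF N : cintegral (F N) = \sum_(0 <= n < N) h n * RtoC r ^+ n * rft phi (m%:R - n%:R).
  rewrite /F cintegral_sum => [|n]; last first.
    by apply: cintbleZ; exact: rft_cintble phi0.
  by apply: eq_bigr => n _; rewrite cintegralZ//; exact: rft_cintble phi0.
have Fl t : clim \oo (F ^~ t) (H (RtoC r * expi t) * twist phi m t).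
  have h1 : cabs (RtoC r * expi t : C) < 1 by rewrite cabs_circle ger0_norm.
  rewrite mulrC; apply: (eq_clim _ (climZ (twist phi m t) (hH _ h1))) => N /=.
  by rewrite FE mulrC.
have ig : rintble (fun t => B / (1 - q) * `|phi t|).
  by apply: rintbleZ; apply: integrable_norm; exact: supp_rintble phi0.
have Fg N t : cabs (F N t) <= B / (1 - q) * `|phi t|.
  rewrite FE cabsM cabs_twist ler_wpM2r//; apply: le_trans (cabs_sum _ _ _) _.
  apply: (@le_trans _ _ (\sum_(0 <= n < N) B * q ^+ n)).
    by apply: ler_sum => n _; rewrite cabsM cabsX cabs_circle ger0_norm.
  by rewrite -mulr_sumr ler_wpM2l// geometric_sum_le// q0.
have [_] := cintegral_dct mF Fl ig Fg.
by apply: eq_clim => N; exact: iF.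
Qed.

Lemma near1_left : \forall r \near (1 : R)^'-, 0 <= r < 1.
Proof.
near=> r; apply/andP; split.
  by apply/ltW; near: r; apply: nbhs_left_gt.
by near: r; exact: nbhs_left_lt.
Unshelve. all: by end_near. Qed.

Lemma RtoCX_near1 n : clim (1 : R)^'- (fun r => RtoC r ^+ n : C) 1.
Proof.
have -> : 1 = RtoC (1 ^+ n) :> C by rewrite expr1n.
under eq_fun do rewrite -RtoCX.
apply: clim_RtoC; apply: cvg_at_left_filter; exact: exprn_continuous.
Qed.

Lemma pairing_limit H h phi a b (B : R) m : has_expansion H h ->
  (forall n, cabs (h n) <= B * n.+1%:R) -> rsmooth phi -> supp_in a b phi ->
  exists2 l, csum_cvg (fun n => h n * rft phi (m%:R - n%:R)) l &
    clim (1 : R)^'- (fun r => pairing H phi r m) l.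
Proof.
move=> hH hB sphi phi0; have [K K0 hK] := rft_decay sphi phi0.
have B0 : 0 <= B by have := le_trans (cabs_ge0 _) (hB 0%N); rewrite mulr1.
(* With [y = m - n], linear growth is absorbed by [n + 1 <= 2 (m + 1) (1 + y^2)]. The majorant may
   depend on [m], which is fixed, but not on [r]. *)
pose D (n : nat) := B * K * (2 * m.+1%:R) * (1 ^+ 2 + (m%:R - n%:R) ^+ 2)^-1.
have hD n : cabs (h n * rft phi (m%:R - n%:R)) <= D n.
  rewrite cabsM.
  apply: (@le_trans _ _ (B * n.+1%:R * (K / (1 + (m%:R - n%:R) ^+ 2) ^+ 2))).
    by apply: ler_pM; rewrite ?cabs_ge0.
  rewrite /D expr1n; set y := m%:R - n%:R.
  have p1 : 0 < 1 + y ^+ 2 by rewrite ltr_wpDr ?sqr_ge0.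
  rewrite -!mulrA ler_wpM2l//.
  rewrite mulrCA ler_wpM2l// expr2 invfM !mulrA ler_wpM2r ?invr_ge0 ?(ltW p1)//.
  rewrite ler_pdivrMr// -(natr1 n) -(natr1 m).
  have m0 : 0 <= m%:R :> R by [].
  have : n%:R = m%:R - y by rewrite /y; lra.
  by move=> ->; have := sqr_ge0 (y + 1); nra.
have sD N : \sum_(0 <= n < N) D n <= B * K * (2 * m.+1%:R) * (3 * pi / 1).
  rewrite /D -mulr_sumr ler_wpM2l ?mulr_ge0//.
  exact: lattice_sum.
have [l hl _] := dominated_csum_cvg hD sD.
exists l => //.
apply: (@csum_dct _ _ _ _ (fun r n => h n * RtoC r ^+ n * rft phi (m%:R - n%:R)) _ D _ _ _ sD _ _ _ hl).
- apply: filterS near1_left => r /andP[r0 r1] n.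
  apply: le_trans (hD n); rewrite !cabsM ler_wpM2r ?cabs_ge0//.
  rewrite cabsX cabs_RtoC ger0_norm// ler_piMr ?cabs_ge0//.
  by rewrite exprn_ile1// ltW.
- move=> n; rewrite -[X in clim _ _ X]mulr1.
  by apply: (eq_clim _ (climZ _ (RtoCX_near1 n))) => r; rewrite mulrAC.
- apply: filterS near1_left => r r01.
  apply: pairing_expansion => //; [exact: rsmooth_continuous|exact: phi0].
Qed.

(** A null sequence convolved with a kernel of quadratic decay vanishes at infinity: the tail in [n]
    is small uniformly in the evaluation point, and each of the finitely many other terms tends to
    0. The filter is abstract because the evaluation point runs to infinity along the integers in
    one use and along the real line, in both directions, in another. *)
Lemma conv_cvg0 (T : Type) (F : set_system T) {FF : Filter F} (X : T -> R)
  (c : nat -> C) (w : R -> C) (K : R) (L : T -> C) :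
  (forall A : R, \forall x \near F, A <= `|X x|) ->
  0 <= K -> (forall x, cabs (w x) <= K / (1 + x ^+ 2)) -> clim \oo c 0 ->
  (forall x, csum_cvg (fun n => c n * w (X x - n%:R)) (L x)) -> clim F L 0.
Proof.
move=> hX K0 hw c0 hL e e0.
have k1 : 0 < K * (3 * pi) + 1 by have := pi_gt0 R; nra.
have d0 : 0 < e / 2 / (K * (3 * pi) + 1) by rewrite divr_gt0//; lra.
have [N _ hN] := c0 _ d0; move: d0 hN; set d := e / 2 / _ => d0 hN.
have tail x : cabs (L x - \sum_(0 <= n < N) c n * w (X x - n%:R)) <= d * (K * (3 * pi)).
  apply: (@csum_tail_le _ _ _ (fun n => cabs (c n * w (X x - n%:R))) _ _ (hL x)) => // M NM.
  apply: (@le_trans _ _ (\sum_(N <= n < M) d * (K * (1 ^+ 2 + (X x - n%:R) ^+ 2)^-1))).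
    rewrite big_seq [leRHS]big_seq; apply: ler_sum => n; rewrite mem_index_iota => /andP[Nn _].
    rewrite cabsM; apply: ler_pM; rewrite ?cabs_ge0//; last by rewrite expr1n; exact: hw.
    by have := hN n Nn; rewrite /= subr0 => /ltW.
  rewrite -!mulr_sumr ler_wpM2l ?(ltW d0)// ler_wpM2l//.
  by have := @lattice_sum R 1 (X x) N M (lexx 1) NM; rewrite divr1.
have w0 n : clim F (fun x => c n * w (X x - n%:R)) 0.
  rewrite -(mulr0 (c n)); apply: climZ => e' e'0.
  have := hX (n%:R + K / e' + 1); apply: filterS => x nx; rewrite subr0.
  apply: le_lt_trans (hw _) _.
  have q0 : 0 <= K / e' by rewrite divr_ge0// ltW.
  have := ler_distD n%:R (X x) 0; rewrite !subr0 normr_nat => tri.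
  have y1 : K / e' + 1 <= `|X x - n%:R| by lra.
  rewrite ltr_pdivrMr ?ltr_wpDr ?sqr_ge0// -ltr_pdivrMl// mulrC.
  rewrite -(real_normK (num_real (X x - n%:R))).
  by move: (`|X x - n%:R|) (K / e') y1 q0 => y z y1 q0; nra.
have := @clim_sum R T F FF _ (index_iota 0 N) _ _ w0 _ (divr_gt0 e0 (ltr0Sn _ 1)).
rewrite big1 //; apply: filterS => x; rewrite !subr0 => h1.
have := cabsD (L x - \sum_(0 <= n < N) c n * w (X x - n%:R))
  (\sum_(0 <= n < N) c n * w (X x - n%:R)); rewrite subrK.
have := tail x.
have : d * (K * (3 * pi)) <= e / 2.
  rewrite /d mulrAC ler_pdivrMr// ler_wpM2l//; lra.
lra.
Qed.

Lemma clim0_bounded (c : nat -> C) : clim \oo c 0 ->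
  exists2 B : R, 0 <= B & forall n, cabs (c n) <= B.
Proof.
move=> c0; have [N _ hN] := c0 1 ltr01.
exists (\sum_(i < N) cabs (c i) + 1).
  by rewrite addr_ge0// sumr_ge0// => i _; exact: cabs_ge0.
move=> n; case: (leqP N n) => Nn.
  have := hN n Nn; rewrite /= subr0 => /ltW h; apply: le_trans h _.
  by rewrite lerDr sumr_ge0// => i _; exact: cabs_ge0.
rewrite (bigD1 (Ordinal Nn))//= -addrA lerDl addr_ge0// sumr_ge0// => i _.
exact: cabs_ge0.
Qed.

End AbelPairing.

(** * Good test functions *)

Section FourierContinuity.
Variable R : realType.
Local Notation C := (Cplx R).
Local Notation mu := (@lebesgue_measure R).
Implicit Types (f g phi : R -> R).

Lemma lipschitz1 f (df : R -> R) : (forall x : R, is_derive x 1 f (df x)) ->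
  (forall x, `|df x| <= 1) -> forall x y, `|f x - f y| <= `|x - y|.
Proof.
move=> fd f1; suff h x y : x < y -> `|f y - f x| <= `|y - x|.
  move=> x y; case: (ltgtP x y) => [/h|/h//|->]; last by rewrite !subrr.
  by rewrite distrC (distrC x).
move=> xy; have [c _ ->] := @MVT _ f df x y xy (fun z _ => fd z)
  (derivable_within_continuous (fun z _ => @ex_derive _ _ _ _ _ _ _ (fd z))).
by rewrite normrM ler_piMl.
Qed.

Lemma cos_lipschitz (x y : R) : `|cos x - cos y| <= `|x - y|.
Proof.
apply: (@lipschitz1 _ (fun x => - sin x)) => z.
by rewrite normrN ler_norml sin_geN1 sin_le1.
Qed.

Lemma sin_lipschitz (x y : R) : `|sin x - sin y| <= `|x - y|.
Proof.
apply: (@lipschitz1 _ cos) => z.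
by rewrite ler_norml cos_geN1 cos_le1.
Qed.

Lemma expi_lipschitz (x y : R) : cabs (expi x - expi y : C) <= 2 * `|x - y|.
Proof.
apply: le_trans (cabs_le_ReIm _) _; rewrite Re_add Im_add Re_opp Im_opp /=.
by have := cos_lipschitz x y; have := sin_lipschitz x y; lra.
Qed.

(** The transform is Lipschitz with constant a multiple of the integral of [|t phi(t)|]. Continuity
    then gives the measurability recorded in [cmeas_rft]. *)
Lemma rft_continuous a b phi : continuous phi -> supp_in a b phi ->
  continuous (fun x => complex.Re (rft phi x)) /\
  continuous (fun x => complex.Im (rft phi x)).
Proof.
move=> cphi phi0; pose g t := `|t * phi t|.
have ig : rintble g.
  apply: integrable_norm; apply: (@supp_rintble _ a b (fun t => t * phi t)).
    by move=> t; apply: cvgM; [exact: cvg_id|exact: cphi].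
  by move=> t /phi0 ->; rewrite mulr0.
pose A := 2 * (2 * Rintegral mu setT g).
have lip x y : cabs (rft phi x - rft phi y) <= A * `|x - y|.
  have ix := rft_cintble x cphi phi0; have iy := rft_cintble y cphi phi0.
  rewrite /rft /fourier -cintegralB// /A.
  rewrite (_ : 2 * (2 * _) * _ = 2 * (2 * `|x - y| * Rintegral mu setT g)); last by ring.
  rewrite -RintegralZl//; apply: cabs_cintegral_le.
  - have := cintbleD ix (cintbleZ (-1) iy).
    by under eq_fun do rewrite mulN1r.
  - exact: rintbleZ.
  - move=> t; rewrite -mulrBl cabsM cabs_RtoC /g normrM mulrA ler_wpM2r//.
    apply: le_trans (expi_lipschitz _ _) _.
    rewrite (_ : - (x * t) - - (y * t) = - ((x - y) * t)); last by ring.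
    by rewrite normrN normrM mulrA.
have A0 : 0 <= A by rewrite !mulr_ge0// Rintegral_ge0// => t _; exact: normr_ge0.
have cts f : (forall x y, `|f x - f y| <= cabs (rft phi x - rft phi y)) -> continuous f.
  move=> hf x; apply/cvgrPdist_lt => e e0.
  have A1 : 0 < A + 1 by lra.
  apply/nbhs_ballP; exists (e / (A + 1)); first exact: divr_gt0.
  move=> y; rewrite /ball /= => xy.
  apply: le_lt_trans (hf _ _) _; apply: le_lt_trans (lip _ _) _.
  move: xy; rewrite ltr_pdivlMr// mulrC; apply: le_lt_trans; rewrite ler_wpM2r//; lra.
split; apply: cts => x y.
  by have := Re_le_cabs (rft phi x - rft phi y); rewrite Re_add Re_opp.
by have := Im_le_cabs (rft phi x - rft phi y); rewrite Im_add Im_opp.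
Qed.

Lemma cmeas_rft a b phi (u : R -> R) : continuous phi -> supp_in a b phi ->
  measurable_fun setT u -> cmeas (fun x => rft phi (u x)).
Proof.
move=> cphi phi0 mu'; have [c1 c2] := rft_continuous cphi phi0.
have m1 := continuous_measurable_fun c1; have m2 := continuous_measurable_fun c2.
by split; [exact: (measurableT_comp m1 mu')|exact: (measurableT_comp m2 mu')].
Qed.

Definition cauchyk (x : R) : R := (1 + x ^+ 2)^-1.

Lemma cauchyk_ge0 x : 0 <= cauchyk x.
Proof. by rewrite invr_ge0 addr_ge0// sqr_ge0. Qed.

Lemma cauchyk_le1 x : cauchyk x <= 1.
Proof. by rewrite invf_le1 ?lerDl ?sqr_ge0// ltr_wpDr// sqr_ge0. Qed.

Lemma cauchyk_continuous : continuous cauchyk.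
Proof. exact: continuous_oneDsqrV. Qed.

Lemma cauchyk_rintble : rintble cauchyk.
Proof.
apply/integrableP; split.
  apply/measurable_EFinP; apply: continuous_measurable_fun; exact: cauchyk_continuous.
under eq_integral => x _ do rewrite /= ger0_norm ?cauchyk_ge0//.
rewrite ge0_symfun_integralT//; last 3 first.
- exact: cauchyk_ge0.
- exact: cauchyk_continuous.
- by move=> x; rewrite /= /cauchyk sqrrN.
rewrite (_ : [set x | _] = `[0%R, +oo[%classic); last first.
  by apply/seteqP; split=> x /=; rewrite in_itv /= andbT.
have := integral0y_oneDsqr R; rewrite /oneDsqr /cauchyk => ->.
by rewrite -EFinM ltry.
Qed.

Lemma cauchyk_shift (c : R) : rintble (fun x => cauchyk (x + c)) /\
  Rintegral mu setT (fun x => cauchyk (x + c)) = Rintegral mu setT cauchyk.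
Proof.
have := rintble_affine_ge0 c ltr01 cauchyk_continuous cauchyk_ge0 cauchyk_rintble.
by rewrite mul1r => -[h1 h2]; split; [move: h1|rewrite -h2; apply: eq_Rintegral => x _];
  (under eq_fun do rewrite mul1r) || rewrite mul1r.
Qed.

Lemma rft_cauchyk a b phi : rsmooth phi -> supp_in a b phi ->
  exists2 K : R, 0 <= K & forall x, cabs (rft phi x) <= K * cauchyk x.
Proof.
move=> sphi phi0; have [K K0 hK] := rft_decay sphi phi0.
exists K => // x; apply: le_trans (hK x) _.
have h : 1 <= 1 + x ^+ 2 by rewrite lerDl sqr_ge0.
rewrite ler_wpM2l// lef_pV2 ?posrE ?exprn_gt0//; try lra.
by rewrite expr2 ler_peMl//; lra.
Qed.

End FourierContinuity.

(** * From local pseudofunction behavior to good bumps *)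

Section LocalPseudofunction.
Variable R : realType.
Local Notation C := (Cplx R).
Local Notation mu := (@lebesgue_measure R).
Implicit Types (f g phi psi : R -> R) (h c : nat -> C) (H : C -> C).

Definition good H phi := exists2 l : nat -> C,
  forall m, clim (1 : R)^'- (fun r => pairing H phi r m) (l m) & clim \oo l 0.

Lemma twist_test_fun U a b phi m : rsmooth phi -> supp_in a b phi ->
  `[a, b]%classic `<=` U -> test_fun U (twist phi m).
Proof.
move=> sphi phi0 abU; split.
  have e : (fun t => complex.Re (twist phi m t)) = (fun t => cos ((- m%:R) * t + 0) * phi t).
    by apply/funext => t; rewrite /twist Re_expiM addr0 mulNr.
  have e' : (fun t => complex.Im (twist phi m t)) = (fun t => sin ((- m%:R) * t + 0) * phi t).
    by apply/funext => t; rewrite /twist Im_expiM addr0 mulNr.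
  have [h1] : rsmooth (fun t => cos ((- m%:R) * t + 0) * phi t).
    by apply: rsmoothM => //; apply: rsmooth_affine; exact: rsmooth_cos.
  have [h2] : rsmooth (fun t => sin ((- m%:R) * t + 0) * phi t).
    by apply: rsmoothM => //; apply: rsmooth_affine; exact: rsmooth_sin.
  by move=> n x; rewrite e e'; split; [exact: h1|exact: h2].
exists `[a, b]%classic; split; first exact: segment_compact.
split => // x /= /negP xab.
by rewrite /twist phi0// RtoC0 mulr0.
Qed.

Lemma fourier_twist phi m x : fourier (twist phi m) (- x) = rft phi (m%:R - x).
Proof.
apply: eq_cintegral => t; rewrite /twist mulrA -expiD; congr (expi _ * _); ring.
Qed.

(** The pairing is the convolution of [G] with the transform of [phi], evaluated at [m]. Outside
    [[-X, X]] the function [G] is small; inside, the transform is evaluated at distance at least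
    [m - X] from the origin. *)
Lemma pf_pairing_twist_cvg0 (G : R -> C) a b phi : pf_transform G ->
  rsmooth phi -> supp_in a b phi -> clim \oo (fun m => pf_pairing G (twist phi m)) 0.
Proof.
move=> [mG1 [mG2 [[M GM] [/climP Gp /climP Gn]]]] sphi phi0.
have {}GM x : cabs (G x) <= M by have := GM x; rewrite cabsE lecR.
have M0 : 0 <= M by apply: le_trans (GM 0); exact: cabs_ge0.
have [K K0 hK] := rft_cauchyk sphi phi0.
have cphi := rsmooth_continuous sphi.
pose W := Rintegral mu setT (@cauchyk R).
have W0 : 0 <= W by apply: Rintegral_ge0 => x _; exact: cauchyk_ge0.
move=> e e0; pose d := e / 2 / (K * W + 1).
have KW : 0 <= K * W by rewrite mulr_ge0.
have d0 : 0 < d by rewrite /d !divr_gt0//; lra.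
have [X X0 hX] : exists2 X : R, 0 < X & forall x, X < `|x| -> cabs (G x) <= d.
  have [X1 [_ h1]] := Gp _ d0; have [X2 [_ h2]] := Gn _ d0.
  exists (`|X1| + `|X2| + 1) => [|x]; first by have := normr_ge0 X1; have := normr_ge0 X2; lra.
  case: (leP 0 x) => x0 hx.
    rewrite (ger0_norm x0) in hx; have := h1 x; rewrite subr0 => h; apply/ltW/h.
    by have := ler_norm X1; have := normr_ge0 X2; lra.
  rewrite (ltr0_norm x0) in hx; have := h2 x; rewrite subr0 => h; apply/ltW/h.
  by have := ler_norm (- X2); rewrite normrN; have := normr_ge0 X1; lra.
(* This makes [m - X] at least 1 and larger than [4 M K X / e], so that the contribution of
   [[-X, X]], at most [2 X M K / (m - X)], is below [e / 2]. *)
pose N := (`|Num.ceil (X + M * K * (2 * X) * 2 / e)| + 1)%N.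
exists N => // m /= Nm; rewrite subr0.
have mX : X + M * K * (2 * X) * 2 / e <= m%:R - 1.
  rewrite lerBrDr; apply: (@le_trans _ _ N%:R); last by rewrite ler_nat.
  by rewrite natrD lerD2r; exact: le_absz_ceil.
have q0 : 0 <= M * K * (2 * X) * 2 / e by rewrite !mulr_ge0// ?invr_ge0 ltW.
pose mX1 := m%:R - X; have mX1p : 1 <= mX1 by rewrite /mX1; lra.
pose g x := d * K * cauchyk (x + - m%:R) + (if x \in `[- X, X] then M * (K * mX1^-1) else 0).
have [ik ek] := cauchyk_shift (- (m%:R : R)).
have ig : rintble g by apply: rintbleD; [exact: rintbleZ|exact: rintble_cst_supp].
have bd x : cabs (G x * rft phi (m%:R - x)) <= g x.
  rewrite cabsM; case: (ltP X `|x|) => Xx.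
    have xX : (x \in `[- X, X]) = false.
      by apply: contraTF Xx; rewrite in_itv /= -leNgt ler_norml.
    rewrite /g xX addr0 -mulrA; apply: ler_pM; rewrite ?cabs_ge0//; first exact: hX.
    apply: le_trans (hK _) _; rewrite /cauchyk (_ : (m%:R - x) ^+ 2 = (x - m%:R) ^+ 2)//; ring.
  have xX : x \in `[- X, X] by rewrite in_itv /= -ler_norml.
  rewrite /g xX; apply: (@le_trans _ _ (M * (K * mX1^-1))); last first.
    by rewrite lerDr mulr_ge0 ?cauchyk_ge0// mulr_ge0// ltW.
  apply: ler_pM; rewrite ?cabs_ge0//; apply: le_trans (hK _) _.
  rewrite ler_wpM2l// lef_pV2 ?posrE; last 2 first.
  - by rewrite ltr_wpDr ?sqr_ge0.
  - by lra.
  have : mX1 <= m%:R - x by move: Xx; rewrite ler_norml /mX1 => /andP[]; lra.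
  set y := m%:R - x => hy; nra.
have mm : cmeas (fun x => G x * rft phi (m%:R - x)).
  apply: cmeasM; first by split.
  apply: (cmeas_rft cphi phi0); apply: measurable_funB => //; exact: measurable_cst.
rewrite /pf_pairing cabsM cabs_RtoC.
rewrite (@eq_cintegral _ _ (fun x => G x * rft phi (m%:R - x))); last first.
  by move=> x; rewrite fourier_twist.
have hb := cabs_cintegral_le (le_cintble mm ig bd) ig bd.
have XX : - X <= X by lra.
have eg : Rintegral mu setT g = d * K * W + (X - - X) * (M * (K * mX1^-1)).
  rewrite RintegralD//; [|exact: rintbleZ|exact: rintble_cst_supp].
  by rewrite RintegralZl// ek Rintegral_cst_supp.
rewrite eg in hb.
(* The normalisation [1 / (2 pi)] compensates the factor 2 of [cabs_cintegral_le]. *)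
have pi1 : `|(2 * pi)^-1| <= 2^-1 :> R.
  have p2 := @pi_ge2 R; rewrite gtr0_norm ?invr_gt0; last by lra.
  by rewrite lef_pV2 ?posrE; lra.
have mX1i : (X - - X) * (M * (K * mX1^-1)) < e / 2.
  rewrite (_ : _ * _ = M * K * (2 * X) / mX1); last by ring.
  rewrite ltr_pdivrMr; last by lra.
  have : M * K * (2 * X) * 2 / e < mX1 by rewrite /mX1; lra.
  rewrite ltr_pdivrMr//; lra.
have dW : d * K * W <= e / 2.
  rewrite /d -mulrA mulrAC ler_pdivrMr ?ler_wpM2l//; lra.
have := cabs_ge0 (cintegral (fun x => G x * rft phi (m%:R - x))); move: hb pi1.
set v := cabs _; set w := `|_|; have : 0 <= w by exact: normr_ge0.
nra.
Qed.

Lemma lpf_good H U t0 : lpf_boundary H U -> U t0 ->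
  exists2 d : R, 0 < d & forall a b phi, rsmooth phi -> supp_in a b phi ->
    t0 - d <= a -> b <= t0 + d -> good H phi.
Proof.
move=> [_ [T [HT lT]]] /lT[V [oV [Vt0 [VU [G [pG TG]]]]]].
have [d /= d0 dV] : nbhs_ball t0 V by apply/nbhs_ballP; exact: open_nbhs_nbhs.
have d2 : 0 < d / 2 by lra.
exists (d / 2) => // a b phi sphi phi0 ha hb.
have abV : `[a, b]%classic `<=` V.
  move=> x /=; rewrite in_itv /= => /andP[ax xb]; apply: dV.
  rewrite /ball /= ltr_norml; apply/andP; split; lra.
exists (fun m => T (twist phi m)).
  move=> m; apply/climP; apply: HT; apply: (twist_test_fun _ sphi phi0).
  exact: subset_trans VU.
apply: (eq_clim _ (pf_pairing_twist_cvg0 pG sphi phi0)) => m.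
by rewrite TG//; exact: (twist_test_fun _ sphi phi0).
Qed.

End LocalPseudofunction.

(** * A cutoff of the circle that recovers the coefficients *)

Section CutoffCoefficient.
Variable R : realType.

Lemma near1_filter : Filter (1 : R)^'-.
Proof. exact: filter_filter. Qed.

Local Notation C := (Cplx R).
Local Notation mu := (@lebesgue_measure R).
Implicit Types (f g phi psi : R -> R) (h c : nat -> C) (H : C -> C).

Lemma rftD a b f g x : continuous f -> supp_in a b f -> continuous g -> supp_in a b g ->
  rft (fun t => f t + g t) x = rft f x + rft g x.
Proof.
move=> cf f0 cg g0; rewrite /rft /fourier -cintegralD; last 2 first.
- exact: rft_cintble f0.
- exact: rft_cintble g0.
by apply: eq_cintegral => t; rewrite RtoCD mulrDr.
Qed.

(** The frequency [m - n] is an integer, so the exponential has period [2 pi]. *)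
Lemma rft_shift_period a b f (m n : nat) : continuous f -> supp_in a b f ->
  rft (fun t => f (t - 2 * pi)) (m%:R - n%:R) = rft f (m%:R - n%:R).
Proof.
move=> cf f0; set k := m%:R - n%:R.
pose F t : C := expi (- (k * t)) * RtoC (f t).
have FE t : expi (- (k * t)) * RtoC (f (t - 2 * pi)) = F (t + (- (2 * pi))).
  rewrite /F; congr (_ * _).
  have -> : - (k * (t + - (2 * pi))) = - (k * t) + (m%:Z - n%:Z)%:~R * (2 * pi).
    by rewrite intrB /k; ring.
  by rewrite expi_periodic.
rewrite /rft /fourier (eq_cintegral FE).
have [i1 i2] := rft_cintble k cf f0.
have cc : continuous (fun t : R => - (k * t)).
  by move=> t; apply: cvgN; apply: cvgM; [exact: cvg_cst|exact: cvg_id].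
apply: C_ext => /=.
  apply: (Rintegral_shift (f := fun t => complex.Re (F t))) => //.
  rewrite /F; under eq_fun do rewrite Re_expiM.
  move=> t; apply: cvgM; last exact: cf.
  by apply: (continuous_comp (cc t)); exact: continuous_cos.
apply: (Rintegral_shift (f := fun t => complex.Im (F t))) => //.
rewrite /F; under eq_fun do rewrite Im_expiM.
move=> t; apply: cvgM; last exact: cf.
by apply: (continuous_comp (cc t)); exact: continuous_sin.
Qed.

(** The translates of this function by multiples of [2 pi] telescope to the constant 1, so it stands
    for the constant function of the circle among bumps on the line. *)
Definition circle_cutoff (a t : R) : R :=
  smooth_step (t - a) - smooth_step (t - a - 2 * pi).

Lemma rsmooth_shift f (a : R) : rsmooth f -> rsmooth (fun t => f (t - a)).
Proof.
move=> sf; have := @rsmooth_affine R f 1 (- a) sf.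
by under eq_fun do rewrite mul1r.
Qed.

Lemma rsmooth_circle_cutoff a : rsmooth (circle_cutoff a).
Proof.
apply: rsmoothB; first by apply: (@rsmooth_shift _ a); exact: rsmooth_step.
have := @rsmooth_shift _ (a + 2 * pi) (@rsmooth_step R).
by under eq_fun do rewrite opprD addrA.
Qed.

Lemma supp_circle_cutoff a : supp_in a (a + 2 * pi + 1) (circle_cutoff a).
Proof.
move=> t; rewrite in_itv /= negb_and -!ltNge /circle_cutoff => /orP[ta|ta].
  have p := pi_ge0 R.
  by rewrite !smooth_step0 ?subrr//; lra.
have p := pi_ge0 R.
by rewrite !smooth_step1 ?subrr//; lra.
Qed.

Lemma circle_cutoff_ge0 a t : 0 <= circle_cutoff a t.
Proof.
have p := pi_ge2 R; rewrite /circle_cutoff; case: (leP t (a + 2 * pi)) => h.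
  by rewrite (@smooth_step0 _ (_ - 2 * pi)) ?subr0 ?smooth_step_ge0//; lra.
by rewrite (@smooth_step1 _ (t - a)) ?subr_ge0 ?smooth_step_le1//; lra.
Qed.

Lemma circle_cutoff1 a t : a + 1 <= t <= a + 2 * pi -> circle_cutoff a t = 1.
Proof.
move=> /andP[h1 h2]; rewrite /circle_cutoff smooth_step1; last by lra.
by rewrite smooth_step0 ?subr0//; lra.
Qed.

Lemma supp_step_derive : supp_in 0 1 (@smooth_step R)^`()%classic.
Proof.
move=> x; rewrite in_itv /= negb_and -!ltNge => /orP[x0|x1]; apply: is_derive1E.
  apply: (@near_eq_is_derive _ _ _ (fun=> 0)); near=> y; rewrite smooth_step0//.
  by apply/ltW; near: y; exact: lt_nbhsl.
apply: (@near_eq_is_derive _ _ _ (fun=> 1 : R)); near=> y; rewrite smooth_step1//.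
by apply/ltW; near: y; exact: lt_nbhsr.
Unshelve. all: by end_near. Qed.

(** At a nonzero integer [k], multiplication by [i k] passes to the derivative, which is a bump
    minus its translate by [2 pi]; both have the same transform at [k]. At 0 the value is the
    integral, positive because the cutoff is nonnegative and equals 1 on [[a + 1, a + 2]]. *)
Lemma rft_circle_cutoff a : exists2 k : C, k != 0 & forall m n : nat,
  rft (circle_cutoff a) (m%:R - n%:R) = if m == n then k else 0.
Proof.
pose X := circle_cutoff a.
have sX : rsmooth X := @rsmooth_circle_cutoff a.
have cX := rsmooth_continuous sX.
have X0 := @supp_circle_cutoff a.
exists (rft X 0).
  have iX : rintble X := supp_rintble cX X0.
  have -> : rft X 0 = RtoC (Rintegral mu setT X).
    rewrite -cintegral_RtoC; apply: eq_cintegral => t.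
    by rewrite mul0r oppr0 expi0 mul1r.
  apply/eqP => /(congr1 (@complex.Re R)) /= X00.
  have := @le_RintegralT _ (fun t => if t \in `[a + 1, a + 2] then 1 else 0) X
    (@rintble_cst_supp _ _ _ _) iX.
  rewrite Rintegral_cst_supp ?lerD2l ?ler1n// X00 => /(_ _).
  have h x : (if x \in `[a + 1, a + 2] then 1 else 0) <= X x.
    case: ifPn => [|_]; last exact: circle_cutoff_ge0.
    rewrite in_itv /= => /andP[h1 h2]; rewrite /X circle_cutoff1//.
    by have := pi_ge2 R; lra.
  by move=> /(_ h); lra.
move=> m n; case: eqVneq => [->|mn]; first by rewrite subrr.
set k := m%:R - n%:R.
have k0 : (0 +i* k)%C != 0 :> C.
  apply/eqP => /(congr1 (@complex.Im R)) /= /eqP; rewrite subr_eq0 eqr_nat.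
  exact/negP.
apply: (mulfI k0); rewrite mulr0 -(rft_derive _ sX X0).
have [ss ds] := rsmoothP (@rsmooth_step R).
pose s1 t := (@smooth_step R)^`()%classic (t - a).
have ss1 : rsmooth s1 := @rsmooth_shift _ a ss.
have supp1 : supp_in a (a + 1 + 2 * pi) s1.
  move=> t ht; apply: supp_step_derive; apply: contra ht; rewrite !in_itv /=.
  by have := pi_ge0 R; move=> p /andP[]; lra.
have shd (u t : R) : is_derive t 1 (fun t => smooth_step (t - u))
    ((@smooth_step R)^`()%classic (t - u)).
  have := @is_derive_affine _ _ 1 (- u) _ t (ds (1 * t - u)).
  by rewrite !mul1r; under [X in is_derive _ _ X _]eq_fun do rewrite mul1r.
have XE : X^`()%classic = fun t => s1 t + - s1 (t - 2 * pi).
  apply/funext => t; apply: is_derive1E.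
  have h1 := shd a t; have h2 := shd (a + 2 * pi) t.
  rewrite /s1 /X /circle_cutoff.
  have e (y : R) : y - a - 2 * pi = y - (a + 2 * pi) by ring.
  have e' (y : R) : y - 2 * pi - a = y - (a + 2 * pi) by ring.
  rewrite e'; under [X in is_derive _ _ X _]eq_fun do rewrite e.
  exact: (is_deriveB h1 h2).
have supp2 : supp_in a (a + 1 + 2 * pi) (fun t => - s1 (t - 2 * pi)).
  move=> t ht; rewrite /s1 supp_step_derive ?oppr0//; apply: contra ht; rewrite !in_itv /=.
  by have := pi_ge0 R; move=> p /andP[]; lra.
have ss2 : rsmooth (fun t => s1 (t - 2 * pi)) := @rsmooth_shift _ (2 * pi) ss1.
rewrite XE (rftD _ (rsmooth_continuous ss1) supp1 (rsmooth_continuous (rsmoothN ss2)) supp2).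
have -> : rft (fun t => - s1 (t - 2 * pi)) k = - rft (fun t => s1 (t - 2 * pi)) k.
  rewrite /rft /fourier -cintegralN; last first.
    apply: (@rft_cintble _ a (a + 1 + 2 * pi)); first exact: rsmooth_continuous.
    by move=> t /supp2/eqP; rewrite oppr_eq0 => /eqP.
  by apply: eq_cintegral => t; rewrite RtoCN mulrN.
by rewrite (rft_shift_period _ _ (rsmooth_continuous ss1) supp1) subrr.
Qed.

(** All terms of the pairing but one vanish: it equals [h m * k * r ^+ m], whose limit as [r] tends
    to 1 returns the coefficient with no bound on [h]. *)
Lemma cutoff_coef H h a : has_expansion H h -> good H (circle_cutoff a) ->
  clim \oo h 0.
Proof.
move=> hH [l Hl l0]; have [k k0 hk] := rft_circle_cutoff a.
suff hl m : h m = k^-1 * l m.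
  by rewrite -(mulr0 k^-1); apply: (eq_clim _ (climZ k^-1 l0)) => m; rewrite hl.
have e : clim (1 : R)^'- (fun r => pairing H (circle_cutoff a) r m) (h m * k).
  rewrite -[X in clim _ _ X]mulr1 => e e0.
  have hn := @climZ R _ _ near1_filter (h m * k) _ _ (@RtoCX_near1 R m) e e0.
  apply: filterS2 (near1_left R) hn => r r01.
  suff -> : pairing H (circle_cutoff a) r m = h m * k * RtoC r ^+ m by [].
  have cX := rsmooth_continuous (@rsmooth_circle_cutoff a).
  have := pairing_expansion m hH r01 cX (@supp_circle_cutoff a).
  move=> /clim_unique; apply => e' e'0; exists m.+1 => // N /= mN.
  rewrite (bigD1_seq m) ?mem_index_iota ?iota_uniq//= hk eqxx big1_seq ?addr0.
    by rewrite mulrAC subrr cabs0.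
  by move=> n /andP[nm _]; rewrite hk eq_sym (negbTE nm) mulr0.
have -> : l m = h m * k by exact: (clim_unique (Hl m) e).
by rewrite mulrC mulfK.
Qed.

(** [H] is known only through its expansion, so integrability comes from the polynomial partial sums
    by dominated convergence. *)
Lemma pairing_cintble H h phi a b r m : has_expansion H h -> 0 <= r < 1 ->
  continuous phi -> supp_in a b phi ->
  cintble (fun t => H (RtoC r * expi t) * twist phi m t).
Proof.
move=> hH r01 cphi phi0.
have [B [q [B0 q0 q1 hB]]] := coef_geometric_bound hH r01.
have /andP[r0 r1] := r01.
have cr t : cabs (RtoC r * expi t : C) < 1 by rewrite cabs_circle ger0_norm.
have partial N t : cabs (\sum_(0 <= n < N) h n * (RtoC r * expi t) ^+ n) <= B / (1 - q).
  apply: le_trans (cabs_sum _ _ _) _.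
  apply: (@le_trans _ _ (\sum_(0 <= n < N) B * q ^+ n)).
    by apply: ler_sum => n _; rewrite cabsM cabsX cabs_circle ger0_norm.
  by rewrite -mulr_sumr ler_wpM2l// geometric_sum_le// q0.
have mcirc : cmeas (fun t => RtoC r * expi t).
  by apply: cmeasM; [exact: cmeas_cst|apply: cmeas_expi].
have mX (f : R -> C) n : cmeas f -> cmeas (fun t => f t ^+ n).
  move=> mf; elim: n => [|n IH]; first by under eq_fun do rewrite expr0; exact: cmeas_cst.
  by under eq_fun do rewrite exprS; exact: cmeasM.
have [mH _] : cintble (fun t => H (RtoC r * expi t) * twist phi m t) /\
   clim \oo (fun N => cintegral (fun t => (\sum_(0 <= n < N) h n * (RtoC r * expi t) ^+ n) *
     twist phi m t)) (cintegral (fun t => H (RtoC r * expi t) * twist phi m t)).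
  apply: (@cintegral_dct _ _ _ (fun t => B / (1 - q) * `|phi t|)).
  - move=> N; apply: cmeasM.
      by apply: cmeas_sum => n; apply: cmeasM; [exact: cmeas_cst|exact: mX].
    apply: cmeasM; first exact: cmeas_expi_linear.
    by apply: cmeas_RtoC; exact: continuous_measurable_fun.
  - move=> t; rewrite [X in clim _ _ X]mulrC.
    apply: (eq_clim _ (climZ (twist phi m t) (hH _ (cr t)))) => N /=.
    by rewrite mulrC.
  - by apply: rintbleZ; apply: integrable_norm; exact: supp_rintble phi0.
  - by move=> N t; rewrite cabsM cabs_twist ler_wpM2r.
exact: mH.
Qed.

Lemma goodD H h a b phi psi : has_expansion H h ->
  rsmooth phi -> supp_in a b phi -> rsmooth psi -> supp_in a b psi ->
  good H phi -> good H psi -> good H (fun t => phi t + psi t).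
Proof.
move=> hH sphi phi0 spsi psi0 [l1 h1 l10] [l2 h2 l20].
exists (fun m => l1 m + l2 m); last first.
  by rewrite -[X in clim _ _ X](addr0 0); exact: climD.
move=> m e e0; have hn := @climD R _ _ near1_filter _ _ _ _ (h1 m) (h2 m) e e0.
apply: filterS2 (near1_left R) hn => r r01.
suff -> : pairing H (fun t => phi t + psi t) r m = pairing H phi r m + pairing H psi r m by [].
rewrite /pairing -cintegralD; last 2 first.
- exact: (pairing_cintble _ hH r01 (rsmooth_continuous sphi) phi0).
- exact: (pairing_cintble _ hH r01 (rsmooth_continuous spsi) psi0).
by apply: eq_cintegral => t; rewrite /twist RtoCD !mulrDr.
Qed.

Lemma good0 H phi : (forall t, phi t = 0) -> good H phi.
Proof.
move=> phi0; exists (fun=> 0); last exact: clim_cst.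
move=> m; apply: (eq_clim _ (clim_cst 0)) => r.
rewrite /pairing (eq_cintegral (g := fun=> 0)) ?cintegral0// => t.
by rewrite /twist phi0 RtoC0 !mulr0.
Qed.

End CutoffCoefficient.

(** * Partitions of unity and locality of goodness *)

Section Gluing.
Variable R : realType.
Local Notation C := (Cplx R).
Local Notation mu := (@lebesgue_measure R).
Implicit Types (f g phi psi : R -> R) (h c : nat -> C) (H : C -> C).

(** The points where this fails form the set [E'] of the overview. A radius valid at [t] gives half
    of it at nearby points, so the regular points form an open set. *)
Definition reg H (t : R) := exists2 d : R, 0 < d & forall a b phi, rsmooth phi ->
  supp_in a b phi -> t - d <= a -> b <= t + d -> good H phi.

Definition unit_bump (u : R) : R := smooth_step (u + 1) - smooth_step u.

Lemma rsmooth_unit_bump : rsmooth unit_bump.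
Proof.
apply: rsmoothB; last exact: rsmooth_step.
have := @rsmooth_affine R _ 1 1 (@rsmooth_step R).
by under eq_fun do rewrite mul1r.
Qed.

Lemma unit_bump_ge0 u : 0 <= unit_bump u.
Proof.
rewrite /unit_bump; case: (leP u 0) => h.
  by rewrite (@smooth_step0 _ u)// subr0 smooth_step_ge0.
by rewrite (@smooth_step1 _ (u + 1)) ?subr_ge0 ?smooth_step_le1//; lra.
Qed.

Lemma supp_unit_bump : supp_in (-1) 1 unit_bump.
Proof.
move=> u; rewrite in_itv /= negb_and -!ltNge /unit_bump => /orP[h|h].
  by rewrite !smooth_step0 ?subrr//; lra.
by rewrite !smooth_step1 ?subrr//; lra.
Qed.

(* [grid_bump N a j], [j : nat], is a smooth partition of unity on [a, +oo) at scale [1 / N]. *)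
Definition grid_bump (N a : R) (j : nat) (t : R) : R := unit_bump (N * t + (- (N * a) - j%:R)).

Lemma rsmooth_grid_bump N a j : rsmooth (grid_bump N a j).
Proof. exact: (@rsmooth_affine R _ N _ rsmooth_unit_bump). Qed.

Lemma supp_grid_bump N a j t : 0 < N -> grid_bump N a j t != 0 ->
  a + (j%:R - 1) / N <= t <= a + (j%:R + 1) / N.
Proof.
move=> N0 h; have : N * t + (- (N * a) - j%:R) \in `[-1, 1].
  by apply: contraNT h => h; rewrite /grid_bump supp_unit_bump.
rewrite in_itv /= => /andP[h1 h2].
rewrite -lerBrDl ler_pdivrMr// -lerBlDl ler_pdivlMr//; apply/andP; split; lra.
Qed.

Lemma grid_bump_sum N a b phi (Q : nat) t : supp_in a b phi -> 0 < N ->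
  N * (b - a) + 1 <= Q%:R -> phi t = \sum_(0 <= j < Q) phi t * grid_bump N a j t.
Proof.
move=> phi0 N0 NQ; rewrite -mulr_sumr.
case: (boolP (t \in `[a, b])) => [|/phi0 ->]; last by rewrite mul0r.
rewrite in_itv /= => /andP[a_t tb].
(* The sum telescopes. At [j = 0] the step is evaluated at [N (t - a) + 1 >= 1], at [j = Q] at a
   nonpositive point, which is what the lower bound on [Q] ensures. *)
pose s (j : nat) := - smooth_step (N * t - N * a + 1 - j%:R).
rewrite (eq_bigr (fun j => s j.+1 - s j)); last first.
  move=> j _; rewrite /grid_bump /unit_bump /s opprK [RHS]addrC.
  by congr (smooth_step _ - smooth_step _); rewrite -?natr1; ring.
rewrite telescope_sumr// /s opprK subr0 smooth_step0 ?oppr0 ?add0r ?smooth_step1 ?mulr1//.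
  by rewrite lerDr -mulrBr mulr_ge0 ?(ltW N0)//; lra.
have : N * (t - a) <= N * (b - a) by rewrite ler_pM2l//; lra.
lra.
Qed.

Lemma supp_grid_piece N a b phi j : 0 < N -> supp_in a b phi ->
  supp_in (Num.max a (a + (j%:R - 1) / N)) (Num.min b (a + (j%:R + 1) / N))
    (fun t => phi t * grid_bump N a j t).
Proof.
move=> N0 phi0 t ht.
case: (boolP (t \in `[a, b])) => [|/phi0 ->]; last by rewrite mul0r.
case: (eqVneq (grid_bump N a j t) 0) => [->|/(supp_grid_bump N0)]; first by rewrite mulr0.
move=> /andP[h1 h2]; rewrite in_itv /= => /andP[h3 h4].
by move: ht; rewrite in_itv /= ge_max le_min h1 h2 h3 h4.
Qed.

Lemma good_grid H h N a b phi Q : has_expansion H h -> rsmooth phi -> supp_in a b phi ->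
  0 < N -> N * (b - a) + 1 <= Q%:R ->
  (forall j, (j < Q)%N -> good H (fun t => phi t * grid_bump N a j t)) -> good H phi.
Proof.
move=> hH sphi phi0 N0 NQ hg.
have sp j : rsmooth (fun t => phi t * grid_bump N a j t).
  by apply: rsmoothM => //; exact: rsmooth_grid_bump.
have s0 j : supp_in a b (fun t => phi t * grid_bump N a j t).
  by move=> t /phi0 ->; rewrite mul0r.
have -> : phi = fun t => \sum_(0 <= j < Q) phi t * grid_bump N a j t.
  by apply/funext => t; exact: (@grid_bump_sum N a b phi Q t phi0 N0 NQ).
have {NQ} hg' : forall j, (j < Q)%N -> good H (fun t => phi t * grid_bump N a j t) by [].
have aux q : (q <= Q)%N -> rsmooth (fun t => \sum_(0 <= j < q) phi t * grid_bump N a j t) /\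
    supp_in a b (fun t => \sum_(0 <= j < q) phi t * grid_bump N a j t) /\
    good H (fun t => \sum_(0 <= j < q) phi t * grid_bump N a j t).
  elim: q => [_|q IH qQ].
    have e : (fun t => \sum_(0 <= j < 0) phi t * grid_bump N a j t) = fun=> 0.
      by apply/funext => t; rewrite big_geq.
    by rewrite e; split; [exact: rsmooth_cst|split => //; exact: good0].
  have [i1 [i2 i3]] := IH (ltnW qQ).
  have e : (fun t => \sum_(0 <= j < q.+1) phi t * grid_bump N a j t) =
      fun t => \sum_(0 <= j < q) phi t * grid_bump N a j t + phi t * grid_bump N a q t.
    by apply/funext => t; rewrite big_nat_recr.
  rewrite e; split; first exact: rsmoothD.
  split; first by move=> t ht; rewrite i2// s0// addr0.
  exact: (@goodD _ _ _ a b _ _ hH i1 i2 (sp q) (s0 q) i3 (hg' q qQ)).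
by have [_ []] := aux Q (leqnn Q).
Qed.

(** Compactness of [[a, b]] provides a Lebesgue number: a single [N] such that every bump within
    [2 / (N + 1)] of some point of [[a, b]] is good. Grid pieces have supports of that length. *)
Lemma reg_good H h a b phi : has_expansion H h -> rsmooth phi -> supp_in a b phi ->
  (forall t, a <= t <= b -> reg H t) -> good H phi.
Proof.
move=> hH sphi phi0 hreg.
pose P (n : nat) (x : R) := forall a' b' psi, rsmooth psi -> supp_in a' b' psi ->
  x - 2 / n.+1%:R <= a' -> b' <= x + 2 / n.+1%:R -> good H psi.
have [N _ hN] : \forall n \near \oo, forall x, `[a, b]%classic x -> P n x.
  apply: (@compact_near_coveringP _ _).1 => //.
    exact: segment_compact.
  move=> x /=; rewrite in_itv /= => /hreg[d d0 hd].
  (* A point within [d / 2] of [x] together with a radius [2 / (n + 1) < d / 2] stays within [d] of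
     [x]. *)
  have d4 : 0 < d / 4 by lra.
  have := near_infty_natSinv_lt (PosNum d4).
  move=> hn; exists ([set y | `|x - y| < d / 2], [set n | n.+1%:R^-1 < d / 4]).
    split => //=; apply/nbhs_ballP; exists (d / 2) => //=; lra.
  move=> [y n] /= [xy nd] a' b' psi sp p0; move: nd; set v := n.+1%:R^-1.
  move=> nd h1 h2; apply: (hd a' b') => //.
    by move: xy; rewrite ltr_norml => /andP[]; lra.
  by move: xy; rewrite ltr_norml => /andP[]; lra.
have {}hN := hN N (leqnn N).
have N0 : 0 < N.+1%:R :> R by [].
pose Q := (`|Num.ceil (N.+1%:R * (b - a) + 1)|)%N.
have NQ : N.+1%:R * (b - a) + 1 <= Q%:R := le_absz_ceil _.
apply: (good_grid hH sphi phi0 N0 NQ) => j _.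
have sj := @supp_grid_piece N.+1%:R a b phi j N0 phi0.
have sm : rsmooth (fun t => phi t * grid_bump N.+1%:R a j t).
  by apply: rsmoothM => //; exact: rsmooth_grid_bump.
set x := Num.max _ _ in sj; set y := Num.min _ _ in sj.
case: (leP x y) => xy; last first.
  apply: good0 => t; apply: sj; rewrite in_itv /=; apply/negP => /andP[]; lra.
have xa : a <= x by rewrite /x le_max lexx.
have xb : x <= b by apply: le_trans xy _; rewrite /y ge_min lexx.
apply: (hN x _ x y) => //=; first by rewrite in_itv /= xa.
  by rewrite lerBlDr lerDl divr_ge0.
apply: (@le_trans _ _ (a + (j%:R + 1) / N.+1%:R)); first by rewrite /y ge_min lexx orbT.
have : a + (j%:R - 1) / N.+1%:R <= x by rewrite /x le_max lexx orbT.
rewrite (_ : (j%:R + 1) / N.+1%:R = (j%:R - 1) / N.+1%:R + 2 / N.+1%:R); last first.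
  by rewrite -mulrDl; congr (_ / _); ring.
by set u := (_ - 1) / _; set v := 2 / _; lra.
Qed.

End Gluing.

(** * Fourier estimate for a piece multiplied by a factor vanishing at a point *)

Section LocalizedEstimate.
Variable R : realType.
Local Notation C := (Cplx R).
Implicit Types (f g phi psi e p : R -> R).

(** The six terms are those of the second derivative of [e(x) phi(x) p(N x + beta)], where [e] is at
    most [2 / N] on the support. They contribute [9 Y + 4 N Y], at most [13 N Y] since [N >= 1]. *)
Lemma product_rule_bound (N Y T1 T2 T3 T4 T5 T6 : R) : 1 <= N -> 0 <= Y ->
  `|T1| <= 1 * Y -> `|T2| <= 1 * Y -> `|T3| <= 1 * Y ->
  `|T4| <= 2 / N * Y -> `|T5| <= 2 / N * Y -> `|T6| <= 2 / N * Y ->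
  `|T1 + 2 * T2 + 2 * N * T3 + T4 + 2 * N * T5 + N ^+ 2 * T6| <= 13 * N * Y.
Proof.
move=> N1 Y0; have N0 : 0 < N by lra.
have NN : 2 / N <= 2 by rewrite ler_pdivrMr// ler_pMr.
have scal (c T U : R) : 0 <= c -> `|T| <= U -> `|c * T| <= c * U.
  by move=> c0 h; rewrite normrM ger0_norm// ler_wpM2l.
have N20 : 0 <= 2 * N by lra.
move=> t1 t2 /(scal _ _ _ N20) t3 t4 /(scal _ _ _ N20) t5 /(scal _ _ _ (sqr_ge0 N)) t6.
rewrite (_ : 2 * N * (2 / N * Y) = 4 * Y) in t5; last by field; exact: lt0r_neq0.
rewrite (_ : N ^+ 2 * (2 / N * Y) = 2 * (N * Y)) in t6; last by field; exact: lt0r_neq0.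
rewrite (_ : 2 * N * (1 * Y) = 2 * (N * Y)) in t3; last by ring.
have {}t4 := le_trans t4 (ler_wpM2r Y0 NN).
have NY : Y <= N * Y by rewrite ler_peMl.
rewrite -(mulrA 13); move: (N * Y) NY t3 t6 => Z NY t3 t6.
move: (2 * N * T3) (2 * N * T5) (N ^+ 2 * T6) t3 t5 t6 => U V W.
move: t1 t2 t4; rewrite !ler_norml !mul1r.
do 3 case/andP=> ? ?; do 3 case/andP=> ? ?; apply/andP; split; lra.
Qed.

(** Since [e] vanishes at [t], it is at most [2 / N] on a support of length [2 / N] containing [t].
    This gains a factor [N] both on the function, of size [O(1 / N)], and on its second derivative,
    [O(N)] instead of [O(N^2)]. The constant is [60 = 8 + 52], with [8 = 2 (2) (2)] from the size
    and [52 = 2 (2) (13)] from the second derivative. *)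
Lemma localized_rft e phi p (A P N beta t al be : R) :
  rsmooth e -> rsmooth phi -> rsmooth p -> 1 <= N -> 0 <= A -> 0 <= P ->
  (forall x, `|e x| <= `|x - t|) -> (forall x, `|e^`()%classic x| <= 1) ->
  (forall x, `|e^`()%classic^`()%classic x| <= 1) ->
  (forall x, [/\ `|phi x| <= A, `|phi^`()%classic x| <= A &
                 `|phi^`()%classic^`()%classic x| <= A]) ->
  (forall x, [/\ `|p x| <= P, `|p^`()%classic x| <= P &
                 `|p^`()%classic^`()%classic x| <= P]) ->
  al <= t <= be -> be - al <= 2 / N ->
  supp_in al be (fun x => e x * (phi x * p (N * x + beta))) ->
  forall k, (N ^+ 2 + k ^+ 2) *
    cabs (rft (fun x => e x * (phi x * p (N * x + beta))) k) <= 60 * (A * P).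
Proof.
move=> se sphi sp N1 A0 P0 e0 e1 e2 phiA pP /andP[alt tbe] len supp k.
have N0 : 0 < N by lra.
have ab : al <= be by lra.
have len0 : 0 <= be - al by lra.
have [se1 de] := rsmoothP se; have [se2 de1] := rsmoothP se1.
have [sphi1 dphi] := rsmoothP sphi; have [sphi2 dphi1] := rsmoothP sphi1.
have [sp1 dp] := rsmoothP sp; have [sp2 dp1] := rsmoothP sp1.
pose q0 x := p (N * x + beta).
pose q1 x := p^`()%classic (N * x + beta).
pose q2 x := p^`()%classic^`()%classic (N * x + beta).
have dq (x : R) : is_derive x 1 q0 (N * q1 x) by exact: is_derive_affine.
have dq1 (x : R) : is_derive x 1 q1 (N * q2 x) by exact: is_derive_affine.
pose g x := e x * (phi x * q0 x).
pose e' := e^`()%classic; pose e'' := e'^`()%classic.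
pose f' := phi^`()%classic; pose f'' := f'^`()%classic.
pose g1 x := e' x * (phi x * q0 x) + e x * (f' x * q0 x + phi x * (N * q1 x)).
have dg (x : R) : is_derive x 1 g (g1 x).
  apply: (is_derive_eq (is_derive_mulR (de x) (is_derive_mulR (dphi x) (dq x)))).
  rewrite /g1 -/e' -/f'; move: (e x) (e' x) (phi x) (f' x) (q0 x) (q1 x) => *; ring.
pose g2 x := e'' x * (phi x * q0 x) + 2 * (e' x * (f' x * q0 x + phi x * (N * q1 x))) +
  e x * (f'' x * q0 x + 2 * (f' x * (N * q1 x)) + phi x * (N * (N * q2 x))).
have dg1 (x : R) : is_derive x 1 g1 (g2 x).
  have h1 := is_derive_mulR (de1 x) (is_derive_mulR (dphi x) (dq x)).
  have h2 := is_derive_mulR (dphi1 x) (dq x).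
  have h3 := is_derive_mulR (dphi x) (is_derive_scaleR N (dq1 x)).
  apply: (is_derive_eq (is_derive_addR h1 (is_derive_mulR (de x) (is_derive_addR h2 h3)))).
  rewrite /g2 -/e' -/f' -/e'' -/f''.
  move: (e x) (e' x) (e'' x) (phi x) (f' x) (f'' x) (q0 x) (q1 x) (q2 x) => *; ring.
have gE1 : g^`()%classic = g1 by apply/funext => x; exact: is_derive1E.
have gE2 : g^`()%classic^`()%classic = g2.
  by rewrite gE1; apply/funext => x; exact: is_derive1E.
have sq : rsmooth q0 by exact: (@rsmooth_affine R p N beta sp).
have sg : rsmooth g by apply: rsmoothM => //; exact: rsmoothM.
have AP0 : 0 <= A * P by rewrite mulr_ge0.
have dist x : x \in `[al, be] -> `|e x| <= 2 / N.
  rewrite in_itv /= => /andP[h1 h2]; apply: le_trans (e0 x) _.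
  by apply: le_trans len; rewrite ler_norml; apply/andP; split; lra.
have NN : 2 / N <= 2 by rewrite ler_pdivrMr// ler_pMr.
have gb x : `|g x| <= 2 / N * (A * P).
  case: (boolP (x \in `[al, be])) => [/dist h|/supp h]; last first.
    by rewrite /g [X in `|X|]h normr0 mulr_ge0// divr_ge0// ltW.
  have [a1 _ _] := phiA x; have [b1 _ _] := pP (N * x + beta).
  by rewrite /g !normrM; apply: ler_pM => //; apply: ler_pM.
have mul3 (u v w U V W : R) : `|u| <= U -> `|v| <= V -> `|w| <= W ->
    `|u * (v * w)| <= U * (V * W).
  move=> h1 h2 h3; rewrite !normrM.
  by apply: ler_pM => //; exact: ler_pM.
have g2b x : `|g2 x| <= 13 * N * (A * P).
  case: (boolP (x \in `[al, be])) => [/dist h|h]; last first.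
    rewrite -gE2 (supp_in_derive _ (supp_in_derive sg supp))//.
      by rewrite normr0 !mulr_ge0// ltW.
    by have [] := rsmoothP sg.
  have [a1 a2 a3] := phiA x; have [b1 b2 b3] := pP (N * x + beta).
  have t1 := mul3 _ _ _ _ _ _ (e2 x) a1 b1.
  have t2 := mul3 _ _ _ _ _ _ (e1 x) a2 b1.
  have t3 := mul3 _ _ _ _ _ _ (e1 x) a1 b2.
  have t4 := mul3 _ _ _ _ _ _ h a3 b1.
  have t5 := mul3 _ _ _ _ _ _ h a2 b2.
  have t6 := mul3 _ _ _ _ _ _ h a1 b3.
  rewrite (_ : g2 x = e'' x * (phi x * q0 x) + 2 * (e' x * (f' x * q0 x)) +
    2 * N * (e' x * (phi x * q1 x)) + e x * (f'' x * q0 x) +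
    2 * N * (e x * (f' x * q1 x)) + N ^+ 2 * (e x * (phi x * q2 x))); last first.
    by rewrite /g2; ring.
  exact: product_rule_bound.
have cg := rsmooth_continuous sg.
have r0 : N ^+ 2 * cabs (rft g k) <= 8 * (A * P).
  apply: (@le_trans _ _ (N ^+ 2 * (2 * ((2 / N) * (2 / N * (A * P)))))).
    rewrite ler_wpM2l ?sqr_ge0//; apply: le_trans (rft_bound k ab cg supp gb) _.
    by rewrite ler_wpM2l// ler_wpM2r// mulr_ge0// divr_ge0// ltW.
  rewrite le_eqVlt; apply/orP; left; apply/eqP; field; exact: lt0r_neq0.
have r2 : k ^+ 2 * cabs (rft g k) <= 52 * (A * P).
  apply: (@le_trans _ _ (2 * ((2 / N) * (13 * N * (A * P))))).
    apply: (@le_trans _ _ (2 * ((be - al) * (13 * N * (A * P))))).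
      by apply: rft_decay2 => // y; rewrite gE2; exact: g2b.
    by rewrite ler_wpM2l// ler_wpM2r// !mulr_ge0// ltW.
  rewrite le_eqVlt; apply/orP; left; apply/eqP; field; exact: lt0r_neq0.
rewrite (_ : 60 * (A * P) = 8 * (A * P) + 52 * (A * P)); last by rewrite -mulrDl -natrD.
by rewrite mulrDl; exact: lerD.
Qed.

End LocalizedEstimate.

(** * The exceptional set *)

Section NullSets.
Variable R : realType.
Local Notation mu := (@lebesgue_measure R).
Implicit Types (S : set R).

(** The neighbourhoods [A k] of the part of [S] in [[a, b]] decrease to a subset of [S], so their
    measure tends to 0 by continuity from above. At a fine enough scale every marked piece
    contributes a grid cell inside [A k], and these cells are disjoint. *)
Lemma null_grid_count S (a b e : R) : closed S -> mu S = 0%E -> 0 < e ->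
  exists N0 : nat, forall N Q : nat, (N0 <= N)%N -> forall J : {pred 'I_Q},
    (forall j : 'I_Q, J j -> exists x, [/\ S x, a <= x <= b &
      a + (j%:R - 1) / N.+1%:R <= x <= a + (j%:R + 1) / N.+1%:R]) ->
    #|J|%:R / N.+1%:R <= e.
Proof.
move=> cS S0 e0.
pose A (k : nat) : set R := \bigcup_(s in S `&` `[a, b]%classic) ball s k.+1%:R^-1.
have oA k : open (A k) by apply: bigcup_open => s _; exact: ball_open.
have mA k : measurable (A k) by exact: open_measurable.
have lemu (X Y : set R) : measurable X -> measurable Y -> X `<=` Y -> (mu X <= mu Y)%E.
  by move=> mX mY XY; apply: le_measure; rewrite ?inE.
have dA : nonincreasing_seq A.
  move=> m n mn; apply/subsetPset => x [s Ss sx]; exists s => //.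
  apply: le_ball sx; rewrite lef_pV2 ?posrE// ler_nat.
  by rewrite ltnS.
have A0 : (mu (A 0%N) < +oo)%E.
  apply: (@le_lt_trans _ _ (mu `[a - 1, b + 1]%classic)).
    apply: lemu; [exact: mA|exact: measurable_itv|].
    move=> x [s [_ /=]]; rewrite !in_itv /= => /andP[h1 h2].
    by rewrite /ball /= invr1 ltr_norml => /andP[]; lra.
  have h : (@lebesgue_measure R `[(a - 1)%R, (b + 1)%R]%classic < +oo)%E.
    by rewrite lebesgue_measure_itv; case: ifP => // _; rewrite -EFinB ltry.
  exact: h.
have capS : \bigcap_n A n `<=` S.
  move=> x Ax; apply: contrapT => Sx.
  have : nbhs x (~` S) by apply: open_nbhs_nbhs; split => //; exact: closed_openC.
  move=> /nbhs_ballP[d /= d0 dS].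
  have [k _ hk] := near_infty_natSinv_lt (PosNum d0).
  have [s [Ss _] sx] := Ax k I.
  apply: (dS s) => //; apply: ball_sym; apply: le_ball sx.
  by apply/ltW/hk => /=.
have mS : measurable S by exact: closed_measurable.
have cap0 : mu (\bigcap_n A n) = 0%E.
  apply/eqP; rewrite eq_le measure_ge0 andbT -S0; apply: lemu => //.
  exact: bigcapT_measurable.
have hcv : mu (A k) @[k --> \oo] --> mu (\bigcap_n A n).
  exact: (@nonincreasing_cvg_mu _ _ _ mu A A0 mA (bigcapT_measurable mA) dA).
rewrite cap0 in hcv; move: hcv => /fine_cvgP[_ /cvgrPdist_lt/(_ _ e0)[k _ hk]].
have Ak : (mu (A k) < e%:E)%E.
  have fA : mu (A k) \is a fin_num.
    rewrite ge0_fin_numE//; apply: le_lt_trans A0.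
    by apply: lemu; [exact: mA|exact: mA|apply/subsetPset; exact: dA].
  have := hk k (leqnn k); rewrite /= sub0r normrN => h.
  by rewrite -(fineK fA) lte_fin; apply: le_lt_trans h; exact: ler_norm.
(* The marked point and any point of the associated cell lie within three grid steps of each other,
   and three steps are then shorter than [1 / (k + 1)]. *)
exists (3 * k.+1)%N => N Q NN J hJ.
have N0 : 0 < N.+1%:R :> R by [].
pose u (j : nat) : R := a + (j%:R - 1) / N.+1%:R.
have uS j : u j.+1 = u j + N.+1%:R^-1.
  by rewrite /u -natr1; field; exact: lt0r_neq0.
have u_mono i j : (i <= j)%N -> u i <= u j.
  by move=> ij; rewrite /u lerD2l ler_pM2r ?invr_gt0// lerD2r ler_nat.
(* The support of piece [j] spans two grid cells; only the left one is kept, half-open, so that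
   distinct indices give disjoint sets. *)
pose I (j : 'I_Q) : set R := `]u j, u j.+1]%classic.
have IA j : J j -> I j `<=` A k.
  move=> /hJ[x [Sx xab]]; rewrite -/(u j) => /andP[h1 h2] y.
  rewrite /I /= in_itv /= uS => /andP[h3 h4]; exists x => //.
  have h5 : x <= u j + 2 * N.+1%:R^-1.
    apply: le_trans h2 _; rewrite /u -addrA lerD2l le_eqVlt; apply/orP; left.
    by apply/eqP; field; exact: lt0r_neq0.
  have : 3 * N.+1%:R^-1 < k.+1%:R^-1 :> R.
    rewrite ltr_pdivrMr// mulrC ltr_pdivlMr// -natrM ltr_nat.
    by rewrite ltnS.
  rewrite /ball /= ltr_norml; move: h4 h5; set v := N.+1%:R^-1 => h4 h5 hv.
  have v0 : 0 < v by rewrite invr_gt0.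
  move: (u j) (k.+1%:R^-1) v h1 h3 h4 h5 hv v0 => w d v h1 h3 h4 h5 hv v0.
  by apply/andP; split; lra.
have tI : trivIset J I.
  apply/trivIsetP => i j _ _ ij; apply/seteqP; split => // x [] /=.
  rewrite /I /= !in_itv /= => /andP[h1 h2] /andP[h3 h4].
  have : (i != j :> nat)%N by [].
  rewrite neq_ltn => /orP[h|h]; have := u_mono _ _ h; lra.
have mI j : measurable (I j) by exact: measurable_itv.
have hmu := @measure_bigsetU_ord_cond _ _ _ mu Q J I (fun j _ => mI j) tI.
have muI j : mu (I j) = (N.+1%:R^-1)%:E.
  have h : @lebesgue_measure R `]u j, u j.+1]%classic = (N.+1%:R^-1)%:E.
    rewrite lebesgue_measure_itv /= lte_fin uS ltrDl invr_gt0 ltr0n /=.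
    by rewrite -EFinB addrAC subrr add0r.
  exact: h.
rewrite (eq_bigr (fun=> (N.+1%:R^-1)%:E)) in hmu; last by move=> j _; exact: muI.
rewrite sumEFin sumr_const in hmu.
rewrite mulr_natl -lee_fin -hmu; apply: (@le_trans _ _ (mu (A k))); last exact: ltW.
apply: lemu; [by apply: bigsetU_measurable|exact: mA|].
by elim/big_ind : _ => [x []|X Y hX hY x [/hX|/hY]|j Jj] //; exact: IA.
Qed.

(** Baire's argument carried out with nested intervals centred in [S]. If no portion worked, one
    could choose them so that on the interval of index [k + 1] some [u n] exceeds [k] throughout;
    their common point lies in the closed set [S] and contradicts the pointwise bound. *)
Lemma baire_bounded S (u : nat -> R -> R) : closed S -> S !=set0 ->
  (forall n, continuous (u n)) -> (forall t, S t -> exists M, forall n, u n t <= M) ->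
  exists t0 d M : R, [/\ S t0, 0 < d &
    forall t, S t -> `|t - t0| <= d -> forall n, u n t <= M].
Proof.
move=> cS [s0 Ss0] cu bu; apply: contrapT => hno.
have step (k : nat) (p : R * R) : exists q : R * R, S p.1 -> 0 < p.2 ->
    [/\ S q.1, 0 < q.2, q.2 <= k.+1%:R^-1,
      `|q.1 - p.1| + q.2 <= p.2 &
      forall x, `|x - q.1| <= q.2 -> exists n, k%:R < u n x].
  (* The choice function must be defined on all pairs; on those violating the invariant any value
     will do. *)
  case: (pselect (S p.1 /\ 0 < p.2)) => [[Sp p0]|h]; last first.
    by exists p => h1 h2; exfalso; apply: h.
  have [t [St tp [n ut]]] : exists t, [/\ S t, `|t - p.1| <= p.2 / 2 & exists n, k%:R < u n t].
    apply: contrapT => h; apply: hno; exists p.1, (p.2 / 2), k%:R; split => //; first by lra.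
    move=> t St tp n; rewrite leNgt; apply/negP => un.
    by apply: h; exists t; split => //; exists n.
  have /nbhs_ballP[d /= d0 hd] : nbhs t [set x | k%:R < u n x].
    have := cu n t; move=> /(_ [set y | k%:R < y]); apply.
    exact: (lt_nbhsr ut).
  (* The three radii keep the new interval where [u n] exceeds [k], keep it inside the previous one,
     and make the lengths tend to 0. *)
  exists (t, Num.min (d / 2) (Num.min (p.2 / 2) k.+1%:R^-1)) => _ _ /=; split => //.
  - by rewrite !lt_min invr_gt0 ltr0n; apply/and3P; split => //; lra.
  - by rewrite !ge_min lexx !orbT.
  - have : Num.min (d / 2) (Num.min (p.2 / 2) k.+1%:R^-1) <= p.2 / 2 by rewrite !ge_min lexx !orbT.
    by lra.
  - move=> x hx; exists n; apply: hd; rewrite /ball /= distrC.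
    apply: le_lt_trans hx _; apply: (@le_lt_trans _ _ (d / 2)); last by lra.
    by rewrite ge_min lexx.
have [f hf] := @choice _ _ (fun (kp : nat * (R * R)) q => S kp.2.1 -> 0 < kp.2.2 ->
    [/\ S q.1, 0 < q.2, q.2 <= kp.1.+1%:R^-1, `|q.1 - kp.2.1| + q.2 <= kp.2.2 &
      forall x, `|x - q.1| <= q.2 -> exists n, kp.1%:R < u n x])
  (fun kp => step kp.1 kp.2).
pose p := fix p n : R * R := if n is k.+1 then f (k, p k) else (s0, 1).
have inv n : S (p n).1 /\ 0 < (p n).2.
  elim: n => [|n [h1 h2]]; first by split => //=.
  by have [] := hf (n, p n) h1 h2.
have hp n := hf (n, p n) (inv n).1 (inv n).2.
have nest n m : (n <= m)%N -> `|(p m).1 - (p n).1| + (p m).2 <= (p n).2.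
  elim: m => [|m IH]; first by rewrite leqn0 => /eqP ->; rewrite subrr normr0 add0r.
  rewrite leq_eqVlt => /orP[/eqP ->|]; first by rewrite subrr normr0 add0r.
  rewrite ltnS => /IH h; have [_ _ _ h' _] := hp m; rewrite /= in h'.
  have := ler_distD (p m).1 (p m.+1).1 (p n).1; rewrite /=; lra.
(* The common point is the supremum of the left endpoints, bounded above by every right endpoint. *)
pose L := [set (p n).1 - (p n).2 | n in [set: nat]].
have Lub m : ubound L ((p m).1 + (p m).2).
  move=> _ [n _ <-]; case: (leqP n m) => nm.
    by have := nest _ _ nm; have := ler_norm ((p n).1 - (p m).1); rewrite distrC;
      have := (inv m).2; lra.
  by have := nest _ _ (ltnW nm); have := ler_norm ((p n).1 - (p m).1);
      have := (inv n).2; lra.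
have hL : has_sup L by split; [exists ((p 0%N).1 - (p 0%N).2); exists 0%N|exists ((p 0%N).1 + (p 0%N).2)].
pose tau := sup L.
have tauP n : `|tau - (p n).1| <= (p n).2.
  have h1 : tau <= (p n).1 + (p n).2 by apply: sup_le_ub => //; exact: hL.1.
  have h2 : (p n).1 - (p n).2 <= tau by apply: ub_le_sup; [exact: hL.2|exists n].
  by rewrite ler_norml; apply/andP; split; lra.
have Stau : S tau.
  apply: contrapT => St.
  have : nbhs tau (~` S) by apply: open_nbhs_nbhs; split => //; exact: closed_openC.
  move=> /nbhs_ballP[d /= d0 dS].
  have [k _ hk] := near_infty_natSinv_lt (PosNum d0).
  apply: (dS (p k.+1).1 _ (inv k.+1).1).
  rewrite /ball /=; apply: le_lt_trans (tauP k.+1) _.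
  have [_ _ h _ _] := hp k; apply: le_lt_trans h _.
  exact: (hk k (leqnn k)).
have [M hM] := bu _ Stau.
pose k := `|Num.ceil M|%N.
have [_ _ _ _ h] := hp k.
have [n] := h _ (tauP k.+1); rewrite ltNge => /negP; apply.
exact: le_trans (hM n) (le_absz_ceil M).
Qed.

End NullSets.

(** * Summation by parts at a point with bounded partial sums *)

Section SummationByParts.
Variable R : realType.
Local Notation C := (Cplx R).

Lemma sum_by_parts (c v : nat -> C) k :
  \sum_(0 <= n < k) c n * v n = (\sum_(0 <= i < k) c i) * v k +
    \sum_(0 <= n < k) (\sum_(0 <= i < n.+1) c i) * (v n - v n.+1).
Proof.
elim: k => [|k IH]; first by rewrite !big_geq// mul0r addr0.
rewrite big_nat_recr//= IH [X in _ = _ + X]big_nat_recr//= [\sum_(0 <= i < k.+1) _]big_nat_recr//=.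
by ring.
Qed.

(** Writing [c n * w (m - n)] as [c n e^{int}] times [v n] brings in the bounded partial sums. The
    boundary term costs [M W]; the differences of [v] have the modulus bounded in the last
    hypothesis and are summed by [lattice_sum]. The result does not depend on [m]. *)
Lemma bounded_partial_sums_pairing (c : nat -> C) (t M K W N : R) (w : R -> C) m (L : C) :
  (forall k, cabs (\sum_(0 <= n < k.+1) c n * expi t ^+ n) <= M) ->
  csum_cvg (fun n => c n * w (m%:R - n%:R)) L ->
  (forall x, cabs (w x) <= W) -> 1 <= N -> 0 <= K ->
  (forall k, (N ^+ 2 + k ^+ 2) * cabs (w k - expi (- t) * w (k - 1)) <= K) ->
  cabs L <= M * (W + K * (3 * pi / N)).
Proof.
move=> hM cL hW N1 K0 hK.
have M0 : 0 <= M by apply: le_trans (hM 0%N); exact: cabs_ge0.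
have et (n : nat) : expi t ^+ n != 0 :> C by rewrite expf_neq0// expi_neq0.
pose v n := (expi t ^+ n)^-1 * w (m%:R - n%:R).
have cv n : c n * w (m%:R - n%:R) = (c n * expi t ^+ n) * v n.
  by rewrite /v mulrA mulfK.
have nv (n : nat) : cabs ((expi t ^+ n)^-1 : C) = 1.
  by rewrite cabsV cabsX cabs_expi expr1n invr1.
have dv n : cabs (v n - v n.+1) <= K * (N ^+ 2 + (m%:R - n%:R) ^+ 2)^-1.
  have -> : v n - v n.+1 = (expi t ^+ n)^-1 *
      (w (m%:R - n%:R) - expi (- t) * w (m%:R - n%:R - 1)).
    rewrite /v mulrBr mulrA; congr (_ - _ * w _).
      by rewrite expiN exprSr invfM mulrC.
    by rewrite -natr1; ring.
  rewrite cabsM nv mul1r ler_pdivlMr ?(mulrC (cabs _))//.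
  by rewrite ltr_wpDr ?sqr_ge0// exprn_gt0//; lra.
have sM k : cabs (\sum_(0 <= n < k) c n * expi t ^+ n) <= M.
  by case: k => [|k]; [rewrite big_geq// cabs0|exact: hM].
apply: (clim_le cL); apply: nearW => k.
rewrite (eq_bigr _ (fun n _ => cv n)) sum_by_parts.
apply: le_trans (cabsD _ _) _; rewrite mulrDr; apply: lerD.
  rewrite cabsM; apply: ler_pM; rewrite ?cabs_ge0//.
  by rewrite /v cabsM nv mul1r.
apply: le_trans (cabs_sum _ _ _) _.
apply: (@le_trans _ _ (\sum_(0 <= n < k) M * (K * (N ^+ 2 + (m%:R - n%:R) ^+ 2)^-1))).
  by apply: ler_sum => n _; rewrite cabsM; apply: ler_pM; rewrite ?cabs_ge0.
rewrite -!mulr_sumr ler_wpM2l// ler_wpM2l//; exact: lattice_sum.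
Qed.

(** The left side is the transform of [(1 - e^{i(x - t)}) g]. It is split into two real factors,
    [1 - cos (x - t)] and [sin (x - t)], both vanishing at [t], so that estimates for real functions
    apply. *)
Lemma rft_twisted_difference a b (g : R -> R) (t k : R) : continuous g -> supp_in a b g ->
  rft g k - expi (- t) * rft g (k - 1) =
  rft (fun x => (1 - cos (x - t)) * g x) k - (0 +i* 1)%C * rft (fun x => sin (x - t) * g x) k.
Proof.
move=> cg g0.
have cs : continuous (fun x => x - t) by move=> x; apply: cvgB; [exact: cvg_id|exact: cvg_cst].
have c1 : continuous (fun x => (1 - cos (x - t)) * g x).
  move=> x; apply: cvgM; last exact: cg.
  apply: cvgB; first exact: cvg_cst.
  by apply: (continuous_comp (cs x)); exact: continuous_cos.
have c2 : continuous (fun x => sin (x - t) * g x).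
  move=> x; apply: cvgM; last exact: cg.
  by apply: (continuous_comp (cs x)); exact: continuous_sin.
have s1 : supp_in a b (fun x => (1 - cos (x - t)) * g x) by move=> x /g0 ->; rewrite mulr0.
have s2 : supp_in a b (fun x => sin (x - t) * g x) by move=> x /g0 ->; rewrite mulr0.
have i0 := rft_cintble k cg g0; have i1 := rft_cintble (k - 1) cg g0.
have j1 := rft_cintble k c1 s1; have j2 := rft_cintble k c2 s2.
rewrite /rft /fourier -[X in _ - X = _]cintegralZ// -[X in _ = _ - X]cintegralZ//.
rewrite -[LHS]cintegralB//; last exact: cintbleZ.
rewrite -[RHS]cintegralB//; last exact: cintbleZ.
apply: eq_cintegral => x.
have -> : expi (- ((k - 1) * x)) = expi (- (k * x)) * expi x :> C.
  by rewrite -expiD; congr expi; ring.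
rewrite !RtoCM.
have -> : RtoC (1 - cos (x - t)) = 1 - expi (x - t) + (0 +i* 1)%C * RtoC (sin (x - t)) :> C.
  by apply: C_ext; rewrite ?Re_add ?Im_add ?Re_opp ?Im_opp ?Re_mul ?Im_mul /=; ring.
rewrite expiD; move: (expi x) (expi (- t)) (expi (- (k * x))) (RtoC (g x)) (RtoC (sin _)) => *.
ring.
Qed.

End SummationByParts.

Section CoefficientDecay.
Variable R : realType.
Local Notation C := (Cplx R).
Local Notation mu := (@lebesgue_measure R).
Implicit Types (f g phi psi e p : R -> R) (c : nat -> C) (F : C -> C).

Lemma cabs_dist (x y : C) : `|cabs x - cabs y| <= cabs (y - x).
Proof.
rewrite ler_norml; apply/andP; split.
  by have := cabsD (y - x) x; rewrite subrK; lra.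
by have := cabsD (x - y) y; rewrite subrK cabsBC; lra.
Qed.

Lemma smooth_bounds a b phi : rsmooth phi -> supp_in a b phi ->
  exists2 A : R, 0 <= A & forall x, [/\ `|phi x| <= A, `|phi^`()%classic x| <= A &
                 `|phi^`()%classic^`()%classic x| <= A].
Proof.
move=> s0 p0; have [s1 _] := rsmoothP s0; have [s2 _] := rsmoothP s1.
have p1 := supp_in_derive s0 p0; have p2 := supp_in_derive s1 p1.
have [A A0 hA] := supp_in_bounded (rsmooth_continuous s0) p0.
have [B B0 hB] := supp_in_bounded (rsmooth_continuous s1) p1.
have [D D0 hD] := supp_in_bounded (rsmooth_continuous s2) p2.
exists (A + B + D) => [|x]; first by lra.
split; [apply: le_trans (hA x) _|apply: le_trans (hB x) _|apply: le_trans (hD x) _]; lra.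
Qed.

(** The piece is at most [A P] on a support of length [2 / (N + 1)], which gives [4 A P / (N + 1)]
    for its transform. Its twisted differences have constant [120 A P], that is 60 for each of the
    two real factors, and [lattice_sum] multiplies this by [3 pi / (N + 1)]. *)
Lemma piece_coef_bound c phi a b (A P B M t : R) (N j m : nat) (L : C) :
  (forall n, cabs (c n) <= B) ->
  (forall k, cabs (\sum_(0 <= n < k.+1) c n * expi t ^+ n) <= M) ->
  rsmooth phi -> supp_in a b phi -> 0 <= A -> 0 <= P ->
  (forall x, [/\ `|phi x| <= A, `|phi^`()%classic x| <= A &
                 `|phi^`()%classic^`()%classic x| <= A]) ->
  (forall x : R, [/\ `|unit_bump x| <= P, `|(@unit_bump R)^`()%classic x| <= P &
                 `|(@unit_bump R)^`()%classic^`()%classic x| <= P]) ->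
  a <= t <= b -> a + (j%:R - 1) / N.+1%:R <= t <= a + (j%:R + 1) / N.+1%:R ->
  csum_cvg (fun n => c n * rft (fun x => phi x * grid_bump N.+1%:R a j x) (m%:R - n%:R)) L ->
  cabs L <= M * (A * P) * (4 + 360 * pi) / N.+1%:R.
Proof.
move=> cB hM sphi phi0 A0 P0 hA hP /andP[ta tb] /andP[tj1 tj2] cL.
have M0 : 0 <= M by apply: le_trans (hM 0%N); exact: cabs_ge0.
pose N1 : R := N.+1%:R; have N0 : 0 < N1 by rewrite ltr0n.
have N11 : 1 <= N1 by rewrite ler1n.
pose g x := phi x * grid_bump N1 a j x.
have sg : rsmooth g by apply: rsmoothM => //; exact: rsmooth_grid_bump.
have g0 : supp_in _ _ g := @supp_grid_piece R N1 a b phi j N0 phi0.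
move: g0; set al := Num.max _ _; set be := Num.min _ _ => g0.
have at1 : al <= t <= be by rewrite ge_max le_min ta tb tj1 tj2.
have len : be - al <= 2 / N1.
  have h1 : a + (j%:R - 1) / N1 <= al by rewrite le_max lexx orbT.
  have h2 : be <= a + (j%:R + 1) / N1 by rewrite ge_min lexx orbT.
  have h3 : a + (j%:R + 1) / N1 = a + (j%:R - 1) / N1 + 2 / N1.
    by field; exact: lt0r_neq0.
  move: h1 h2; rewrite h3; move: (a + _ / N1) (2 / N1) => u v; lra.
have AP0 : 0 <= A * P by rewrite mulr_ge0.
have gb x : `|g x| <= A * P.
  have [h1 _ _] := hA x; have [h2 _ _] := hP (N1 * x + (- (N1 * a) - j%:R)).
  by rewrite normrM; exact: ler_pM.
have alb : al <= be by case/andP: at1; exact: le_trans.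
have rb x : cabs (rft g x) <= 4 * (A * P) / N1.
  apply: le_trans (rft_bound x alb (rsmooth_continuous sg) g0 gb) _.
  rewrite (_ : 4 * (A * P) / N1 = 2 * (2 / N1 * (A * P))); last by ring.
  by rewrite ler_wpM2l// ler_wpM2r.
(* Both factors and their derivatives meet the bounds required of [e] in [localized_rft]. The form
   [1 * x + - t] is that of the affine substitution lemmas. *)
pose e1 x := 1 - cos (1 * x + - t); pose e2 x := sin (1 * x + - t).
have ds x : is_derive (x : R) 1 e2 (cos (1 * x + - t)).
  have := @is_derive_affine _ _ 1 (- t) _ x (is_derive_sin (1 * x + - t)).
  by rewrite mul1r.
have dc x : is_derive (x : R) 1 (fun x => cos (1 * x + - t)) (- e2 x).
  have := @is_derive_affine _ _ 1 (- t) _ x (is_derive_cos (1 * x + - t)).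
  by rewrite mul1r.
have d1 x : is_derive (x : R) 1 e1 (e2 x).
  have h := is_derive_addR (is_derive_cst (1 : R) x 1) (is_derive_scaleR (-1) (dc x)).
  rewrite (_ : e1 = fun y => 1 + -1 * cos (1 * y + - t)); last first.
    by apply/funext => y; rewrite mulN1r.
  by apply: (is_derive_eq h); rewrite add0r mulN1r opprK.
have D1 : e1^`()%classic = e2 by apply/funext => x; exact: is_derive1E.
have D2 : e2^`()%classic = fun x => cos (1 * x + - t) by apply/funext => x; exact: is_derive1E.
have D3 : (fun x => cos (1 * x + - t))^`()%classic = fun x => - e2 x.
  by apply/funext => x; exact: is_derive1E.
have se2 : rsmooth e2 by apply: rsmooth_affine; exact: rsmooth_sin.
have se1 : rsmooth e1.
  by apply: rsmoothB; [exact: rsmooth_cst|apply: rsmooth_affine; exact: rsmooth_cos].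
have cb x : `|cos x| <= 1 :> R by rewrite ler_norml cos_geN1 cos_le1.
have sb x : `|sin x| <= 1 :> R by rewrite ler_norml sin_geN1 sin_le1.
have e1b x : `|e1 x| <= `|x - t|.
  have := cos_lipschitz (1 * x + - t) 0; rewrite cos0 subr0 mul1r.
  by rewrite /e1 distrC mul1r.
have e2b x : `|e2 x| <= `|x - t|.
  by have := sin_lipschitz (1 * x + - t) 0; rewrite sin0 !subr0 mul1r /e2 mul1r.
have sup1 : supp_in al be (fun x => e1 x * (phi x * unit_bump (N1 * x + (- (N1 * a) - j%:R)))).
  by move=> x /g0; rewrite /g /grid_bump => ->; rewrite mulr0.
have sup2 : supp_in al be (fun x => e2 x * (phi x * unit_bump (N1 * x + (- (N1 * a) - j%:R)))).
  by move=> x /g0; rewrite /g /grid_bump => ->; rewrite mulr0.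
have sub := @rsmooth_unit_bump R.
have E1 : forall x, `|e1^`()%classic x| <= 1 by move=> x; rewrite D1; exact: sb.
have E2 : forall x, `|e1^`()%classic^`()%classic x| <= 1 by move=> x; rewrite D1 D2; exact: cb.
have E3 : forall x, `|e2^`()%classic x| <= 1 by move=> x; rewrite D2; exact: cb.
have E4 : forall x, `|e2^`()%classic^`()%classic x| <= 1.
  by move=> x; rewrite D2 D3 normrN; exact: sb.
have b1 := localized_rft se1 sphi sub N11 A0 P0 e1b E1 E2 hA hP at1 len sup1.
have b2 := localized_rft se2 sphi sub N11 A0 P0 e2b E3 E4 hA hP at1 len sup2.
have K0 : 0 <= 120 * (A * P) by rewrite mulr_ge0.
have := bounded_partial_sums_pairing hM cL rb N11 K0.
rewrite (_ : M * (A * P) * (4 + 360 * pi) / N1 =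
  M * (4 * (A * P) / N1 + 120 * (A * P) * (3 * pi / N1))); last by ring.
apply => k; rewrite (rft_twisted_difference t k (rsmooth_continuous sg) g0).
have := cabsB (rft (fun x => (1 - cos (x - t)) * g x) k)
  ((0 +i* 1)%C * rft (fun x => sin (x - t) * g x) k).
have -> : cabs ((0 +i* 1)%C * rft (fun x => sin (x - t) * g x) k) =
    cabs (rft (fun x => sin (x - t) * g x) k).
  have i1 : cabs ((0 +i* 1)%C : C) = 1.
    by apply/eqP; rewrite -(@eqrXn2 _ 2) ?cabs_ge0// cabs_sqr /= expr0n add0r.
  by rewrite cabsM i1 mul1r.
have f1 : (fun x => (1 - cos (x - t)) * g x) =
    (fun x => e1 x * (phi x * unit_bump (N1 * x + (- (N1 * a) - j%:R)))).
  by apply/funext => x; rewrite /e1 mul1r.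
have f2 : (fun x => sin (x - t) * g x) =
    (fun x => e2 x * (phi x * unit_bump (N1 * x + (- (N1 * a) - j%:R)))).
  by apply/funext => x; rewrite /e2 mul1r.
rewrite f1 f2; move: (b1 k) (b2 k).
move: (cabs (rft _ k)) (cabs (rft _ k)) => u v h1 h2 h.
have p : 0 <= N1 ^+ 2 + k ^+ 2 by rewrite addr_ge0 ?sqr_ge0.
apply: le_trans (ler_wpM2l p h) _; rewrite mulrDr.
apply: le_trans (lerD h1 h2) _.
by rewrite -mulrDl -natrD.
Qed.

Lemma rft_sum (I : Type) (s : seq I) (f : I -> R -> R) a b x :
  (forall i, continuous (f i)) -> (forall i, supp_in a b (f i)) ->
  rft (fun t => \sum_(i <- s) f i t) x = \sum_(i <- s) rft (f i) x.
Proof.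
move=> cf sf; rewrite /rft /fourier.
rewrite -(cintegral_sum s (F := fun i t => expi (- (x * t)) * RtoC (f i t))); last first.
  by move=> i; apply: rft_cintble (sf i).
apply: eq_cintegral => t; rewrite -mulr_sumr; congr (_ * _).
by elim/big_rec2 : _ => // i y z _ <-; rewrite RtoCD.
Qed.

Lemma pairing_limits F c (B : R) a b phi : has_expansion F c ->
  (forall n, cabs (c n) <= B * n.+1%:R) -> rsmooth phi -> supp_in a b phi ->
  exists l : nat -> C, forall m, csum_cvg (fun n => c n * rft phi (m%:R - n%:R)) (l m) /\
    clim (1 : R)^'- (fun r => pairing F phi r m) (l m).
Proof.
move=> hF cB sphi phi0.
have h m : exists l : C, csum_cvg (fun n => c n * rft phi (m%:R - n%:R)) l /\
    clim (1 : R)^'- (fun r => pairing F phi r m) l.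
  by have [l h1 h2] := pairing_limit m hF cB sphi phi0; exists l.
by have [l hl] := choice h; exists l.
Qed.

(** Given [e], the scale is chosen so that the pieces near [S] add up to at most [e / 2] for every
    [m]. At that fixed scale finitely many other pieces remain; each is supported among regular
    points and tends to 0 in [m]. *)
Lemma bounded_reg F c (S : set R) (t0 d M B : R) : has_expansion F c ->
  (forall n, cabs (c n) <= B) ->
  closed S -> mu S = 0%E -> (forall t, ~ S t -> reg F t) -> 0 < d ->
  (forall t : R, S t -> `|t - t0| <= d ->
    forall k, cabs (\sum_(0 <= n < k.+1) c n * expi t ^+ n) <= M) -> reg F t0.
Proof.
move=> hF cB cS S0 hreg d0 hM; exists d => // a b phi sphi phi0 ha hb.
have B0 : 0 <= B by apply: le_trans (cB 0%N); exact: cabs_ge0.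
have cB' n : cabs (c n) <= B * n.+1%:R by apply: le_trans (cB n) _; rewrite ler_peMr// ler1n.
have [l0 hl0] := pairing_limits hF cB' sphi phi0.
exists l0 => [m|e e0]; first exact: (hl0 m).2.
have [A A0 hA] := smooth_bounds sphi phi0.
have [P P0 hP] := smooth_bounds (@rsmooth_unit_bump R) (@supp_unit_bump R).
(* Independent of the scale. The absolute value makes [K] nonnegative even if no point of [S]
   constrains the sign of [M]. *)
pose K := `|M| * (A * P) * (4 + 360 * pi).
have K0 : 0 <= K.
  apply: mulr_ge0; first by apply: mulr_ge0; [exact: normr_ge0|exact: mulr_ge0].
  by apply: addr_ge0; [exact: ler0n|apply: mulr_ge0; [exact: ler0n|exact: pi_ge0]].
have K1 : 0 < K + 1 by lra.
have e1 : 0 < e / 2 / (K + 1) by rewrite !divr_gt0.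
have [N hN] := null_grid_count a b cS S0 e1.
have N0 : 0 < N.+1%:R :> R by [].
pose Q := (`|Num.ceil (N.+1%:R * (b - a) + 1)|)%N.
have NQ : N.+1%:R * (b - a) + 1 <= Q%:R := le_absz_ceil _.
pose near_S (j : nat) := exists x : R, [/\ S x, a <= x <= b &
      a + (j%:R - 1) / N.+1%:R <= x <= a + (j%:R + 1) / N.+1%:R].
pose J : {pred 'I_Q} := fun j => `[< near_S j >].
have hJ := hN N Q (leqnn N) J (fun j Jj => (asboolP _ Jj)).
pose g (j : nat) x := phi x * grid_bump N.+1%:R a j x.
have sg j : rsmooth (g j) by apply: rsmoothM => //; exact: rsmooth_grid_bump.
have g0 j : supp_in a b (g j) by move=> x /phi0; rewrite /g => ->; rewrite mul0r.
have [l hl] := choice (fun j => pairing_limits hF cB' (sg j) (g0 j)).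
have lsum m : l0 m = \sum_(j < Q) l j m.
  apply: (clim_unique (hl0 m).1).
  apply: (eq_clim _ (clim_sum (index_enum 'I_Q) (fun j : 'I_Q => (hl j m).1))) => k.
  rewrite exchange_big; apply: eq_bigr => n _; rewrite -mulr_sumr; congr (_ * _).
  rewrite -(rft_sum _ _ (fun j : 'I_Q => rsmooth_continuous (sg j)) (fun j : 'I_Q => g0 j)).
  congr (rft _ _); apply/funext => x.
  by rewrite (grid_bump_sum x phi0 N0 NQ) big_mkord.
have far (j : 'I_Q) : ~~ J j -> clim \oo (l j) 0.
  move=> /asboolPn nJ.
  have [l' hl' l'0] : good F (g j).
    apply: (reg_good hF (sg j) (@supp_grid_piece R _ a b phi j N0 phi0)) => t.
    rewrite ge_max le_min => /andP[/andP[t1 t2] /andP[t3 t4]].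
    by apply: hreg => St; apply: nJ; exists t; split => //; apply/andP.
  apply: (eq_clim _ l'0) => m; exact: (clim_unique (hl' m) (hl j m).2).
have close (j : 'I_Q) m : J j -> cabs (l j m) <= K / N.+1%:R.
  move=> /asboolP[x [Sx xab xj]].
  have hMx k : cabs (\sum_(0 <= n < k.+1) c n * expi x ^+ n) <= `|M|.
    apply: le_trans (ler_norm M); apply: hM => //.
    by move: xab => /andP[h1 h2]; rewrite ler_norml; apply/andP; split; lra.
  exact: (piece_coef_bound cB hMx sphi phi0 A0 P0 hA hP xab xj (hl j m).1).
(* Zeroing the pieces near [S] leaves a sum over the full index set in which every term tends to
   0. *)
pose z (j : 'I_Q) m : C := if J j then 0 else l j m.
have z0 j : clim \oo (z j) 0.
  case: (boolP (J j)) => hj.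
    by apply: (eq_clim _ (clim_cst 0)) => m; rewrite /z hj.
  by apply: (eq_clim _ (far j hj)) => m; rewrite /z (negbTE hj).
have Ff : Filter \oo by exact: filter_filter.
have e2 : 0 < e / 2 by lra.
have := @clim_sum R nat \oo Ff _ (index_enum 'I_Q) _ _ z0 _ e2.
rewrite big1 //; apply: filterS => m; rewrite !subr0 => hz.
have -> : l0 m = \sum_(j < Q) (if J j then l j m else 0) + \sum_(j < Q) z j m.
  rewrite lsum -big_split /=; apply: eq_bigr => j _; rewrite /z.
  by case: ifP; rewrite ?addr0 ?add0r.
apply: le_lt_trans (cabsD _ _) _; rewrite [e]splitr.
apply: ler_ltD => //; apply: le_trans (cabs_sum _ _ _) _.
apply: (@le_trans _ _ (\sum_(j < Q | J j) K / N.+1%:R)).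
  rewrite [leRHS]big_mkcond /=; apply: ler_sum => j _.
  by case: ifPn => [/close|]; rewrite ?cabs0.
rewrite sumr_const (_ : _ *+ _ = K * (#|J|%:R / N.+1%:R)); last first.
  by rewrite -mulr_natr -mulrA [X in K * X]mulrC.
apply: le_trans (ler_wpM2l K0 hJ) _.
rewrite mulrA ler_pdivrMr// [K * _]mulrC ler_wpM2l//; lra.
Qed.

Lemma coef_cvg0 F c (E : set C) : has_expansion F c -> mu [set t : R | E (expi t)] = 0%E ->
  lpf_boundary F [set t : R | ~ E (expi t)] ->
  (forall t : R, E (expi t) ->
     exists M : R, forall N, cabs (\sum_(0 <= n < N.+1) c n * expi t ^+ n) <= M) ->
  clim \oo c 0.
Proof.
move=> hF E0 lF bF.
have regF (t : R) : ~ E (expi t) -> reg F t by move=> nE; have := lpf_good lF nE.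
pose S : set R := [set t | ~ reg F t].
have SE : S `<=` [set t : R | E (expi t)].
  by move=> t nr; apply: contrapT => nE; apply: nr; exact: regF.
have cS : closed S.
  rewrite -[S]setCK; apply: open_closedC.
  have -> : ~` S = [set t | reg F t] by apply/seteqP; split => t /=; [exact: contrapT|move=> h nh; exact: nh].
  rewrite openE => t [d d0 hd]; apply/nbhs_ballP.
  have d2 : 0 < d / 2 by lra.
  exists (d / 2) => //= s; rewrite /ball /= ltr_norml => /andP[h1 h2].
  by exists (d / 2) => // a b phi sp p0 ha hb; apply: (hd a b) => //; lra.
have oE : open [set t : R | ~ E (expi t)] by case: lF.
have mE : measurable [set t : R | E (expi t)].
  apply: closed_measurable; rewrite -[X in closed X]setCK; exact: open_closedC.
have S0 : mu S = 0%E.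
  apply/eqP; rewrite eq_le measure_ge0 andbT -E0; apply: le_measure; rewrite ?inE//.
  exact: closed_measurable.
case: (pselect (S !=set0)) => [S1|nS]; last first.
  apply: (@cutoff_coef _ _ _ 0 hF).
  apply: (reg_good hF (@rsmooth_circle_cutoff R 0) (@supp_circle_cutoff R 0)) => t _.
  by apply: contrapT => h; apply: nS; exists t.
pose u N (t : R) := cabs (\sum_(0 <= n < N.+1) c n * expi t ^+ n).
have cu N : continuous (u N).
  have cexp : forall n (t : R), clim (nbhs t) (fun s => c n * expi s ^+ n) (c n * expi t ^+ n).
    move=> n t; apply: climZ; apply: (eq_clim (f := fun s => expi (n%:R * s))).
      by move=> s; rewrite expi_natM.
    have cn : continuous (fun s : R => n%:R * s).
      by move=> s; apply: cvgM; [exact: cvg_cst|exact: cvg_id].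
    rewrite -expi_natM; apply/clim_ReIm; split => /=.
      by apply: (continuous_comp (cn t)); exact: continuous_cos.
    by apply: (continuous_comp (cn t)); exact: continuous_sin.
  move=> t; apply/cvgrPdist_lt => e e0.
  have Fn : Filter (nbhs t) by typeclasses eauto.
  have := @clim_sum R _ (nbhs t) Fn _ (index_iota 0 N.+1) _ _ (fun n => cexp n t) e e0.
  apply: filterS => s; apply: le_lt_trans; rewrite /u.
  exact: cabs_dist.
have bu t : S t -> exists M, forall N, u N t <= M by move=> /SE/bF.
have [t0 [d [M [St0 d0 hM]]]] := baire_bounded cS S1 cu bu.
have hM0 N : cabs (\sum_(0 <= n < N.+1) c n * expi t0 ^+ n) <= M.
  by apply: (hM t0 St0); rewrite subrr normr0 ltW.
(* Consecutive partial sums at the single point [t0] differ by a term of modulus [|c n|]. *)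
have cB n : cabs (c n) <= 2 * M.
  have -> : cabs (c n) = cabs (c n * expi t0 ^+ n).
    by rewrite cabsM cabsX cabs_expi expr1n mulr1.
  case: n => [|n].
    by have := hM0 0%N; have := cabs_ge0 (c 0%N * expi t0 ^+ 0); rewrite big_nat1; lra.
  have -> : c n.+1 * expi t0 ^+ n.+1 = \sum_(0 <= i < n.+2) c i * expi t0 ^+ i -
      \sum_(0 <= i < n.+1) c i * expi t0 ^+ i.
    by rewrite [X in X - _]big_nat_recr//= addrAC subrr add0r.
  by apply: le_trans (cabsB _ _) _; have := hM0 n; have := hM0 n.+1; lra.
exfalso; apply: St0; apply: (bounded_reg hF cB cS S0 _ d0 hM).
by move=> t nS; apply: contrapT.
Qed.

End CoefficientDecay.

(** * The boundary distribution on the circle *)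

Section FlatTopKernel.
Variable R : realType.
Local Notation C := (Cplx R).
Local Notation mu := (@lebesgue_measure R).

Lemma Rintegral_odd (f : R -> R) : rintble f -> (forall x, f (- x) = - f x) ->
  Rintegral mu setT f = 0.
Proof.
move=> jf fodd.
have mf : measurable_fun [set: measurableTypeR R] (EFin \o f) by exact: measurable_int jf.
have mo : measurable_fun [set: measurableTypeR R] (-%R : _ -> measurableTypeR R).
  by apply: continuous_measurable_fun; exact: opp_continuous.
have jo : mu.-integrable ((-%R : _ -> measurableTypeR R) @^-1` setT) ((EFin \o f) \o -%R).
  have := rintbleZ (-1) jf; rewrite preimage_setT.
  by apply: eq_integrable => // x _ /=; rewrite fodd mulN1r.
have := integral_pushforward mo mf jo measurableT.
have e : (\int[pushforward mu (-%R : _ -> measurableTypeR R)]_(y in setT) (EFin \o f) y =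
    \int[mu]_(y in setT) (EFin \o f) y)%E.
  by apply: eq_measure_integral => A mA _; exact: lebesgue_measureN.
rewrite e preimage_setT => h.
have : Rintegral mu setT f = Rintegral mu setT (fun x => - f x).
  rewrite /Rintegral; congr fine; rewrite h; apply: eq_integral => x _ /=.
  by rewrite fodd.
have -> : Rintegral mu setT (fun x => - f x) = - Rintegral mu setT f.
  rewrite -mulN1r -RintegralZl//; apply: eq_Rintegral => x _; by rewrite mulN1r.
lra.
Qed.

Lemma mvt0_bound (f df : R -> R) (B y : R) : f 0 = 0 ->
  (forall x : R, is_derive x 1 f (df x)) -> (forall z, `|z| <= `|y| -> `|df z| <= B) ->
  `|f y| <= B * `|y|.
Proof.
move=> f0 fd hB.
have cf (x : R) : derivable f x 1 by exact: ex_derive.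
case: (ltgtP 0 y) => [y0|y0|<-]; last by rewrite f0 !normr0 mulr0.
  have [c hc e] := @MVT _ f df 0 y y0 (fun z _ => fd z)
    (derivable_within_continuous (fun z _ => cf z)).
  rewrite f0 !subr0 in e; rewrite e normrM ler_wpM2r// hB//.
  by move: hc; rewrite in_itv /= => /andP[h1 h2]; rewrite !gtr0_norm// ltW.
have [c hc e] := @MVT _ f df y 0 y0 (fun z _ => fd z)
  (derivable_within_continuous (fun z _ => cf z)).
rewrite f0 !sub0r in e; rewrite -normrN e normrM normrN ler_wpM2r// hB//.
by move: hc; rewrite in_itv /= => /andP[h1 h2]; rewrite !ltr0_norm// lerN2 ltW.
Qed.

(** Two applications of the mean value bound, first to [x - sin x] and then to the remainder. A
    cubic remainder is what makes [fejer] continuous at 0 after division by [y^2]. *)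
Lemma cos_taylor2 (y : R) : `|1 - cos y - 2^-1 * y ^+ 2| <= `|y| ^+ 3.
Proof.
pose s (x : R) := x - sin x.
have ds (x : R) : is_derive x 1 s (1 - cos x).
  by apply: is_derive_eq.
have sb (x : R) : `|s x| <= `|x| ^+ 2.
  rewrite expr2; apply: (mvt0_bound _ ds); first by rewrite /s sin0 subr0.
  move=> z zx; apply: le_trans zx; have := cos_lipschitz z 0.
  by rewrite cos0 subr0 distrC.
pose f (x : R) := 1 - cos x - 2^-1 * x ^+ 2.
have dm (x : R) : is_derive x 1 (fun x => - cos x) (sin x).
  by rewrite -[sin x]opprK; exact: is_deriveN.
have dx (x : R) : is_derive x 1 (fun x : R => - 2^-1 * (x * x)) (- x).
  have := is_derive_scaleR (- 2^-1) (is_derive_mulR (is_derive_id x 1) (is_derive_id x 1)).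
  by move=> h; apply: (is_derive_eq h); lra.
have df (x : R) : is_derive x 1 f (- s x).
  have h := is_derive_addR (is_derive_addR (is_derive_cst (1 : R) x 1) (dm x)) (dx x).
  have -> : f = fun x => 1 + - cos x + - 2^-1 * (x * x).
    by apply/funext => z; rewrite /f; lra.
  by apply: (is_derive_eq h); rewrite /s; lra.
have -> : `|y| ^+ 3 = `|y| ^+ 2 * `|y| by rewrite exprSr.
apply: (mvt0_bound _ df); first by rewrite /f cos0 expr0n mulr0; lra.
move=> z zy; rewrite normrN; apply: le_trans (sb z) _.
by rewrite ler_sqr ?nnegrE.
Qed.

(* The Fejer-type kernel [(1 - cos y) / y^2], continuously extended at [0]. *)
Definition fejer (y : R) : R := if y == 0 then 2^-1 else (1 - cos y) / y ^+ 2.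

Lemma fejer_scale (s y : R) : s != 0 -> y != 0 ->
  s ^+ 2 * fejer (s * y) = (1 - cos (s * y)) / y ^+ 2.
Proof.
move=> s0 y0; rewrite /fejer mulf_eq0 (negbTE s0) (negbTE y0) /=.
by rewrite exprMn; field; rewrite y0.
Qed.

Lemma fejer_ge0 y : 0 <= fejer y.
Proof.
rewrite /fejer; case: ifP => // _; by rewrite divr_ge0 ?sqr_ge0// subr_ge0 cos_le1.
Qed.

Lemma fejer_near0 y : `|fejer y - 2^-1| <= `|y|.
Proof.
rewrite /fejer; case: eqVneq => [->|y0]; first by rewrite subrr normr0.
have n0 : 0 < `|y| by rewrite normr_gt0.
have -> : (1 - cos y) / y ^+ 2 - 2^-1 = (1 - cos y - 2^-1 * y ^+ 2) / y ^+ 2.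
  by field.
rewrite normrM normfV normrX ler_pdivrMr ?exprn_gt0//.
by rewrite -exprS; exact: cos_taylor2.
Qed.

Lemma fejer_le y : fejer y <= 4 * cauchyk y.
Proof.
have p : 0 < 1 + y ^+ 2 by rewrite ltr_wpDr ?sqr_ge0.
rewrite /cauchyk ler_pdivlMr//.
have f0 := fejer_ge0 y.
have y2 : y ^+ 2 = `|y| ^+ 2 by rewrite real_normK ?num_real.
case: (leP `|y| 1) => y1.
  have : fejer y <= 3 / 2.
    by have := fejer_near0 y; rewrite ler_norml => /andP[_]; lra.
  have : y ^+ 2 <= 1 by rewrite y2 expr_le1.
  by have := sqr_ge0 y; nra.
have y0 : y != 0 by apply: contraTneq y1 => ->; rewrite normr0 -leNgt.
have y21 : 1 <= y ^+ 2 by rewrite y2 expr_ge1// ltW.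
have : fejer y * y ^+ 2 <= 2.
  rewrite /fejer (negbTE y0) divfK ?expf_neq0//.
  by have := cos_geN1 y; lra.
nra.
Qed.

Lemma fejer_continuous : continuous fejer.
Proof.
move=> y; case: (eqVneq y 0) => [->|y0].
  apply/cvgrPdist_lt => e e0; apply/nbhs_ballP; exists e => //= z.
  rewrite /ball /= sub0r normrN => ze; apply: le_lt_trans ze.
  by rewrite {1}/fejer eqxx distrC; exact: fejer_near0.
have h : {near y, (fun z => (1 - cos z) / z ^+ 2) =1 fejer}.
  have : nbhs y [set z | z != 0].
    apply/nbhs_ballP; exists `|y|; rewrite /= ?normr_gt0// => z.
    by apply: contraPneq => ->; rewrite /ball /= subr0 ltxx.
  by apply: filterS => z /= z0; rewrite /fejer (negbTE z0).
have : {for y, continuous (fun z : R => (1 - cos z) / z ^+ 2)}.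
  apply: cvgM; first by apply: cvgB; [exact: cvg_cst|exact: continuous_cos].
  by apply: cvgV; [rewrite expf_neq0|exact: exprn_continuous].
move=> h2; rewrite /prop_for /continuous_at.
have -> : fejer y = (1 - cos y) / y ^+ 2 by rewrite /fejer (negbTE y0).
by apply: cvg_trans h2; apply: near_eq_cvg.
Qed.

Lemma fejer_rintble : rintble fejer.
Proof.
apply: (@le_rintble _ _ (fun x => 4 * cauchyk x)).
- by apply: continuous_measurable_fun; exact: fejer_continuous.
- by apply: rintbleZ; exact: cauchyk_rintble.
- by move=> x; rewrite ger0_norm ?fejer_ge0//; exact: fejer_le.
Qed.

(** The integral equals [pi]; the reproducing kernel is normalised by dividing by it, which calls
    only for its positivity. *)
Definition fejer_mass : R := Rintegral mu setT fejer.

Lemma fejer_mass_gt0 : 0 < fejer_mass.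
Proof.
have h : Rintegral mu setT (fun x => if x \in `[(- 4^-1 : R), 4^-1] then 4^-1 else 0) <= fejer_mass.
  apply: le_RintegralT; [exact: rintble_cst_supp|exact: fejer_rintble|].
  move=> x; case: ifPn => [|_]; last exact: fejer_ge0.
  rewrite in_itv /= -ler_norml => hx; have := fejer_near0 x.
  by rewrite ler_norml => /andP[h _]; lra.
apply: lt_le_trans h; rewrite Rintegral_cst_supp; last by lra.
by rewrite mulr_gt0//; lra.
Qed.

Lemma fejer_scaled_mass (s : R) : 0 < s ->
  rintble (fun y => s ^+ 2 * fejer (s * y)) /\
  Rintegral mu setT (fun y => s ^+ 2 * fejer (s * y)) = s * fejer_mass.
Proof.
move=> s0; have [] := rintble_affine_ge0 0 s0 fejer_continuous fejer_ge0 fejer_rintble.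
under eq_fun do rewrite addr0.
move=> h1 h2; split; first exact: rintbleZ.
by rewrite RintegralZl// expr2 -mulrA h2.
Qed.

(* [flat_top y = (cos y - cos 2y) / y^2]: its Fourier transform is a trapezoid, constant on
   [-1, 1]. *)
Definition flat_top (y : R) : R := 4 * fejer (2 * y) - fejer y.

Lemma flat_top_continuous : continuous flat_top.
Proof.
move=> y; apply: cvgB; last exact: fejer_continuous.
apply: cvgM; first exact: cvg_cst.
have c2 : continuous (fun y : R => 2 * y).
  by move=> z; apply: cvgM; [exact: cvg_cst|exact: cvg_id].
by apply: (continuous_comp (c2 y)); exact: fejer_continuous.
Qed.

Lemma flat_top_le y : `|flat_top y| <= 20 * cauchyk y.
Proof.
have h1 := fejer_le (2 * y); have h2 := fejer_le y.
have h3 := fejer_ge0 (2 * y); have h4 := fejer_ge0 y.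
have h5 : cauchyk (2 * y) <= cauchyk y.
  rewrite /cauchyk lef_pV2 ?posrE ?ltr_wpDr ?sqr_ge0//.
  by rewrite lerD2l exprMn; have := sqr_ge0 y; lra.
by rewrite /flat_top ler_norml; apply/andP; split; lra.
Qed.

(** After multiplication by [y^2] this is the product-to-sum formula for
    [cos (y s) (cos y - cos (2 y))]. *)
Lemma flat_top_cos (s y : R) : `|s| < 1 -> cos (y * s) * flat_top y =
  2^-1 * ((2 + s) ^+ 2 * fejer ((2 + s) * y) + (2 - s) ^+ 2 * fejer ((2 - s) * y) -
          ((1 + s) ^+ 2 * fejer ((1 + s) * y) + (1 - s) ^+ 2 * fejer ((1 - s) * y))).
Proof.
rewrite ltr_norml => /andP[s1 s2]; case: (eqVneq y 0) => [->|y0].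
  by rewrite /flat_top mul0r !mulr0 cos0 /fejer eqxx; field.
have f1 : 4 * fejer (2 * y) = (1 - cos (2 * y)) / y ^+ 2.
  have n2 : (2 : R) != 0 by [].
  have n4 : (4 : R) = 2 ^+ 2 by rewrite expr2 -natrM.
  by rewrite n4 (fejer_scale n2 y0).
have f2 : fejer y = (1 - cos y) / y ^+ 2 by rewrite /fejer (negbTE y0).
rewrite /flat_top f1 f2 !fejer_scale//; try (by apply/eqP; lra).
have e1 : (2 + s) * y = 2 * y + y * s by ring.
have e2 : (2 - s) * y = 2 * y - y * s by ring.
have e3 : (1 + s) * y = y + y * s by ring.
have e4 : (1 - s) * y = y - y * s by ring.
by rewrite e1 e2 e3 e4 !cosB !cosD; field.
Qed.

Lemma fejer_even y : fejer (- y) = fejer y.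
Proof. by rewrite /fejer oppr_eq0 cosN sqrrN. Qed.

Lemma cmeas_flat_top (h : R -> R) : measurable_fun setT h ->
  cmeas (fun y => expi (h y) * RtoC (flat_top y)).
Proof.
move=> mh; apply: cmeasM; first exact: cmeas_expi.
by apply: cmeas_RtoC; apply: continuous_measurable_fun; exact: flat_top_continuous.
Qed.

Lemma flat_top_cintble (h : R -> R) : measurable_fun setT h ->
  cintble (fun y => expi (h y) * RtoC (flat_top y)).
Proof.
move=> mh; apply: (@le_cintble _ _ (fun x => 20 * cauchyk x)).
- exact: cmeas_flat_top.
- by apply: rintbleZ; exact: cauchyk_rintble.
- by move=> y; rewrite cabsM cabs_expi mul1r cabs_RtoC; exact: flat_top_le.
Qed.

(** The imaginary part is odd. For the real part, [fejer] rescaled as in [flat_top_cos] has mass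
    proportional to its scale, all four scales being positive when [|s| < 1]; the total [((2 + s) +
    (2 - s) - (1 + s) - (1 - s)) / 2 = 1] does not depend on [s]. *)
Lemma flat_top_transform (s : R) : `|s| < 1 ->
  cintegral (fun y => expi (y * s) * RtoC (flat_top y)) = RtoC fejer_mass.
Proof.
move=> s1; have mh : measurable_fun setT (fun y : R => y * s).
  by apply: measurable_funM => //; exact: measurable_cst.
have [i1 i2] := flat_top_cintble mh.
apply: C_ext => /=; last first.
  apply: Rintegral_odd => [|y]; first exact: i2.
  by rewrite !mulr0 !add0r mulNr sinN /flat_top mulrN !fejer_even mulNr.
have h := s1; move: h; rewrite ltr_norml => /andP[sl sr].
have [j1 m1] := @fejer_scaled_mass (2 + s) ltac:(lra).
have [j2 m2] := @fejer_scaled_mass (2 - s) ltac:(lra).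
have [j3 m3] := @fejer_scaled_mass (1 + s) ltac:(lra).
have [j4 m4] := @fejer_scaled_mass (1 - s) ltac:(lra).
rewrite (@eq_Rintegral _ _ _ mu setT (fun y => 2^-1 *
  (((2 + s) ^+ 2 * fejer ((2 + s) * y) + (2 - s) ^+ 2 * fejer ((2 - s) * y)) -
   ((1 + s) ^+ 2 * fejer ((1 + s) * y) + (1 - s) ^+ 2 * fejer ((1 - s) * y))))); last first.
  by move=> y _; rewrite mulr0 subr0 flat_top_cos.
rewrite RintegralZl//; last by apply: rintbleB; exact: rintbleD.
rewrite RintegralB//; [|exact: rintbleD|exact: rintbleD].
by rewrite !RintegralD// m1 m2 m3 m4; lra.
Qed.

End FlatTopKernel.

(** * Fubini's theorem with an oscillating factor *)

Section ComplexFubini.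
Variable R : realType.
Local Notation C := (Cplx R).
Local Notation mu := (@lebesgue_measure R).

Lemma EFin_Rintegral (h : R -> R) : rintble h ->
  (\int[mu]_x (h x)%:E)%E = (Rintegral mu setT h)%:E.
Proof. by move=> jh; rewrite /Rintegral fineK//; exact: integrable_fin_num. Qed.

Lemma Rintegral_fubini (A phi : R -> R) (w : R * R -> R) :
  measurable_fun setT A -> rintble A -> measurable_fun setT phi -> rintble phi ->
  measurable_fun setT w -> (forall z, `|w z| <= 1) ->
  Rintegral mu setT (fun x => A x * Rintegral mu setT (fun t => w (x, t) * phi t)) =
  Rintegral mu setT (fun t => phi t * Rintegral mu setT (fun x => w (x, t) * A x)).
Proof.
move=> mA jA mphi jphi mw w1.
pose f (z : measurableTypeR R * measurableTypeR R) : \bar R := (A z.1 * (w z * phi z.2))%:E.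
have mf : measurable_fun setT f.
  apply/measurable_EFinP; apply: measurable_funM; first exact: measurableT_comp.
  by apply: measurable_funM => //; exact: measurableT_comp.
have mw1 (x : measurableTypeR R) : measurable_fun setT (fun t : measurableTypeR R => w (x, t)).
  by apply: measurableT_comp => //; exact: pair1_measurable.
have mw2 (t : measurableTypeR R) : measurable_fun setT (fun x : measurableTypeR R => w (x, t)).
  by apply: measurableT_comp => //; exact: pair2_measurable.
have j1 x : rintble (fun t => w (x, t) * phi t).
  apply: (@le_rintble _ _ (fun t => `|phi t|)); first exact: (measurable_funM (mw1 x) mphi).
    exact: integrable_norm.
  by move=> t; rewrite normrM ler_piMl.
have j2 t : rintble (fun x => w (x, t) * A x).
  apply: (@le_rintble _ _ (fun x => `|A x|)); first exact: (measurable_funM (mw2 t) mA).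
    exact: integrable_norm.
  by move=> x; rewrite normrM ler_piMl.
have E1 x : (\int[mu]_t f (x, t) = (A x * Rintegral mu setT (fun t => w (x, t) * phi t))%:E)%E.
  have := EFin_Rintegral (rintbleZ (A x) (j1 x)).
  by rewrite (RintegralZl (A x) measurableT (j1 x)) => <-.
have E2 t : (\int[mu]_x f (x, t) = (phi t * Rintegral mu setT (fun x => w (x, t) * A x))%:E)%E.
  have := EFin_Rintegral (rintbleZ (phi t) (j2 t)).
  rewrite (RintegralZl (phi t) measurableT (j2 t)) => <-.
  by apply: eq_integral => x _; rewrite /f /=; congr (_%:E); ring.
have jf : (mu \x mu)%E.-integrable setT f.
  apply/(integrable12ltyP _ _ mf).2.
  have nb x : (\int[mu]_t `|f (x, t)| <= (`|A x| * Rintegral mu setT (fun t => `|phi t|))%:E)%E.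
    have jn : rintble (fun t => `|phi t|) by exact: integrable_norm.
    have := EFin_Rintegral (rintbleZ `|A x| jn).
    rewrite (RintegralZl `|A x| measurableT jn) => <-.
    apply: ge0_le_integral => //.
    - apply: measurableT_comp => //; apply/measurable_EFinP.
      apply: (@measurable_funM _ _ _ _ (cst (A x)) (fun t => w (x, t) * phi t)).
        exact: measurable_cst.
      exact: (measurable_funM (mw1 x) mphi).
    - apply/measurable_EFinP.
      apply: (@measurable_funM _ _ _ _ (cst `|A x|) (fun t => `|phi t|)).
        exact: measurable_cst.
      exact: (measurableT_comp (@normr_measurable _ _) mphi).
    - by move=> t _; rewrite /f /= lee_fin !normrM ler_wpM2l// ler_piMl.
  have jnA : rintble (fun x => Rintegral mu setT (fun t => `|phi t|) * `|A x|).
    by apply: rintbleZ; exact: integrable_norm.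
  have /integrableP[mnA lA] := jnA.
  apply: le_lt_trans lA; apply: ge0_le_integral => //.
  - by move=> x _; apply: integral_ge0.
  - apply: (measurable_fun_fubini_tonelli_F (m2 := mu) (fun z => `|f z|%E)) => //.
    exact: measurableT_comp.
  - exact: measurableT_comp.
  - move=> x _; apply: le_trans (nb x) _.
    rewrite /= lee_fin mulrC; exact: ler_norm.
transitivity (fine (\int[mu]_x (\int[mu]_t f (x, t)))%E).
  rewrite [LHS]/Rintegral; congr fine; apply: eq_integral => x _; exact: (esym (E1 x)).
transitivity (fine (\int[mu]_t (\int[mu]_x f (x, t)))%E); first by congr fine; exact: (Fubini jf).
by rewrite [RHS]/Rintegral; congr fine; apply: eq_integral => t _; exact: E2.
Qed.

Lemma cintegral_fubini_expi (A phi : R -> R) (h : R * R -> R) :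
  measurable_fun setT A -> rintble A -> measurable_fun setT phi -> rintble phi ->
  measurable_fun setT h ->
  cintegral (fun x => RtoC (A x) * cintegral (fun t => expi (h (x, t)) * RtoC (phi t))) =
  cintegral (fun t => RtoC (phi t) * cintegral (fun x => expi (h (x, t)) * RtoC (A x))).
Proof.
move=> mA jA mphi jphi mh.
have mc : measurable_fun setT (fun z => cos (h z)).
  by apply: (measurableT_comp _ mh); apply: continuous_measurable_fun; exact: continuous_cos.
have ms : measurable_fun setT (fun z => sin (h z)).
  by apply: (measurableT_comp _ mh); apply: continuous_measurable_fun; exact: continuous_sin.
have hc := Rintegral_fubini mA jA mphi jphi mc (fun z => _).
have hs := Rintegral_fubini mA jA mphi jphi ms (fun z => _).
apply: C_ext => /=.
  transitivity (Rintegral mu setT (fun x => A x * Rintegral mu setT (fun t => cos (h (x, t)) * phi t))).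
    apply: eq_Rintegral => x _; rewrite mul0r subr0; congr (_ * _).
    by apply: eq_Rintegral => t _; rewrite mulr0 subr0.
  rewrite hc; last by move=> z; rewrite ler_norml cos_geN1 cos_le1.
  apply: eq_Rintegral => t _; rewrite mul0r subr0; congr (_ * _).
  by apply: eq_Rintegral => x _; rewrite mulr0 subr0.
transitivity (Rintegral mu setT (fun x => A x * Rintegral mu setT (fun t => sin (h (x, t)) * phi t))).
  apply: eq_Rintegral => x _; rewrite mul0r addr0; congr (_ * _).
  by apply: eq_Rintegral => t _; rewrite mulr0 add0r.
rewrite hs; last by move=> z; rewrite ler_norml sin_geN1 sin_le1.
apply: eq_Rintegral => t _; rewrite mul0r addr0; congr (_ * _).
by apply: eq_Rintegral => x _; rewrite mulr0 add0r.
Qed.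

End ComplexFubini.

Section KernelReproduction.
Variable R : realType.
Local Notation C := (Cplx R).
Local Notation mu := (@lebesgue_measure R).
Implicit Types (phi : R -> R) (c : nat -> C) (F : C -> C).

(* The modulated kernel whose translates reproduce [e^{int}] for [|t - t0| < 1]. *)
Definition kernel_at (t0 y : R) : C := expi (- (t0 * y)) * RtoC (flat_top y).

Lemma kernel_at_le t0 y : cabs (kernel_at t0 y) <= 20 / (1 + y ^+ 2).
Proof. by rewrite cabsM cabs_expi mul1r cabs_RtoC; exact: flat_top_le. Qed.

(** After Fubini and the shift [y = x - n], the inner integral is [e^{int}] times the transform of
    [flat_top] at [t - t0]. This is constant because the support of [phi] lies within distance 1 of
    [t0]. *)
Lemma kernel_at_reproduces t0 a b phi n : continuous phi -> supp_in a b phi ->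
  t0 - 1 < a -> b < t0 + 1 ->
  cintegral (fun x => kernel_at t0 (x - n%:R) * rft phi (- x)) =
  RtoC (fejer_mass R) * rft phi (- n%:R).
Proof.
move=> cphi phi0 ha hb.
pose A (x : R) := flat_top (x - n%:R).
pose h (z : measurableTypeR R * measurableTypeR R) : R := z.1 * z.2 - t0 * (z.1 - n%:R).
have mh : measurable_fun setT h.
  apply: measurable_funB; first exact: measurable_funM.
  apply: measurable_funM; first exact: measurable_cst.
  by apply: measurable_funB => //; exact: measurable_cst.
have sub : continuous (fun x : R => x - n%:R).
  by move=> x; apply: cvgB; [exact: cvg_id|exact: cvg_cst].
have cA : continuous A.
  by move=> x; apply: (continuous_comp (sub x)); exact: flat_top_continuous.
have mA : measurable_fun setT A by exact: continuous_measurable_fun.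
have jA : rintble A.
  apply: (@le_rintble _ _ (fun x => 20 * cauchyk (x + - n%:R))) => //.
    by apply: rintbleZ; have [] := cauchyk_shift (- (n%:R : R)).
  by move=> x; exact: flat_top_le.
have mphi : measurable_fun setT phi by exact: continuous_measurable_fun.
have jphi := supp_rintble cphi phi0.
have -> : cintegral (fun x => kernel_at t0 (x - n%:R) * rft phi (- x)) =
  cintegral (fun x => RtoC (A x) * cintegral (fun t => expi (h (x, t)) * RtoC (phi t))).
  apply: eq_cintegral => x; rewrite /kernel_at (mulrC (expi _)) -mulrA; congr (_ * _).
  rewrite /rft /fourier -cintegralZ; last exact: rft_cintble phi0.
  apply: eq_cintegral => t; rewrite mulrA -expiD; congr (expi _ * _).
  by rewrite /h /=; ring.
rewrite (cintegral_fubini_expi mA jA mphi jphi mh).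
have inner t : `|t - t0| < 1 -> cintegral (fun x => expi (h (x, t)) * RtoC (A x)) =
    expi (n%:R * t) * RtoC (fejer_mass R).
  move=> ht; pose G y : C := expi (n%:R * t) * (expi (y * (t - t0)) * RtoC (flat_top y)).
  have my : measurable_fun setT (fun y : R => y * (t - t0)).
    by apply: measurable_funM => //; exact: measurable_cst.
  have jG0 := flat_top_cintble my.
  have [jG1 jG2] : cintble G := cintbleZ (expi (n%:R * t)) jG0.
  have GE x : expi (h (x, t)) * RtoC (A x) = G (x + - n%:R).
    by rewrite /G mulrA -expiD /A; congr (expi _ * _); rewrite /h /=; ring.
  rewrite (eq_cintegral GE).
  have cy : continuous (fun y : R => n%:R * t + y * (t - t0)).
    move=> y; apply: cvgD; first exact: cvg_cst.
    by apply: cvgM; [exact: cvg_id|exact: cvg_cst].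
  have GE' y : G y = expi (n%:R * t + y * (t - t0)) * RtoC (flat_top y).
    by rewrite /G mulrA -expiD.
  have cG1 : continuous (fun y => complex.Re (G y)).
    under eq_fun do rewrite GE' Re_expiM.
    move=> y; apply: cvgM; last exact: flat_top_continuous.
    by apply: (continuous_comp (cy y)); exact: continuous_cos.
  have cG2 : continuous (fun y => complex.Im (G y)).
    under eq_fun do rewrite GE' Im_expiM.
    move=> y; apply: cvgM; last exact: flat_top_continuous.
    by apply: (continuous_comp (cy y)); exact: continuous_sin.
  transitivity (cintegral G).
    apply: C_ext => /=.
      exact: (Rintegral_shift (- n%:R) cG1 jG1).
    exact: (Rintegral_shift (- n%:R) cG2 jG2).
  by rewrite /G cintegralZ// flat_top_transform.
rewrite /rft /fourier -cintegralZ; last exact: rft_cintble phi0.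
apply: eq_cintegral => t.
case: (boolP (t \in `[a, b])) => [|/phi0 ->]; last by rewrite RtoC0 mul0r !mulr0.
rewrite in_itv /= => /andP[at' tb]; rewrite inner; last first.
  by rewrite ltr_norml; apply/andP; split; lra.
by rewrite mulNr opprK; ring.
Qed.

End KernelReproduction.

(** * Complex test functions through their real and imaginary parts *)

Section RealParts.
Variable R : realType.
Local Notation C := (Cplx R).
Local Notation mu := (@lebesgue_measure R).

Local Notation iu := (Complex 0 1 : Cplx R).

Lemma oo_filter : Filter (\oo : set_system nat).
Proof. exact: _. Qed.

Lemma near_eq_clim (T : Type) (F : set_system T) (FF : Filter F) (f g : T -> C) (l : C) :
  (\forall x \near F, f x = g x) -> clim F f l -> clim F g l.
Proof. by move=> h hf e e0; apply: filterS2 h (hf e e0) => x ->. Qed.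

Lemma C_split (z : C) : z = RtoC (complex.Re z) + iu * RtoC (complex.Im z).
Proof.
by apply: C_ext; rewrite ?(Re_add, Im_add, Re_mul, Im_mul) /=;
  rewrite ?(mul0r, mul1r, mulr0, subr0, addr0, add0r, subrr).
Qed.

Lemma cintegral_split (g phi : R -> C) :
  cintble (fun t => g t * RtoC (complex.Re (phi t))) ->
  cintble (fun t => g t * RtoC (complex.Im (phi t))) ->
  cintegral (fun t => g t * phi t) =
  cintegral (fun t => g t * RtoC (complex.Re (phi t))) +
  iu * cintegral (fun t => g t * RtoC (complex.Im (phi t))).
Proof.
move=> j1 j2; rewrite -cintegralZ// -cintegralD//; last exact: cintbleZ.
by apply: eq_cintegral => t; rewrite {1}(C_split (phi t)) mulrDr mulrCA.
Qed.

Lemma test_fun_rsmooth U (phi : R -> C) : test_fun U phi ->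
  rsmooth (fun t => complex.Re (phi t)) /\ rsmooth (fun t => complex.Im (phi t)).
Proof. by move=> [sphi _]; split; split => n x;
  [exact: (proj1 (sphi n x))|exact: (proj2 (sphi n x))]. Qed.

Lemma test_fun_supp U a b (phi : R -> C) : test_fun U phi -> U `<=` `[a, b]%classic ->
  supp_in a b (fun t => complex.Re (phi t)) /\ supp_in a b (fun t => complex.Im (phi t)).
Proof.
move=> [_ [K [_ [KU phi0]]]] Uab.
by split=> x /negP xab; rewrite phi0//= => /KU/Uab.
Qed.

Lemma test_fun_bounded_supp U (phi : R -> C) : test_fun U phi ->
  exists a b, supp_in a b (fun t => complex.Re (phi t)) /\
    supp_in a b (fun t => complex.Im (phi t)).
Proof.
move=> tphi; have [sphi [K [cK [KU phi0]]]] := tphi.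
have [M [_ hM]] := compact_bounded cK.
(* [phi] is viewed as a test function on its own compact set [K], which lies in a bounded
   interval. *)
exists (- (M + 1)), (M + 1); apply: (@test_fun_supp K).
  by split; [exact: sphi|exists K; split; [exact: cK|split]].
by move=> x Kx; rewrite /= in_itv /= -ler_norml; apply: (hM (M + 1)) => //; rewrite ltrDl.
Qed.

Lemma fourier_split U (phi : R -> C) x : test_fun U phi ->
  fourier phi x = rft (fun t => complex.Re (phi t)) x +
    iu * rft (fun t => complex.Im (phi t)) x.
Proof.
move=> tphi; have [s1 s2] := test_fun_rsmooth tphi.
have [a [b [p1 p2]]] := test_fun_bounded_supp tphi.
rewrite /rft /fourier; apply: cintegral_split.
  exact: rft_cintble (rsmooth_continuous s1) p1.
exact: rft_cintble (rsmooth_continuous s2) p2.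
Qed.

End RealParts.

Section CircleBoundary.
Variable R : realType.
Local Notation C := (Cplx R).
Local Notation mu := (@lebesgue_measure R).
Local Notation iu := (Complex 0 1 : Cplx R).
Implicit Types (c : nat -> C) (F : C -> C).

Lemma circle_dist_limit F c B (phi : R -> C) : has_expansion F c ->
  (forall n, cabs (c n) <= B) -> test_fun setT phi ->
  exists2 l, csum_cvg (fun n => c n * fourier phi (- n%:R)) l &
    clim (1 : R)^'- (fun r => cintegral (fun t => F (RtoC r * expi t) * phi t)) l.
Proof.
move=> Fc cB tphi; have [s1 s2] := test_fun_rsmooth tphi.
have [a [b [p1 p2]]] := test_fun_bounded_supp tphi.
have B0 : 0 <= B by apply: le_trans (cB 0%N); exact: cabs_ge0.
have cB' n : cabs (c n) <= B * n.+1%:R.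
  by apply: le_trans (cB n) _; rewrite ler_peMr// ler1n.
have [l1 k1 e1] := pairing_limit 0%N Fc cB' s1 p1.
have [l2 k2 e2] := pairing_limit 0%N Fc cB' s2 p2.
have tw (f : R -> R) t : twist f 0%N t = RtoC (f t).
  by rewrite /twist mul0r oppr0 expi0 mul1r.
exists (l1 + iu * l2).
  have := @climD R nat \oo oo_filter _ _ _ _ k1 (@climZ R nat \oo oo_filter iu _ _ k2); apply: eq_clim => N.
  rewrite mulr_sumr -big_split; apply: eq_bigr => n _ /=.
  by rewrite (fourier_split _ tphi) sub0r mulrDr mulrCA.
have nf := near1_filter R.
apply: (@near_eq_clim _ _ _ nf _ _ _ _ (@climD R _ _ nf _ _ _ _ e1 (@climZ R _ _ nf iu _ _ e2))).
apply: (@filterS _ _ nf _ _ _ (near1_left R)) => r r01 /=.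
have j1 := pairing_cintble 0%N Fc r01 (rsmooth_continuous s1) p1.
have j2 := pairing_cintble 0%N Fc r01 (rsmooth_continuous s2) p2.
rewrite /pairing; move: j1 j2.
under eq_fun do rewrite tw.
move=> j1.
under eq_fun do rewrite tw.
move=> j2.
by rewrite (cintegral_split j1 j2).
Qed.

Lemma kernel_series c B t0 x : (forall n, cabs (c n) <= B) ->
  exists2 l, csum_cvg (fun n => c n * kernel_at t0 (x - n%:R)) l &
    cabs l <= B * 20 * (3 * pi).
Proof.
move=> cB; have B0 : 0 <= B by apply: le_trans (cB 0%N); exact: cabs_ge0.
apply: (@dominated_csum_cvg _ _ (fun n => B * 20 * (1 ^+ 2 + (x - n%:R) ^+ 2)^-1)).
  move=> n; rewrite cabsM -mulrA; apply: ler_pM; rewrite ?cabs_ge0//.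
  by rewrite expr1n; exact: kernel_at_le.
move=> N; rewrite -mulr_sumr ler_wpM2l ?mulr_ge0//.
by have := @lattice_sum R 1 x 0 N (lexx _) (leq0n _); rewrite divr1.
Qed.

Lemma kernel_series_partial c B t0 x N : (forall n, cabs (c n) <= B) ->
  cabs (\sum_(0 <= n < N) c n * kernel_at t0 (x - n%:R)) <= B * 20 * (3 * pi).
Proof.
move=> cB; have B0 : 0 <= B by apply: le_trans (cB 0%N); exact: cabs_ge0.
apply: le_trans (cabs_sum _ _ _) _.
apply: (@le_trans _ _ (\sum_(0 <= n < N) B * 20 * (1 ^+ 2 + (x - n%:R) ^+ 2)^-1)).
  apply: ler_sum => n _; rewrite cabsM -mulrA; apply: ler_pM; rewrite ?cabs_ge0//.
  by rewrite expr1n; exact: kernel_at_le.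
rewrite -mulr_sumr ler_wpM2l ?mulr_ge0//.
by have := @lattice_sum R 1 x 0 N (lexx _) (leq0n _); rewrite divr1.
Qed.

Lemma cmeas_kernel_at t0 (s : R) : cmeas (fun x => kernel_at t0 (x - s)).
Proof.
have sub : continuous (fun x : R => x - s).
  by move=> x; apply: cvgB; [exact: cvg_id|exact: cvg_cst].
have sub' : continuous (fun x : R => - (t0 * (x - s))).
  by move=> x; apply: cvgN; apply: cvgM; [exact: cvg_cst|exact: sub].
apply: cmeasM; first by apply: cmeas_expi; exact: continuous_measurable_fun.
apply: cmeas_RtoC; apply: continuous_measurable_fun => x.
by apply: (continuous_comp (sub x)); exact: flat_top_continuous.
Qed.

Lemma cmeas_clim (f : nat -> R -> C) (g : R -> C) : (forall n, cmeas (f n)) ->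
  (forall x, clim \oo (fun n => f n x) (g x)) -> cmeas g.
Proof.
move=> mf fg; split.
  apply: (measurable_fun_cvg (h := fun n x => complex.Re (f n x))) => [n|x _].
    by have [] := mf n.
  by have /clim_ReIm[] := fg x.
apply: (measurable_fun_cvg (h := fun n x => complex.Im (f n x))) => [n|x _].
  by have [] := mf n.
by have /clim_ReIm[] := fg x.
Qed.

(** Termwise integration: the partial kernel sums are uniformly bounded, the decay of the transform
    of [phi] makes the majorant integrable, and each term is given by [kernel_at_reproduces]. *)
Lemma kernel_series_pairing c B t0 a b (G : R -> C) (phi : R -> R) l :
  (forall n, cabs (c n) <= B) ->
  (forall x, csum_cvg (fun n => c n * kernel_at t0 (x - n%:R)) (G x)) ->
  rsmooth phi -> supp_in a b phi -> t0 - 1 < a -> b < t0 + 1 ->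
  csum_cvg (fun n => c n * rft phi (- n%:R)) l ->
  cintble (fun x => G x * rft phi (- x)) /\
  cintegral (fun x => G x * rft phi (- x)) = RtoC (fejer_mass R) * l.
Proof.
move=> cB GE sphi phi0 ha hb hl.
have B0 : 0 <= B by apply: le_trans (cB 0%N); exact: cabs_ge0.
have cphi := rsmooth_continuous sphi.
have [K K0 hK] := rft_cauchyk sphi phi0.
have hK' x : cabs (rft phi (- x)) <= K * cauchyk x by have := hK (- x); rewrite /cauchyk sqrrN.
have mr : cmeas (fun x => rft phi (- x)).
  by apply: (cmeas_rft cphi phi0); exact: oppr_measurable.
have jn n : cintble (fun x => kernel_at t0 (x - n%:R) * rft phi (- x)).
  apply: (@le_cintble _ _ (fun x => 20 * K * cauchyk x)).
  - by apply: cmeasM => //; exact: cmeas_kernel_at.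
  - by apply: rintbleZ; exact: cauchyk_rintble.
  - move=> x; rewrite cabsM -mulrA; apply: ler_pM; rewrite ?cabs_ge0//.
    apply: le_trans (kernel_at_le _ _) _; rewrite ler_piMr//.
    exact: (cauchyk_le1 (x - n%:R)).
pose f N x := (\sum_(0 <= n < N) c n * kernel_at t0 (x - n%:R)) * rft phi (- x).
have mf N : cmeas (f N).
  apply: cmeasM => //; apply: cmeas_sum => n; apply: cmeasM; first exact: cmeas_cst.
  exact: cmeas_kernel_at.
have fG x : clim \oo (f ^~ x) (G x * rft phi (- x)).
  rewrite mulrC; have := @climZ R nat \oo oo_filter (rft phi (- x)) _ _ (GE x).
  by apply: eq_clim => N; rewrite mulrC.
have jg : rintble (fun x => B * 20 * (3 * pi) * K * cauchyk x).
  by apply: rintbleZ; exact: cauchyk_rintble.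
have fg N x : cabs (f N x) <= B * 20 * (3 * pi) * K * cauchyk x.
  rewrite cabsM -(mulrA _ K); apply: ler_pM; rewrite ?cabs_ge0//.
  exact: kernel_series_partial.
have [j lim1] := cintegral_dct mf fG jg fg; split => //.
apply: (clim_unique lim1); have := @climZ R nat \oo oo_filter (RtoC (fejer_mass R)) _ _ hl.
apply: eq_clim => N; rewrite mulr_sumr /f.
transitivity (cintegral (fun x => \sum_(0 <= n < N) c n * (kernel_at t0 (x - n%:R) * rft phi (- x)))).
  rewrite cintegral_sum => [|n]; last exact: cintbleZ.
  apply: eq_bigr => n _; rewrite cintegralZ// (kernel_at_reproduces n cphi phi0)//.
  by rewrite mulrCA.
by apply: eq_cintegral => x; rewrite mulr_suml; apply: eq_bigr => n _; rewrite mulrA.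
Qed.

Lemma kernel_pf_transform c (t0 k : R) (G : R -> C) : clim \oo c 0 ->
  (forall x, csum_cvg (fun n => c n * kernel_at t0 (x - n%:R)) (G x)) ->
  pf_transform (fun x => RtoC k * G x).
Proof.
move=> c0 GE; have [B B0 cB] := clim0_bounded c0.
have mG : cmeas G.
  apply: (cmeas_clim _ GE) => N; apply: cmeas_sum => n.
  by apply: cmeasM; [exact: cmeas_cst|exact: cmeas_kernel_at].
have [m1 m2] := cmeasM (cmeas_cst (RtoC k)) mG.
have lim (A : set_system R) (FA : Filter A) : (forall M : R, \forall x \near A, M <= `|x|) ->
    clim A (fun x => RtoC k * G x) 0.
  move=> hA; rewrite -(mulr0 (RtoC k)); apply: climZ.
  by apply: (conv_cvg0 hA _ (@kernel_at_le R t0) c0 GE).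
split => //; split => //; split; last split.
- exists (`|k| * (B * 20 * (3 * pi))) => x.
  rewrite cabsE lecR cabsM cabs_RtoC ler_wpM2l//.
  have [l lx hl] := kernel_series t0 x cB.
  by rewrite (clim_unique (GE x) lx).
- apply/climP; apply: lim => M.
  apply: filterS (nbhs_pinfty_ge (num_real M)) => x Mx.
  exact: le_trans Mx (ler_norm _).
- apply/climP; apply: lim => M.
  apply: filterS (nbhs_ninfty_le (num_real (- M))) => x Mx.
  by rewrite -normrN; apply: le_trans (ler_norm _); rewrite lerNr.
Qed.

Lemma circle_boundary F c : has_expansion F c -> clim \oo c 0 -> pf_boundary_circle F.
Proof.
move=> Fc c0; have [B B0 cB] := clim0_bounded c0.
have [T hT] : exists T : (R -> C) -> C, forall phi, test_fun setT phi ->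
    csum_cvg (fun n => c n * fourier phi (- n%:R)) (T phi) /\
    clim (1 : R)^'- (fun r => cintegral (fun t => F (RtoC r * expi t) * phi t)) (T phi).
  (* [T] must be defined on all functions; away from test functions it takes the arbitrary value
     0. *)
  have /choice[T hT] : forall phi : R -> C, exists l, test_fun setT phi ->
    csum_cvg (fun n => c n * fourier phi (- n%:R)) l /\
    clim (1 : R)^'- (fun r => cintegral (fun t => F (RtoC r * expi t) * phi t)) l.
    move=> phi; have [tphi|] := pselect (test_fun setT phi); last by exists 0.
    by have [l] := circle_dist_limit Fc cB tphi; exists l.
  by exists T.
split; first exact: openT.
exists T; split.
  by move=> phi /hT[_ h]; apply/climP.
(* Any radius below 1 would do: the kernel centred at [t0] reproduces only bumps supported within
   distance 1. *)
move=> t0 _; have hlf : (2^-1 : R) < 1 by lra.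
exists `]t0 - 2^-1, t0 + 2^-1[%classic; split; first exact: interval_open.
split; first by rewrite /= in_itv /=; apply/andP; split; lra.
split => //.
have /choice[G GE] : forall x : R, exists l, csum_cvg (fun n => c n * kernel_at t0 (x - n%:R)) l.
  by move=> x; have [l] := kernel_series t0 x cB; exists l.
have m0 := fejer_mass_gt0 R; have p0 := pi_gt0 R.
(* The factor cancels both the [1 / (2 pi)] of [pf_pairing] and the mass produced by the kernel. *)
exists (fun x => RtoC (2 * pi / fejer_mass R) * G x); split.
  exact: kernel_pf_transform GE.
move=> phi tphi.
have tphiT : test_fun setT phi by have [? [K [? [? ?]]]] := tphi; split => //; exists K.
have [s1 s2] := test_fun_rsmooth tphi.
have [p1 p2] : supp_in (t0 - 2^-1) (t0 + 2^-1) (fun t => complex.Re (phi t)) /\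
    supp_in (t0 - 2^-1) (t0 + 2^-1) (fun t => complex.Im (phi t)).
  apply: (test_fun_supp tphi) => x /=; rewrite !in_itv /= => /andP[h1 h2].
  by rewrite !ltW.
have ha : t0 - 1 < t0 - 2^-1 by lra.
have hb : t0 + 2^-1 < t0 + 1 by lra.
have cB' n : cabs (c n) <= B * n.+1%:R.
  by apply: le_trans (cB n) _; rewrite ler_peMr// ler1n.
have [l1 k1 _] := pairing_limit 0%N Fc cB' s1 p1.
have [l2 k2 _] := pairing_limit 0%N Fc cB' s2 p2.
have {}k1 : csum_cvg (fun n => c n * rft (fun t => complex.Re (phi t)) (- n%:R)) l1.
  by move: k1; apply: eq_clim => N; apply: eq_bigr => n _; rewrite sub0r.
have {}k2 : csum_cvg (fun n => c n * rft (fun t => complex.Im (phi t)) (- n%:R)) l2.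
  by move: k2; apply: eq_clim => N; apply: eq_bigr => n _; rewrite sub0r.
have [j1 i1] := kernel_series_pairing cB GE s1 p1 ha hb k1.
have [j2 i2] := kernel_series_pairing cB GE s2 p2 ha hb k2.
have TE : T phi = l1 + iu * l2.
  have [h _] := hT _ tphiT; apply: (clim_unique h).
  have := @climD R nat \oo oo_filter _ _ _ _ k1 (@climZ R nat \oo oo_filter iu _ _ k2); apply: eq_clim => N.
  rewrite mulr_sumr -big_split; apply: eq_bigr => n _ /=.
  by rewrite (fourier_split _ tphi) mulrDr mulrCA.
rewrite TE /pf_pairing.
have -> : cintegral (fun x => RtoC (2 * pi / fejer_mass R) * G x * fourier phi (- x)) =
    RtoC (2 * pi / fejer_mass R) * (RtoC (fejer_mass R) * l1 + iu * (RtoC (fejer_mass R) * l2)).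
  rewrite -i1 -i2 -(cintegralZ iu)// -cintegralD//; last exact: cintbleZ.
  rewrite -cintegralZ; last by apply: cintbleD => //; exact: cintbleZ.
  apply: eq_cintegral => x; rewrite (fourier_split _ tphi) -mulrA; congr (_ * _).
  by rewrite mulrDr (mulrCA (G x)).
have -> : RtoC (fejer_mass R) * l1 + iu * (RtoC (fejer_mass R) * l2) =
    RtoC (fejer_mass R) * (l1 + iu * l2) by rewrite mulrDr (mulrCA iu).
rewrite !mulrA -!RtoCM (_ : (2 * pi)^-1 * _ * _ = 1) ?RtoC1 ?mul1r//.
by rewrite mulrA mulVf ?mulf_neq0 ?pnatr_eq0 ?gt_eqF// mul1r mulVf// gt_eqF.
Qed.

End CircleBoundary.

(** * Convergence at a point *)

Section DifferenceQuotient.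
Variable R : realType.
Local Notation C := (Cplx R).
Local Notation mu := (@lebesgue_measure R).
Implicit Types (h c v : nat -> C) (F H : C -> C) (z L : C).

Lemma clim_shift (f : nat -> C) l : clim \oo f l <-> clim \oo (fun n => f n.+1) l.
Proof.
split=> hf e /hf[N _ hN].
  by exists N => // n Nn; apply: hN; exact: leqW.
by exists N.+1 => //; case=> // n Nn; exact: hN.
Qed.

Lemma csum_cvg_term0 (w : nat -> C) l : csum_cvg w l -> clim \oo w 0.
Proof.
move=> wl; have := @climB R nat \oo oo_filter _ _ _ _ ((clim_shift _ _).1 wl) wl.
rewrite subrr; apply: eq_clim => N.
by rewrite big_nat_recr//= addrAC subrr add0r.
Qed.

(* Coefficients of [(f z - f_0) / (z - zeta)] for [f = \sum_n c_n z^n]. *)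
Definition quotient_coef c L z n : C := - (z ^- n.+1 * (\sum_(0 <= k < n.+1) c k * z ^+ k - L)).

(** The Taylor coefficients of [F z - L]. *)
Definition shift0 c L n : C := if n is n'.+1 then c n else c 0%N - L.

(** Multiplying the quotient series back by its denominator: [shift0 c L n] is the quotient
    coefficient at [n - 1] (0 when [n = 0]) minus [z] times the one at [n]. The weights [v] are
    arbitrary because both powers of a point of the disc and Fourier transforms at [m - n] are
    substituted for them. *)
Lemma quotient_coef_by_parts c L z v N : z != 0 ->
  \sum_(0 <= n < N) quotient_coef c L z n * (v n.+1 - z * v n) =
  \sum_(0 <= n < N.+1) shift0 c L n * v n + z * (quotient_coef c L z N * v N).
Proof.
move=> z0.
have h0 : shift0 c L 0 = - (z * quotient_coef c L z 0).
  by rewrite /quotient_coef big_nat1 expr0 mulr1 mulrN opprK mulrA expr1 divff// mul1r.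
have hS n : c n.+1 = quotient_coef c L z n - z * quotient_coef c L z n.+1.
  have zn : z ^+ n.+1 != 0 by rewrite expf_neq0.
  have zS : z ^+ n.+2 = z * z ^+ n.+1 by rewrite exprS.
  rewrite /quotient_coef (big_nat_recr n.+1)//= zS.
  move: (\sum_(0 <= k < n.+1) _) => S.
  by move: (z ^+ n.+1) zn (c n.+1) => Z zn d; field; rewrite z0 zn.
elim: N => [|N IH].
  by rewrite big_geq// big_nat1 h0; ring.
by rewrite big_nat_recr//= IH (big_nat_recr N.+1)//= hS; ring.
Qed.

Lemma quotient_csum c L z v l : z != 0 ->
  clim \oo (fun n => quotient_coef c L z n * v n) 0 ->
  csum_cvg (fun n => shift0 c L n * v n) l <->
  csum_cvg (fun n => quotient_coef c L z n * (v n.+1 - z * v n)) l.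
Proof.
move=> z0 hv; have zhv := @climZ R nat \oo oo_filter z _ _ hv; rewrite mulr0 in zhv.
split=> hl.
  have := @climD R nat \oo oo_filter _ _ _ _ ((clim_shift _ _).1 hl) zhv; rewrite addr0.
  by apply: eq_clim => N; rewrite quotient_coef_by_parts.
have := @climB R nat \oo oo_filter _ _ _ _ hl zhv; rewrite subr0.
move=> h; apply/clim_shift; move: h.
by apply: eq_clim => N; rewrite quotient_coef_by_parts// addrK.
Qed.

Lemma quotient_coef_growth c L z B : cabs z = 1 -> (forall n, cabs (c n) <= B) ->
  forall n, cabs (quotient_coef c L z n) <= (B + cabs L) * n.+1%:R.
Proof.
move=> z1 cB n.
rewrite /quotient_coef cabsN cabsM cabsV cabsX z1 expr1n invr1 mul1r.
apply: le_trans (cabsB _ _) _; rewrite mulrDl; apply: lerD; last first.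
  by rewrite ler_peMr ?ler1n// cabs_ge0.
apply: le_trans (cabs_sum _ _ _) _.
apply: (@le_trans _ _ (\sum_(0 <= k < n.+1) B)).
  by apply: ler_sum => k _; rewrite cabsM cabsX z1 expr1n mulr1.
by rewrite sumr_const_nat subn0 mulr_natr.
Qed.

(** With [s = (1 + r) / 2], the inequality [r <= s^2] leaves one factor [s^n] to spare, while
    [(n + 1) s^n] is at most the geometric sum up to [n]. *)
Lemma natr_geometric_cvg0 (r : R) : 0 <= r < 1 -> (fun n => n.+1%:R * r ^+ n) @ \oo --> (0 : R).
Proof.
move=> /andP[r0 r1]; pose s := (1 + r) / 2.
have s0 : 0 <= s by rewrite /s; lra.
have s1 : s < 1 by rewrite /s; lra.
have rs : r <= s * s by rewrite /s; have := sqr_ge0 (1 - r); nra.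
have ns n : n.+1%:R * s ^+ n <= (1 - s)^-1.
  apply: le_trans (geometric_sum_le n.+1 _); last by rewrite s0.
  have -> : n.+1%:R * s ^+ n = \sum_(0 <= k < n.+1) s ^+ n.
    by rewrite sumr_const_nat subn0 mulr_natl.
  rewrite !big_mkord; apply: ler_sum => k _.
  by apply: ler_wiXn2l => //; [exact: ltW|rewrite -ltnS].
apply: (@squeeze_cvgr _ _ _ _ (fun=> 0) (fun n => (1 - s)^-1 * s ^+ n)).
- apply: nearW => n; rewrite mulr_ge0 ?exprn_ge0//=.
  apply: (@le_trans _ _ (n.+1%:R * (s * s) ^+ n)).
    rewrite ler_wpM2l//; elim: n => // n IH.
    by rewrite !exprS ler_pM// exprn_ge0.
  by rewrite exprMn mulrA ler_wpM2r// exprn_ge0.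
- exact: cvg_cst.
- rewrite -[X in _ --> X](mulr0 (1 - s)^-1); apply: cvgM; first exact: cvg_cst.
  by apply: cvg_expr; rewrite ger0_norm.
Qed.

Lemma shift0_csum c L v l : csum_cvg (fun n => c n * v n) l ->
  csum_cvg (fun n => shift0 c L n * v n) (l - L * v 0%N).
Proof.
move=> hl; apply/clim_shift.
have := @climB R nat \oo oo_filter _ _ _ _ ((clim_shift _ _).1 hl)
  (@clim_cst R nat \oo oo_filter (L * v 0%N)).
apply: eq_clim => N; rewrite !(big_nat_recl N)//= mulrBl; ring.
Qed.

Lemma has_expansion_quotient F c L z B : has_expansion F c -> cabs z = 1 ->
  (forall n, cabs (c n) <= B) ->
  has_expansion (fun y => (F y - L) / (y - z)) (quotient_coef c L z).
Proof.
move=> Fc z1 cB y y1.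
have z0 : z != 0 by apply/eqP => z0; move: z1; rewrite z0 cabs0; lra.
have yz : y - z != 0.
  by rewrite subr_eq0; apply/eqP => yz; move: y1; rewrite yz z1; lra.
have hv : clim \oo (fun n => quotient_coef c L z n * y ^+ n) 0.
  have yr : 0 <= cabs y < 1 by rewrite cabs_ge0.
  apply: (@clim_squeeze R nat \oo oo_filter _ _
    (fun n => (B + cabs L) * (n.+1%:R * cabs y ^+ n))).
    apply: nearW => n; rewrite subr0 cabsM cabsX mulrA ler_wpM2r ?exprn_ge0 ?cabs_ge0//.
    exact: quotient_coef_growth.
  rewrite -[X in _ --> X](mulr0 (B + cabs L)); apply: cvgM; first exact: cvg_cst.
  exact: natr_geometric_cvg0.
have := shift0_csum L (Fc y y1); rewrite expr0 mulr1 => /(quotient_csum _ z0 hv) h.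
have := @climZ R nat \oo oo_filter (y - z)^-1 _ _ h; rewrite mulrC.
apply: eq_clim => N; rewrite mulr_sumr; apply: eq_bigr => n _.
by rewrite exprS -mulrBl mulrCA mulKf.
Qed.

End DifferenceQuotient.

(** * The partition of unity around the point and the conclusion *)

Section Convergence.
Variable R : realType.
Local Notation C := (Cplx R).
Local Notation mu := (@lebesgue_measure R).
Implicit Types (h c v : nat -> C) (F H : C -> C) (L : C).

(** Equal to [|e^{it} - e^{i t0}|^2]: a real multiple of the denominator of the difference
    quotient. *)
Definition sqdist (t0 t : R) : R := 2 - 2 * cos (t - t0).

Lemma sqdist_ge0 t0 t : 0 <= sqdist t0 t.
Proof. by rewrite /sqdist; have := cos_le1 (t - t0); lra. Qed.

Lemma sqdist_gt0 t0 t : t != t0 -> `|t - t0| < 2 * pi -> 0 < sqdist t0 t.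
Proof.
rewrite -subr_eq0 /sqdist => x0 xp; set x := t - t0 in x0 xp *.
have -> : 2 - 2 * cos x = 4 * sin (x / 2) ^+ 2.
  have {1}-> : x = x / 2 + x / 2 by field.
  by rewrite cosD; have := cos2Dsin2 (x / 2); rewrite !expr2; lra.
rewrite mulr_gt0// exprn_even_gt0//=.
have [{}x0|{}x0|xx] := ltgtP x 0; last by rewrite xx eqxx in x0.
  rewrite ltr0_norm// in xp.
  by rewrite -oppr_eq0 -sinN gt_eqF// sin_gt0_pi//; apply/andP; split; lra.
rewrite gtr0_norm// in xp.
by rewrite gt_eqF// sin_gt0_pi//; apply/andP; split; lra.
Qed.

Lemma rsmooth_sqdist t0 : rsmooth (sqdist t0).
Proof.
apply: rsmoothB; first exact: rsmooth_cst.
apply: rsmoothM; first exact: rsmooth_cst.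
by apply: (@rsmooth_shift _ _ t0); exact: rsmooth_cos.
Qed.

(** With [z = e^{i t0}] and [v] the transform of [(e^{-it} - z^{-1}) w], the right side is
    [v(k - 1) - z v(k)], the shape that [quotient_csum] requires. *)
Lemma rft_sqdist_mul a b (w : R -> R) t0 k : continuous w -> supp_in a b w ->
  rft (fun t => sqdist t0 t * w t) k =
  (rft w k - (expi t0)^-1 * rft w (k - 1)) -
  expi t0 * (rft w (k + 1) - (expi t0)^-1 * rft w k).
Proof.
move=> cw w0; pose f k t : C := expi (- (k * t)) * RtoC (w t).
have jf j : cintble (f j) := rft_cintble j cw w0.
transitivity (cintegral (fun t => (f k t - (expi t0)^-1 * f (k - 1) t) -
    expi t0 * (f (k + 1) t - (expi t0)^-1 * f k t))).
  apply: eq_cintegral => t; rewrite /f.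
  have -> : expi (- ((k - 1) * t)) = expi (- (k * t)) * expi t :> C.
    by rewrite -expiD; congr expi; ring.
  have -> : expi (- ((k + 1) * t)) = expi (- (k * t)) * (expi t)^-1 :> C.
    by rewrite -expiN -expiD; congr expi; ring.
  rewrite RtoCM /sqdist.
  have -> : RtoC (2 - 2 * cos (t - t0)) = 2 - expi t * (expi t0)^-1 - (expi t)^-1 * expi t0 :> C.
    rewrite -!expiN -!expiD.
    have -> : - t + t0 = - (t - t0) by ring.
    by apply: C_ext; rewrite ?Re_add ?Im_add ?Re_opp ?Im_opp /= ?cosN ?sinN; ring.
  move: (@expi_neq0 R t) (@expi_neq0 R t0).
  move: (expi t) (expi t0) (expi (- (k * t))) (RtoC (w t)) => x y p q x0 y0.
  by field; rewrite x0 y0.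
have jB (f1 f2 : R -> C) y : cintble f1 -> cintble f2 -> cintble (fun t => f1 t - y * f2 t).
  move=> j1 j2; have := cintbleD j1 (cintbleZ (- y) j2).
  by under eq_fun do rewrite mulNr.
rewrite cintegralB; [|exact: jB|by apply: cintbleZ; exact: jB].
rewrite cintegralB//; last exact: cintbleZ.
rewrite [X in _ - X = _]cintegralZ; last exact: jB.
rewrite [X in _ - _ * X = _]cintegralB//; last exact: cintbleZ.
by rewrite !cintegralZ.
Qed.

(** One factor of [sqdist] cancels the denominator and turns the quotient coefficients into those of
    [F - L], which tend to 0; the other stays with the bump in [v]. What remains is a convolution
    covered by [conv_cvg0]. *)
Lemma far_part_good H c L t0 a b (w : R -> R) B :
  has_expansion H (quotient_coef c L (expi t0)) ->
  (forall n, cabs (c n) <= B) -> clim \oo c 0 -> rsmooth w -> supp_in a b w ->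
  good H (fun t => sqdist t0 t * w t).
Proof.
move=> Hh cB c0 sw w0; set z : C := expi t0; set h := quotient_coef c L z.
have z1 : cabs z = 1 by exact: cabs_expi.
have z0 : z != 0 by exact: expi_neq0.
have hB := quotient_coef_growth L z1 cB.
have cw := rsmooth_continuous sw.
have sD : rsmooth (fun t => sqdist t0 t * w t) by apply: rsmoothM => //; exact: rsmooth_sqdist.
have D0 : supp_in a b (fun t => sqdist t0 t * w t) by move=> t /w0 ->; rewrite mulr0.
pose v (x : R) : C := rft w (x + 1) - z^-1 * rft w x.
have term0 m : clim \oo (fun n => h n * rft w (m%:R - n%:R)) 0.
  by have [l hl _] := pairing_limit m Hh hB sw w0; exact: csum_cvg_term0 hl.
have hv m : clim \oo (fun n => h n * v (m%:R - n%:R)) 0.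
  have := @climB R nat \oo oo_filter _ _ _ _ (term0 m.+1)
    (@climZ R nat \oo oo_filter z^-1 _ _ (term0 m)).
  rewrite mulr0 subr0; apply: eq_clim => n.
  by rewrite /v -natr1 addrAC mulrBr (mulrCA (h n)).
have /choice[l Hl] : forall m, exists l, csum_cvg (fun n => shift0 c L n * v (m%:R - n%:R)) l /\
    clim (1 : R)^'- (fun r => pairing H (fun t => sqdist t0 t * w t) r m) l.
  move=> m; have [l hl lim] := pairing_limit m Hh hB sD D0.
  exists l; split => //; apply/(quotient_csum _ z0 (hv m)).
  move: hl; apply: eq_clim => N; apply: eq_bigr => n _; congr (_ * _).
  rewrite (rft_sqdist_mul _ _ cw w0) /v -natr1.
  have -> : m%:R - (n%:R + 1) + 1 = m%:R - n%:R :> R by ring.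
  by have -> : m%:R - (n%:R + 1) = m%:R - n%:R - 1 :> R by ring.
exists l => [m|]; first by case: (Hl m).
have [K K0 hK] := rft_cauchyk sw w0.
(* The constant is [4 K = 3 K + K]: the shifted term obeys [1 + x^2 <= 3 (1 + (x + 1)^2)]. *)
apply: (@conv_cvg0 R nat \oo oo_filter (fun m => m%:R) (shift0 c L) v (4 * K)) => [A||x||m].
- exists (`|Num.ceil A|)%N => // m /= Am; rewrite ger0_norm//.
  by apply: le_trans (le_absz_ceil A) _; rewrite ler_nat.
- by rewrite mulr_ge0.
- apply: le_trans (cabsB _ _) _; rewrite cabsM cabsV z1 invr1 mul1r.
  have p0 : 0 < 1 + x ^+ 2 by have := sqr_ge0 x; lra.
  have p1 : 0 < 1 + (x + 1) ^+ 2 by have := sqr_ge0 (x + 1); lra.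
  have -> : 4 * K / (1 + x ^+ 2) = 3 * K / (1 + x ^+ 2) + K / (1 + x ^+ 2) by ring.
  apply: lerD (hK _); apply: le_trans (hK _) _; rewrite /cauchyk.
  rewrite ler_pdivlMr// mulrAC ler_pdivrMr// mulrAC mulrC ler_wpM2r//.
  by have := sqr_ge0 (2 * x + 3); nra.
- by apply/clim_shift; exact: ((clim_shift _ _).1 c0).
- by case: (Hl m).
Qed.

Lemma series_cvg_at F c L t0 : has_expansion F c -> clim \oo c 0 ->
  lpf_boundary_at (fun z => (F z - L) / (z - expi t0)) t0 ->
  csum_cvg (fun n => c n * expi t0 ^+ n) L.
Proof.
move=> Fc c0 [U [_ [Ut0 HU]]]; have [d d0 hd] := lpf_good HU Ut0.
have [B B0 cB] := clim0_bounded c0.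
set z : C := expi t0 in HU hd *.
have z1 : cabs z = 1 by exact: cabs_expi.
set H := (fun y => _) in HU hd; set h := quotient_coef c L z.
have Hh : has_expansion H h by exact: has_expansion_quotient Fc z1 cB.
have p2 := @pi_ge2 R.
(* On the support of this cutoff [|t - t0| <= pi + 1 < 2 pi], so [sqdist] vanishes there only at
   [t0]. *)
pose X := circle_cutoff (t0 - pi).
have sX : rsmooth X := rsmooth_circle_cutoff _.
have X0 : supp_in (t0 - pi) (t0 + pi + 1) X.
  have := @supp_circle_cutoff R (t0 - pi).
  by have -> : t0 - pi + 2 * pi + 1 = t0 + pi + 1 by ring.
pose q t := unit_bump (d^-1 * t + - (d^-1 * t0)).
have sq : rsmooth q by apply: rsmooth_affine; exact: rsmooth_unit_bump.
have qE t : q t = unit_bump ((t - t0) / d) by rewrite /q; congr unit_bump; ring.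
have q0 t : 0 <= q t by rewrite /q; exact: unit_bump_ge0.
have supp_q : supp_in (t0 - d) (t0 + d) q.
  move=> t; rewrite in_itv /= negb_and -!ltNge => ht; rewrite qE; apply: supp_unit_bump.
  rewrite in_itv /= negb_and -!ltNge ltr_pdivrMr// ltr_pdivlMr//.
  by apply/orP; case/orP: ht => ht; [left|right]; lra.
(* [o] vanishes on the support of [X] and is positive off it. Adding it makes the denominator [D]
   nonzero on the whole line, so that its inverse is smooth, without changing the products with
   [X]. *)
pose o t := smooth_step (- 1 * t + (t0 - pi)) + smooth_step (1 * t + (- (t0 + pi + 1))).
have so : rsmooth o by apply: rsmoothD; apply: rsmooth_affine; exact: rsmooth_step.
have o0 t : 0 <= o t by rewrite addr_ge0// smooth_step_ge0.
pose D t := sqdist t0 t + q t + o t.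
have sD : rsmooth D by apply: rsmoothD => //; apply: rsmoothD => //; exact: rsmooth_sqdist.
have D0 t : D t != 0.
  have h1 := sqdist_ge0 t0 t; have h2 := q0 t; have h3 := o0 t.
  suff : 0 < sqdist t0 t \/ 0 < q t \/ 0 < o t.
    by rewrite /D => -[|[|]] ?; rewrite gt_eqF//; lra.
  case: (ltP t (t0 - pi)) => h4.
    right; right; have : 0 < smooth_step (-1 * t + (t0 - pi)) by apply: smooth_step_gt0; lra.
    by have := smooth_step_ge0 (1 * t + - (t0 + pi + 1)); rewrite /o; lra.
  case: (ltP (t0 + pi + 1) t) => h5.
    right; right; have : 0 < smooth_step (1 * t + - (t0 + pi + 1)).
      by apply: smooth_step_gt0; lra.
    by have := smooth_step_ge0 (- 1 * t + (t0 - pi)); rewrite /o; lra.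
  case: (eqVneq t t0) => [->|tt].
    right; left; rewrite qE subrr mul0r /unit_bump add0r (smooth_step1 (lexx 1)).
    by rewrite (smooth_step0 (lexx 0)) subr0.
  left; apply: sqdist_gt0 => //; rewrite ltr_norml; apply/andP; split; lra.
pose w t := X t * (D t)^-1.
have sw : rsmooth w by apply: rsmoothM => //; exact: rsmoothV.
have w0 : supp_in (t0 - pi) (t0 + pi + 1) w by move=> t /X0; rewrite /w => ->; rewrite mul0r.
have oX t : o t * X t = 0.
  case: (boolP (t \in `[t0 - pi, t0 + pi + 1])) => [|/X0 ->]; last by rewrite mulr0.
  rewrite in_itv /= => /andP[h1 h2].
  by rewrite /o !smooth_step0 ?addr0 ?mul0r//; lra.
have XE : X = fun t => q t * w t + sqdist t0 t * w t.
  apply/funext => t; rewrite -mulrDl /w.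
  have -> : q t + sqdist t0 t = D t - o t by rewrite /D; ring.
  rewrite mulrBl mulrCA divff// mulr1.
  by rewrite mulrA oX mul0r subr0.
(* The modulus of the quotient coefficient [h n] is that of the partial sum through index [n] minus
   [L], so [h] tending to 0 is the claim. *)
suff gX : good H X.
  have h0 := cutoff_coef Hh gX.
  apply/clim_shift => e /h0[N _ hN]; exists N => // n Nn.
  have := hN n Nn; rewrite /= subr0 /h /quotient_coef cabsN cabsM cabsV cabsX z1 expr1n.
  by rewrite invr1 mul1r.
have s1 : rsmooth (fun t => q t * w t) by exact: rsmoothM.
have s2 : rsmooth (fun t => sqdist t0 t * w t).
  by apply: rsmoothM => //; exact: rsmooth_sqdist.
have p1 : supp_in (t0 - pi) (t0 + pi + 1) (fun t => q t * w t).
  by move=> t /w0 ->; rewrite mulr0.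
have p2' : supp_in (t0 - pi) (t0 + pi + 1) (fun t => sqdist t0 t * w t).
  by move=> t /w0 ->; rewrite mulr0.
have g1 : good H (fun t => q t * w t).
  apply: (hd (t0 - d) (t0 + d)) => //.
  by move=> t /supp_q ->; rewrite mul0r.
have g2 := far_part_good Hh cB c0 sw w0.
rewrite XE; exact: (goodD Hh s1 p1 s2 p2' g1 g2).
Qed.

End Convergence.

Theorem theorem6p4 (R : realType) (c : nat -> Cplx R) (F : Cplx R -> Cplx R)
    (E : set (Cplx R)) :
  (forall z : Cplx R, `|z| < 1 ->
     series (fun n => c n * z ^+ n) @ \oo --> F z) ->
  E `<=` [set z | `|z| = 1] ->
  closed E ->
  (lebesgue_measure [set t : R | E (expi t)] = 0)%E ->
  lpf_boundary F [set t : R | ~ E (expi t)] ->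
  (forall t : R, E (expi t) ->
     exists M : R, forall N : nat,
       `|\sum_(0 <= n < N.+1) c n * expi t ^+ n| <= RtoC M) ->
  pf_boundary_circle F /\
  c n @[n --> \oo] --> (0 : Cplx R) /\
  (forall (t0 : R) (L : Cplx R),
     lpf_boundary_at (fun z => (F z - L) / (z - expi t0)) t0 ->
     series (fun n => c n * expi t0 ^+ n) @ \oo --> L).
Proof.
move=> Fc _ _ E0 FE SE.
have Fc' : has_expansion F c.
  move=> z z1; apply/csum_cvgP; apply: Fc.
  by rewrite cabsE -RtoC1 ltcR.
have c0 : clim \oo c 0.
  apply: (coef_cvg0 Fc' E0 FE) => t /SE[M hM].
  by exists M => N; have := hM N; rewrite cabsE lecR.
split; first exact: circle_boundary Fc' c0.
split; first exact/climP.
by move=> t0 L h; apply/csum_cvgP; exact: series_cvg_at Fc' c0 h.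
Qed.
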